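(* Let $\mathcal A$ and $\mathcal B$ be complex $C^\ast$-algebras and let $\Phi\colon\mathcal A\to\mathcal B$ be a BJ isomorphism. Suppose $\mathcal A$ is finite-dimensional and has no abelian summand. Then $\mathcal A$ and $\mathcal B$ are isomorphic $C^\ast$-algebras, and there exist a real-linear surjective isometry $\Psi\colon\mathcal A\to\mathcal B$, a function $\gamma\colon\mathcal A\to\mathbb T$, and a function $P\colon\mathcal A\to Z(\mathcal A)$ such that for every $X\in\mathcal A$, $P(X)$ is positive definite and $M_0(X)=M_0(P(X)X)$, and $$\Phi(X)=\Psi\big(\gamma(X)P(X)\cdot X\big),\qquad X\in\mathcal A.$$
   Context: For elements $x,y$ of a complex normed space, $x$ is Birkhoff–James (BJ) orthogonal to $y$, written $x\perp y$, if $\|x+\lambda y\|\ge\|x\|$ for all $\lambda\in\mathbb C$. A BJ isomorphism is a bijective map $\Phi$ that strongly preserves BJ orthogonality, i.e. $x\perp y$ if and only if $\Phi(x)\perp\Phi(y)$. Every finite-dimensional complex $C^\ast$-algebra is $\ast$-isomorphic to $\mathcal A=\bigoplus_{k=1}^\ell M_{n_k}(\mathbb C)$ (with the operator/spectral norm), regarded as block-diagonal matrices inside $M_N(\mathbb C)$, $N=n_1+\dots+n_\ell$. The abelian summand of $\mathcal A$ is the direct sum of its $1\times1$ blocks ($n_k=1$); ''no abelian summand'' means all $n_k\ge2$. $Z(\mathcal A)=\bigoplus_k\mathbb C I_{n_k}$ is the center of $\mathcal A$. For $A\in\mathcal A\subseteq M_N(\mathbb C)$, $M_0(A):=\mathrm{Ker}(\|A\|^2I-A^\ast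 A)=\{x\in\mathbb C^N:\|Ax\|=\|A\|\,\|x\|\}$ (Euclidean norm on vectors). $\mathbb T\subseteq\mathbb C$ is the unit circle. *)

(* Defs.v *)
From HB Require Import structures.
From mathcomp Require Import all_boot all_order all_algebra.
From mathcomp Require Import boolp classical_sets reals.
From mathcomp Require Import complex.
Set Implicit Arguments. Unset Strict Implicit. Unset Printing Implicit Defensive.
Import Order.TTheory GRing.Theory Num.Theory.
Local Open Scope ring_scope.
Local Open Scope classical_set_scope.

(* Scalars: the complex numbers R[i] over an arbitrary real field R : realType
   (every realType is a complete archimedean ordered field, i.e. a copy of ℝ). *)

Definition BJ_orth (R : realType) (T : Type) (add : T -> T -> T)
  (scale : R[i] -> T -> T) (nrm : T -> R) (x y : T) : Prop :=
  forall lam : R[i], nrm x <= nrm (add x (scale lam y)).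

Definition BJ_isomorphism (R : realType) (T U : Type)
  (addT : T -> T -> T) (scaleT : R[i] -> T -> T) (nT : T -> R)
  (addU : U -> U -> U) (scaleU : R[i] -> U -> U) (nU : U -> R)
  (f : T -> U) : Prop :=
  bijective f /\
  forall x y, BJ_orth addT scaleT nT x y <-> BJ_orth addU scaleU nU (f x) (f y).

Record CstarAlgebra (R : realType) := {
  cs_V :> lmodType R[i];
  cs_mul : cs_V -> cs_V -> cs_V;
  cs_star : cs_V -> cs_V;
  cs_norm : cs_V -> R;
  cs_mulA : forall x y z, cs_mul x (cs_mul y z) = cs_mul (cs_mul x y) z;
  cs_mulDl : forall (a : R[i]) x y z,
      cs_mul (a *: x + y) z = a *: cs_mul x z + cs_mul y z;
  cs_mulDr : forall (a : R[i]) x y z,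
      cs_mul x (a *: y + z) = a *: cs_mul x y + cs_mul x z;
  cs_starK : forall x, cs_star (cs_star x) = x;
  cs_starD : forall x y, cs_star (x + y) = cs_star x + cs_star y;
  cs_starZ : forall (a : R[i]) x, cs_star (a *: x) = (Num.conj a) *: cs_star x;
  cs_starM : forall x y, cs_star (cs_mul x y) = cs_mul (cs_star y) (cs_star x);
  cs_norm_eq0 : forall x, cs_norm x = 0 -> x = 0;
  cs_normD : forall x y, cs_norm (x + y) <= cs_norm x + cs_norm y;
  cs_normZ : forall (a : R[i]) x, cs_norm (a *: x) = ComplexField.Normc.normc a * cs_norm x;
  cs_normM : forall x y, cs_norm (cs_mul x y) <= cs_norm x * cs_norm y;
  cs_Cstar : forall x, cs_norm (cs_mul (cs_star x) x) = cs_norm x ^+ 2;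
  cs_complete : forall u : nat -> cs_V,
      (forall e : R, 0 < e -> exists N : nat, forall p q : nat,
          (N <= p)%N -> (N <= q)%N -> cs_norm (u p - u q) < e) ->
      exists lim : cs_V, forall e : R, 0 < e -> exists N : nat,
          forall p : nat, (N <= p)%N -> cs_norm (u p - lim) < e
}.

(* ---------- The finite-dimensional C*-algebra  ⊕_{k<l} M_{n_k}(C) ---------- *)
Definition BD (R : realType) (l : nat) (n : 'I_l -> nat) : Type :=
  forall k : 'I_l, 'M[R[i]]_(n k).

Section BlockDiag.
Variables (R : realType) (l : nat) (n : 'I_l -> nat).

Definition bd_add (X Y : BD R n) : BD R n := fun k => X k + Y k.
Definition bd_scale (a : R[i]) (X : BD R n) : BD R n := fun k => a *: X k.
Definition bd_mul (X Y : BD R n) : BD R n := fun k => X k *m Y k.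
Definition bd_star (X : BD R n) : BD R n := fun k => (map_mx Num.conj (X k))^T.

Definition bdN : nat := (\sum_(k < l) n k)%N.
Definition blk (X : BD R n) : 'M[R[i]]_bdN := \mxdiag_(k < l) X k.

Definition vnorm (m : nat) (x : 'cV[R[i]]_m) : R :=
  Num.sqrt (\sum_(i < m) ComplexField.Normc.normc (x i 0) ^+ 2).
Definition mxnorm (m : nat) (M : 'M[R[i]]_m) : R :=
  sup [set vnorm (M *m x) | x in [set x : 'cV[R[i]]_m | vnorm x <= 1]].

Definition bd_norm (X : BD R n) : R := mxnorm (blk X).

Definition M0 (X : BD R n) : set 'cV[R[i]]_bdN :=
  [set x | vnorm (blk X *m x) = bd_norm X * vnorm x].

Definition in_center (X : BD R n) : Prop :=
  forall k : 'I_l, exists c : R[i], X k = c%:M.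

Definition posdef (m : nat) (M : 'M[R[i]]_m) : Prop :=
  forall x : 'cV[R[i]]_m, x != 0 -> 0 < ((map_mx Num.conj x)^T *m M *m x) 0 0.

Definition star_isomorphic (B : CstarAlgebra R) : Prop :=
  exists f : BD R n -> B,
    [/\ bijective f,
        forall X Y, f (bd_add X Y) = f X + f Y,
        forall (a : R[i]) X, f (bd_scale a X) = a *: f X,
        forall X Y, f (bd_mul X Y) = cs_mul (f X) (f Y) &
        forall X, f (bd_star X) = cs_star (f X)].

Definition real_linear_surj_isometry (B : CstarAlgebra R) (Psi : BD R n -> B) : Prop :=
  [/\ forall X Y, Psi (bd_add X Y) = Psi X + Psi Y,
      forall (r : R) X, Psi (bd_scale (r%:C)%C X) = (r%:C)%C *: Psi X,
      forall X, cs_norm (Psi X) = bd_norm X &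
      forall y : B, exists X, Psi X = y].

End BlockDiag.

(* Main.v *)
(* A nonzero [X] is Birkhoff-James orthogonal to every [Y] with [v^T Y w = 0] for suitable vectors
   [v], [w] in a common block, and the sets [X^perp] ([X] nonzero) that are minimal for inclusion are
   the kernels of the functionals [Y |-> v^T Y w]. Hence a BJ isomorphism between block algebras
   induces a bijection between lines of rank one tensors which preserves linear dependence in both
   directions. By the fundamental theorem of projective geometry it is semilinear in each variable
   (or with the variables exchanged) on each block; since rank one matrices go to rank one matrices,
   it also preserves orthogonality, so the field automorphism is the identity or the conjugation and
   the linear parts are unitary after scaling. The isometry [Psi0] obtained in this way has the same
   zeros [v^T (Psi0 X) w] as [Phi X], so that [Phi X] and [Psi0 X] differ by a nonzero scalar [g X k]
   on each block [k].

   To compare the scalars on different blocks one uses matrices [z^* E_ij + z'^* E_mn] with one entry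
   in each of two blocks: orthogonality to them forces the antilinearity of [Psi0] to be the same on
   all blocks, and the phase of [g X k / g X l] to be independent of [X]; this phase is absorbed in
   the isometry. Testing [X] against [X] with the block [k] removed shows that [k] contains maximal
   vectors of [X] if and only if it contains maximal vectors of the rescaled matrix, which gives the
   equality of the sets [M0].

   The codomain [B] is not known to be finite-dimensional or unital beforehand. Since [E_ij] is
   orthogonal to [Y] exactly when [Y i j = 0], and since by the Hahn-Banach theorem [b^perp] contains
   the kernel of a functional for each [b], the elements of [B] satisfy a uniform linear dependence
   condition. A maximal family of orthogonal projections then gives matrix units for [B], and the
   C*-norm is determined by the involutive algebra through [norm (a ^ (2 ^ k)) = norm a ^ (2 ^ k)]
   for [a] self-adjoint. *)

Require Import Defs.
From HB Require Import structures.
From mathcomp Require Import all_boot all_order all_algebra.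
From mathcomp Require Import boolp classical_sets reals.
From mathcomp Require Import complex.
From mathcomp Require Import ring lra.
Import Order.TTheory GRing.Theory Num.Theory.
Local Open Scope ring_scope.
Local Open Scope classical_set_scope.
Set Implicit Arguments. Unset Strict Implicit. Unset Printing Implicit Defensive.
Import ComplexField.Normc.

(** * Euclidean and spectral norms *)

Section Norms.
Variable R : realType.
Local Notation C := R[i].
Local Notation cj := (map_mx (@Num.conj C)).

(** A block of size two gives only a projective line, on which every bijection is a collineation, so
    the fundamental theorem cannot be applied to one variable at a time. What saves it is that
    dependence of tensors is preserved, and not only dependence of vectors: modulo [e_i] tensor
    [e_j], dependence of three tensors of the form [(e_0 + a e_i)] tensor [(e_0 + b e_j)] expresses
    collinearity of three points [(a, b)] in an affine plane, and a plane is enough. The second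
    index of a block also separates the two kinds of lines of tensors, provides the vectors that
    test orthogonality, and leaves room for two disjoint test entries in each block when phases are
    compared.

    [Phi] is not additive, and the scalars [g X k] depend on [X] without any regularity. The
    comparisons are therefore made on pairs for which orthogonality can be decided: rank one
    matrices, matrices with one entry in each of two blocks, and truncations of [X]. Each time
    orthogonality is certified by a vector or a block that attains the norm, and refuted by a
    direction in which the norm decreases. *)

Lemma eq_of_le (x y : R) : x <= y -> y <= x -> x = y.
Proof. by move=> h h'; apply: le_anti; rewrite h h'. Qed.

Lemma normC_normc (z : C) : `|z| = (normc z)%:C%C.
Proof. by []. Qed.

Lemma normc_ge0 (z : C) : 0 <= normc z.
Proof. by rewrite -lecR -normC_normc normr_ge0. Qed.

Lemma normcD (x y : C) : normc (x + y) <= normc x + normc y.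
Proof. exact: le_normcD. Qed.

Lemma normc_conj (z : C) : normc (Num.conj z) = normc z.
Proof. by apply: complexI; rewrite -!normC_normc norm_conjC. Qed.

Lemma normc_eq0 (z : C) : (normc z == 0) = (z == 0).
Proof. by apply/eqP/eqP => [/eq0_normc//|->]; rewrite normc0. Qed.

Lemma normc_sum (I : Type) (r : seq I) (P : pred I) (F : I -> C) :
  normc (\sum_(i <- r | P i) F i) <= \sum_(i <- r | P i) normc (F i).
Proof.
elim/big_rec2: _ => [|i y x _ H]; first by rewrite normc0.
by apply: le_trans (normcD _ _) _; rewrite lerD2l.
Qed.

Lemma mulC_conj (z : C) : z^* * z = (normc z ^+ 2)%:C%C.
Proof. by rewrite mulrC -normCK normC_normc rmorphXn. Qed.

Lemma normc_real (t : R) : 0 <= t -> normc t%:C%C = t.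
Proof. by move=> t0; apply: complexI; rewrite -normC_normc ger0_norm // ler0c. Qed.

Lemma sum_CauchySchwarz (I : finType) (a b : I -> R) :
  \sum_i a i * b i <=
    Num.sqrt (\sum_i a i ^+ 2) * Num.sqrt (\sum_i b i ^+ 2).
Proof.
set A := \sum_i a i ^+ 2; set B := \sum_i b i ^+ 2.
have A0 : 0 <= A by apply: sumr_ge0 => i _; apply: sqr_ge0.
have B0 : 0 <= B by apply: sumr_ge0 => i _; apply: sqr_ge0.
have z (f : I -> R) : \sum_i f i ^+ 2 = 0 -> forall i, f i = 0.
  move=> /eqP; rewrite psumr_eq0 => [/allP H i|i _]; last exact: sqr_ge0.
  by have := H i (mem_index_enum _); rewrite sqrf_eq0 => /eqP.
have [A00|An0] := eqVneq A 0.
  by rewrite A00 sqrtr0 mul0r big1 // => i _; rewrite (z _ A00) mul0r.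
have [B00|Bn0] := eqVneq B 0.
  by rewrite B00 sqrtr0 mulr0 big1 // => i _; rewrite (z _ B00) mulr0.
set s := Num.sqrt A; set t := Num.sqrt B.
have s0 : 0 < s by rewrite sqrtr_gt0 lt_def An0.
have t0 : 0 < t by rewrite sqrtr_gt0 lt_def Bn0.
have : \sum_i 2 * (s * t) * (a i * b i) <= \sum_i (t ^+ 2 * a i ^+ 2 + s ^+ 2 * b i ^+ 2).
  apply: ler_sum => i _; rewrite -subr_ge0.
  have -> : t ^+ 2 * a i ^+ 2 + s ^+ 2 * b i ^+ 2 - 2 * (s * t) * (a i * b i) =
    (t * a i - s * b i) ^+ 2 by ring.
  exact: sqr_ge0.
rewrite -mulr_sumr big_split /= -!mulr_sumr -/A -/B.
have <- : s ^+ 2 = A by rewrite sqr_sqrtr.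
have <- : t ^+ 2 = B by rewrite sqr_sqrtr.
have st : 0 < s * t by rewrite mulr_gt0.
move=> H; rewrite -(ler_pM2l st); move: (\sum_i a i * b i) H => S H; nra.
Qed.

Lemma sqr_vnorm m (x : 'cV[C]_m) : vnorm x ^+ 2 = \sum_i normc (x i 0) ^+ 2.
Proof. by rewrite sqr_sqrtr // sumr_ge0 // => i _; apply: sqr_ge0. Qed.

Lemma vnorm_ge0 m (x : 'cV[C]_m) : 0 <= vnorm x.
Proof. exact: sqrtr_ge0. Qed.
#[local] Hint Resolve vnorm_ge0 normc_ge0 : core.

Lemma vnorm_dot m (x : 'cV[C]_m) : ((cj x)^T *m x) 0 0 = (vnorm x ^+ 2)%:C%C.
Proof.
rewrite sqr_vnorm mxE rmorph_sum /=; apply: eq_bigr => i _.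
by rewrite !mxE mulC_conj.
Qed.

Lemma vnorm_eq0 m (x : 'cV[C]_m) : (vnorm x == 0) = (x == 0).
Proof.
rewrite -sqrf_eq0 sqr_vnorm psumr_eq0 => [|i _]; last exact: sqr_ge0.
apply/allP/eqP => [H|-> i _]; last by rewrite /= mxE normc0 expr0n.
apply/matrixP => i j; rewrite ord1 mxE; apply/eqP.
by have := H i (mem_index_enum _); rewrite sqrf_eq0 normc_eq0.
Qed.

Lemma vnorm0 m : vnorm (0 : 'cV[C]_m) = 0.
Proof. by apply/eqP; rewrite vnorm_eq0. Qed.

Lemma vnorm_gt0 m (x : 'cV[C]_m) : (0 < vnorm x) = (x != 0).
Proof. by rewrite lt_def vnorm_eq0 vnorm_ge0 andbT. Qed.

Lemma vnorm_sqr_eq m n (x : 'cV[C]_m) (y : 'cV[C]_n) : vnorm x ^+ 2 = vnorm y ^+ 2 -> vnorm x = vnorm y.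
Proof. by move/eqP; rewrite eqrXn2 // => /eqP. Qed.

Lemma vnormZ m (a : C) (x : 'cV[C]_m) : vnorm (a *: x) = normc a * vnorm x.
Proof.
apply/eqP; rewrite -(@eqrXn2 _ 2) ?mulr_ge0 // exprMn !sqr_vnorm mulr_sumr.
by apply/eqP; apply: eq_bigr => i _; rewrite mxE normcM exprMn.
Qed.

Lemma vnorm_conj m (x : 'cV[C]_m) : vnorm (cj x) = vnorm x.
Proof.
apply: vnorm_sqr_eq; rewrite !sqr_vnorm; apply: eq_bigr => i _.
by rewrite mxE normc_conj.
Qed.

Lemma dot_CauchySchwarz m (v w : 'cV[C]_m) :
  normc ((v^T *m w) 0 0) <= vnorm v * vnorm w.
Proof.
rewrite mxE; apply: le_trans (normc_sum _ _ _) _.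
apply: le_trans (sum_CauchySchwarz _ _).
by apply: ler_sum => i _; rewrite normcM mxE.
Qed.

Lemma vnormD m (x y : 'cV[C]_m) : vnorm (x + y) <= vnorm x + vnorm y.
Proof.
rewrite -(@ler_pXn2r _ 2) ?nnegrE ?addr_ge0 // sqr_vnorm.
apply: le_trans (_ : \sum_i (normc (x i 0) + normc (y i 0)) ^+ 2 <= _).
  apply: ler_sum => i _; rewrite mxE ler_pXn2r ?nnegrE ?addr_ge0 //.
  exact: normcD.
under eq_bigr => i _ do rewrite sqrrD.
rewrite !big_split /= sqrrD !sqr_vnorm lerD2r lerD2l.
by rewrite -mulr2n lerMn2r /=; exact: sum_CauchySchwarz.
Qed.

Lemma vnorm_sum m (I : Type) (r : seq I) (P : pred I) (F : I -> 'cV[C]_m) :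
  vnorm (\sum_(i <- r | P i) F i) <= \sum_(i <- r | P i) vnorm (F i).
Proof.
elim/big_rec2: _ => [|i y x _ H]; first by rewrite vnorm0.
by apply: le_trans (vnormD _ _) _; rewrite lerD2l.
Qed.

Lemma normc_le_vnorm m (x : 'cV[C]_m) i : normc (x i 0) <= vnorm x.
Proof.
rewrite -(@ler_pXn2r _ 2) ?nnegrE // sqr_vnorm (bigD1 i) //= lerDl.
by apply: sumr_ge0 => j _; apply: sqr_ge0.
Qed.

Lemma vnorm_delta m (i : 'I_m) : vnorm (delta_mx i 0 : 'cV[C]_m) = 1.
Proof.
rewrite /vnorm (bigD1 i) //= mxE !eqxx normc1 expr1n big1 ?addr0 ?sqrtr1 // => j.
by move=> /negPf ji; rewrite mxE ji normc0 expr0n.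
Qed.

Lemma vnorm_le_sum m (x : 'cV[C]_m) : vnorm x <= \sum_i normc (x i 0).
Proof.
have {1}-> : x = \sum_i x i 0 *: delta_mx i 0.
  by rewrite {1}[x]matrix_sum_delta; apply: eq_bigr => i _; rewrite big_ord1.
apply: le_trans (vnorm_sum _ _ _) _; apply: ler_sum => i _.
by rewrite vnormZ vnorm_delta mulr1.
Qed.

Lemma vnorm_mulmx_bound m (M : 'M[C]_m) (x : 'cV[C]_m) :
  vnorm (M *m x) <= (\sum_i \sum_j normc (M i j)) * vnorm x.
Proof.
apply: le_trans (vnorm_le_sum _) _; rewrite mulr_suml; apply: ler_sum => i _.
rewrite mxE mulr_suml; apply: le_trans (normc_sum _ _ _) _.
by apply: ler_sum => j _; rewrite normcM ler_wpM2l // normc_le_vnorm.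
Qed.

Lemma mxnorm_has_sup m (M : 'M[C]_m) :
  has_sup [set vnorm (M *m x) | x in [set x : 'cV[C]_m | vnorm x <= 1]].
Proof.
split; first by exists (vnorm (M *m 0)), 0; rewrite //= vnorm0.
exists (\sum_i \sum_j normc (M i j)) => _ [x /= x1 <-].
apply: le_trans (vnorm_mulmx_bound _ _) _; rewrite ler_piMr //.
by apply: sumr_ge0 => i _; apply: sumr_ge0.
Qed.

Lemma vnorm_mulmx m (M : 'M[C]_m) (x : 'cV[C]_m) :
  vnorm (M *m x) <= mxnorm M * vnorm x.
Proof.
have [->|x0] := eqVneq x 0; first by rewrite mulmx0 vnorm0 mulr0.
have nx : 0 < vnorm x by rewrite vnorm_gt0.
rewrite -ler_pdivrMr // mulrC.
have nc : normc ((vnorm x)^-1)%:C%C = (vnorm x)^-1.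
  by apply: complexI; rewrite -normC_normc ger0_norm // ler0c invr_ge0.
rewrite -nc -vnormZ scalemxAr.
apply: (sup_upper_bound (mxnorm_has_sup M)); exists (((vnorm x)^-1)%:C%C *: x) => //=.
by rewrite vnormZ nc mulVf ?gt_eqF.
Qed.

Lemma mxnorm_le m (M : 'M[C]_m) (t : R) : 0 <= t ->
  (forall x, vnorm (M *m x) <= t * vnorm x) -> mxnorm M <= t.
Proof.
move=> t0 H; apply: ge_sup; first by have [] := mxnorm_has_sup M.
by move=> _ [x /= x1 <-]; apply: le_trans (H x) _; rewrite ler_piMr.
Qed.

Lemma mxnorm_ge0 m (M : 'M[C]_m) : 0 <= mxnorm M.
Proof.
apply: (sup_upper_bound (mxnorm_has_sup M)); exists 0 => /=; first by rewrite vnorm0.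
by rewrite mulmx0 vnorm0.
Qed.
#[local] Hint Resolve mxnorm_ge0 : core.

Lemma mxnorm_bil m (M : 'M[C]_m) (v w : 'cV[C]_m) :
  normc ((v^T *m M *m w) 0 0) <= mxnorm M * vnorm v * vnorm w.
Proof.
rewrite -mulmxA; apply: le_trans (dot_CauchySchwarz _ _) _.
by rewrite mulrAC mulrC ler_wpM2r // vnorm_mulmx.
Qed.

(** With [v] the conjugate of [M x] the form becomes the square of [vnorm (M x)]. This description
    of the norm treats both vectors alike, so invariance under transposition and conjugation can be
    read off from it. *)
Lemma mxnorm_le_bil m (M : 'M[C]_m) (t : R) : 0 <= t ->
  (forall v w : 'cV[C]_m, normc ((v^T *m M *m w) 0 0) <= t * vnorm v * vnorm w) ->
  mxnorm M <= t.
Proof.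
move=> t0 H; apply: mxnorm_le => // x.
have [->|Mx0] := eqVneq (M *m x) 0; first by rewrite vnorm0 mulr_ge0.
have n0 : 0 < vnorm (M *m x) by rewrite vnorm_gt0.
rewrite -(ler_pM2r n0) -expr2.
have := H (cj (M *m x)) x; rewrite -mulmxA vnorm_dot vnorm_conj.
by rewrite normc_real ?sqr_ge0 // mulrAC.
Qed.

Lemma mxnormD m (M N : 'M[C]_m) : mxnorm (M + N) <= mxnorm M + mxnorm N.
Proof.
apply: mxnorm_le => [|x]; first exact: addr_ge0.
rewrite mulmxDl mulrDl; apply: le_trans (vnormD _ _) _.
by rewrite lerD // vnorm_mulmx.
Qed.

Lemma mxnormZ_le m (a : C) (M : 'M[C]_m) : mxnorm (a *: M) <= normc a * mxnorm M.
Proof.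
apply: mxnorm_le => [|x]; first exact: mulr_ge0.
by rewrite -scalemxAl vnormZ -mulrA ler_wpM2l // vnorm_mulmx.
Qed.

Lemma mxnorm0 m : mxnorm (0 : 'M[C]_m) = 0.
Proof.
apply/eqP; rewrite eq_le mxnorm_ge0 andbT mxnorm_le // => x.
by rewrite mul0mx vnorm0 mul0r.
Qed.

Lemma mxnormZ m (a : C) (M : 'M[C]_m) : mxnorm (a *: M) = normc a * mxnorm M.
Proof.
have [->|a0] := eqVneq a 0; first by rewrite scale0r normc0 mul0r mxnorm0.
apply/eqP; rewrite eq_le mxnormZ_le /= -ler_pdivlMl; last by rewrite lt_def normc_eq0 a0 /=.
by rewrite -normcV -{1}(scalerK a0 M) mxnormZ_le.
Qed.

Lemma mxnorm_eq0 m (M : 'M[C]_m) : mxnorm M = 0 -> M = 0.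
Proof.
move=> M0; apply/matrixP => i j; rewrite [RHS]mxE.
have : vnorm (M *m delta_mx j 0) <= 0 by have := vnorm_mulmx M (delta_mx j 0); rewrite M0 mul0r.
rewrite le_eqVlt ltNge vnorm_ge0 orbF vnorm_eq0 -colE => /eqP/matrixP/(_ i 0).
by rewrite !mxE.
Qed.

Lemma mxnormM m (M N : 'M[C]_m) : mxnorm (M *m N) <= mxnorm M * mxnorm N.
Proof.
apply: mxnorm_le => [|x]; first exact: mulr_ge0.
rewrite -mulmxA -mulrA; apply: le_trans (vnorm_mulmx _ _) _.
by rewrite ler_wpM2l // vnorm_mulmx.
Qed.

Lemma bil_tr m (M : 'M[C]_m) (v w : 'cV[C]_m) :
  (v^T *m M^T *m w) 0 0 = (w^T *m M *m v) 0 0.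
Proof.
have -> : v^T *m M^T *m w = (w^T *m M *m v)^T by rewrite !trmx_mul trmxK mulmxA.
by rewrite mxE.
Qed.

Lemma mxnorm_tr_le m (M : 'M[C]_m) : mxnorm M^T <= mxnorm M.
Proof.
apply: mxnorm_le_bil => // v w; rewrite bil_tr mulrAC; exact: mxnorm_bil.
Qed.

Lemma mxnorm_tr m (M : 'M[C]_m) : mxnorm M^T = mxnorm M.
Proof. by apply: (eq_of_le (mxnorm_tr_le M)); rewrite -{1}(trmxK M); exact: mxnorm_tr_le. Qed.

Lemma map_conjK m p (M : 'M[C]_(m, p)) : cj (cj M) = M.
Proof. by apply/matrixP => i j; rewrite !mxE conjCK. Qed.

Lemma mxnorm_conj_le m (M : 'M[C]_m) : mxnorm (cj M) <= mxnorm M.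
Proof.
apply: mxnorm_le_bil => // v w; have := mxnorm_bil M (cj v) (cj w).
rewrite !vnorm_conj; congr (_ <= _).
have -> : v^T *m cj M *m w = cj ((cj v)^T *m M *m cj w).
  by rewrite !map_mxM map_trmx !map_conjK.
by rewrite [in RHS]mxE normc_conj.
Qed.

Lemma mxnorm_conj m (M : 'M[C]_m) : mxnorm (cj M) = mxnorm M.
Proof. by apply: (eq_of_le (mxnorm_conj_le M)); rewrite -{1}(map_conjK M); exact: mxnorm_conj_le. Qed.

Lemma mxnorm_adj m (M : 'M[C]_m) : mxnorm (cj M)^T = mxnorm M.
Proof. by rewrite mxnorm_tr mxnorm_conj. Qed.

Lemma adjD m p (M N : 'M[C]_(m, p)) : (cj (M + N))^T = (cj M)^T + (cj N)^T.
Proof. by apply/matrixP => i j; rewrite !mxE rmorphD. Qed.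

Lemma adjZ m p (a : C) (M : 'M[C]_(m, p)) : (cj (a *: M))^T = a^* *: (cj M)^T.
Proof. by apply/matrixP => i j; rewrite !mxE rmorphM. Qed.

Lemma vnorm_mul_dot m (M : 'M[C]_m) (x : 'cV[C]_m) :
  ((cj x)^T *m ((cj M)^T *m M) *m x) 0 0 = (vnorm (M *m x) ^+ 2)%:C%C.
Proof. by rewrite -vnorm_dot map_mxM trmx_mul !mulmxA. Qed.

Lemma mxnorm_Cstar m (M : 'M[C]_m) : mxnorm ((cj M)^T *m M) = mxnorm M ^+ 2.
Proof.
apply/eqP; rewrite eq_le; apply/andP; split.
  by apply: le_trans (mxnormM _ _) _; rewrite mxnorm_adj expr2.
rewrite -[leRHS]sqr_sqrtr // ler_pXn2r ?nnegrE ?sqrtr_ge0 //.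
apply: mxnorm_le => [|x]; first exact: sqrtr_ge0.
rewrite -(@ler_pXn2r _ 2) ?nnegrE ?mulr_ge0 ?sqrtr_ge0 // exprMn (sqr_sqrtr (mxnorm_ge0 _)).
have := mxnorm_bil ((cj M)^T *m M) (cj x) x.
by rewrite vnorm_mul_dot normc_real ?sqr_ge0 // vnorm_conj -mulrA -expr2.
Qed.

End Norms.

#[export] Hint Extern 0 (is_true (@Order.le _ _ (@Algebra.zero _) (vnorm _))) =>
  solve [exact: vnorm_ge0] : core.
#[export] Hint Extern 0 (is_true (@Order.le _ _ (@Algebra.zero _) (normc _))) =>
  solve [exact: normc_ge0] : core.
#[export] Hint Extern 0 (is_true (@Order.le _ _ (@Algebra.zero _) (mxnorm _))) =>
  solve [exact: mxnorm_ge0] : core.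

(** * Norming vectors and directions of decrease *)

Section Attained.
Variable R : realType.
Local Notation C := R[i].
Local Notation cj := (map_mx (@Num.conj C)).

(** The spectral theorem for [M^* M] replaces compactness: [x] is an eigenvector for the largest
    eigenvalue. *)
Lemma mxnorm_attained m (M : 'M[C]_m) : M != 0 ->
  exists2 x : 'cV[C]_m, x != 0 & vnorm (M *m x) = mxnorm M * vnorm x.
Proof.
case: m M => [|m] M M0; first by rewrite [M]flatmx0 eqxx in M0.
pose A := (cj M)^T *m M.
have nA : A \is normalmx.
  apply/normalmxP; suff -> : (A ^t* )%sesqui = A by [].
  by rewrite /A trmx_mul trmxK map_mxM map_conjK -map_trmx.
move/orthomx_spectralP: nA; set P := spectralmx A; set D := spectral_diag A => eA.
have uP : P \is unitarymx by exact: spectral_unitarymx.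
have PPt : P *m (cj P)^T = 1%:M by rewrite map_trmx in uP *; apply/eqP.
have PtP : (cj P)^T *m P = 1%:M by apply: mulmx1C.
have iP : invmx P = (cj P)^T by rewrite invmx_unitary // map_trmx.
have isom (z : 'cV[C]_m.+1) : vnorm (P *m z) = vnorm z.
  apply: vnorm_sqr_eq; apply: complexI; rewrite -!vnorm_dot map_mxM trmx_mul.
  by rewrite -mulmxA (mulmxA _ P) PtP mul1mx.
have eMx (z : 'cV[C]_m.+1) :
    (vnorm (M *m ((cj P)^T *m z)) ^+ 2)%:C%C = \sum_j D 0 j * ((normc (z j 0)) ^+ 2)%:C%C.
  rewrite -vnorm_mul_dot -/A eA iP map_mxM -map_trmx map_conjK trmx_mul trmxK.
  rewrite -!mulmxA (mulmxA P) PPt mul1mx (mulmxA P) PPt mul1mx mulmxA.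
  rewrite mxE; apply: eq_bigr => j _; rewrite mul_mx_diag !mxE.
  by rewrite mulrAC mulrC mulC_conj.
have De j : D 0 j = (vnorm (M *m ((cj P)^T *m delta_mx j 0)) ^+ 2)%:C%C.
  rewrite eMx (bigD1 j) //= mxE !eqxx normc1 expr1n mulr1 big1 ?addr0 // => i /negPf ij.
  by rewrite mxE ij normc0 expr0n mulr0.
pose d j := vnorm (M *m ((cj P)^T *m delta_mx j 0)).
have [j _ dmax] := @arg_maxP _ _ _ (ord0 : 'I_m.+1) xpredT d isT.
have nd := vnorm_delta R j.
pose x : 'cV[C]_m.+1 := (cj P)^T *m delta_mx j 0.
have nx : vnorm x = 1 by rewrite -(isom x) mulmxA PPt mul1mx.
exists x; first by rewrite -vnorm_eq0 nx oner_eq0.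
rewrite nx mulr1; apply/eqP; rewrite eq_le; apply/andP; split.
  by rewrite -[leRHS]mulr1 -nx vnorm_mulmx.
apply: mxnorm_le => // z; rewrite -(@ler_pXn2r _ 2) ?nnegrE ?mulr_ge0 // exprMn -lecR.
have {1}-> : z = (cj P)^T *m (P *m z) by rewrite mulmxA PtP mul1mx.
rewrite eMx -(isom z) (sqr_vnorm (P *m z)) rmorphM rmorph_sum /= mulr_sumr.
apply: ler_sum => i _; rewrite De; apply: ler_wpM2r; first by rewrite ler0c sqr_ge0.
have := dmax i isT; rewrite /d -/x lecR => dm.
by apply: lerXn2r dm; rewrite nnegrE vnorm_ge0.
Qed.

Lemma vnorm_le_add_orth m (x y : 'cV[C]_m) (a : C) :
  ((cj x)^T *m y) 0 0 = 0 -> vnorm x <= vnorm (x + a *: y).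
Proof.
move=> xy; have [->|x0] := eqVneq x 0; first by rewrite vnorm0.
have nx : 0 < vnorm x by rewrite vnorm_gt0.
rewrite -(ler_pM2l nx) -expr2.
have := dot_CauchySchwarz (cj x) (x + a *: y).
rewrite mulmxDr -scalemxAr mxE vnorm_dot [X in _ + X]mxE xy mulr0 addr0.
by rewrite normc_real ?sqr_ge0 // vnorm_conj.
Qed.

Lemma Re_ge_normc (z : C) : - normc z <= complex.Re z.
Proof.
rewrite lerNl; apply: le_trans (ler_norm _) _; rewrite normrN.
by case: z => a b /=; rewrite -sqrtr_sqr ler_wsqrtr // lerDl sqr_ge0.
Qed.

Lemma dot_conj m (x y : 'cV[C]_m) :
  ((cj y)^T *m x) 0 0 = (((cj x)^T *m y) 0 0)^*.
Proof.
have -> : (cj y)^T *m x = (cj ((cj x)^T *m y))^T.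
  by rewrite map_mxM -map_trmx map_conjK trmx_mul trmxK.
by rewrite !mxE.
Qed.

Lemma vnormD_sqr m (x y : 'cV[C]_m) :
  vnorm (x + y) ^+ 2 =
    vnorm x ^+ 2 + 2 * complex.Re (((cj x)^T *m y) 0 0) + vnorm y ^+ 2.
Proof.
have h (a b : 'M[C]_1) : (a + b) 0 0 = a 0 0 + b 0 0 by rewrite mxE.
apply: complexI; rewrite -(vnorm_dot (x + y)) adjD mulmxDl !mulmxDr !h.
rewrite (dot_conj x y) !vnorm_dot; case: (_ 0 0) => a b.
by apply/eqP; rewrite eq_complex /=; apply/andP; split; apply/eqP; ring.
Qed.

(* With [z = s b + w], [w] orthogonal to [b], the squared norm of [(a b^* - e Y) z] is at most
   [|s|^2 (1 - 2 e rho) + 2 e K |s| |w| + e^2 K^2 |z|^2], where [rho = Re (a^* Y b)] and [K = |Y|]. *)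
Lemma rank1_decrease m (a b : 'cV[C]_m) (Y : 'M[C]_m) :
  vnorm a = 1 -> vnorm b = 1 -> 0 < complex.Re (((cj a)^T *m Y *m b) 0 0) ->
  exists2 e0 : R, 0 < e0 & forall e : R, 0 < e -> e <= e0 ->
    exists2 t : R, 0 <= t < 1 & forall z : 'cV[C]_m,
      vnorm ((a *m (cj b)^T - e%:C%C *: Y) *m z) <= t * vnorm z.
Proof.
move=> na nb; set al := _ 0 0; set rho := complex.Re al => rho0.
set K := mxnorm Y.
have K0 : 0 <= K by exact: mxnorm_ge0.
(* The first bound gives [4 e^2 K^2 <= e rho], the second [4 e rho <= 1]. They absorb the quadratic
   terms and leave the factor [1 - e rho] for the squared norm. *)
exists (Num.min (rho / (4 * (K ^+ 2 + 1))) (1 / (4 * rho))).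
  by rewrite lt_min !divr_gt0 ?mulr_gt0 ?ltr_wpDl ?sqr_ge0 ?ltr0n.
move=> e e0; rewrite le_min !ler_pdivlMr ?mulr_gt0 ?ltr_wpDl ?sqr_ge0 ?ltr0n //.
case/andP => eK; rewrite mulrCA => er.
have er0 : 0 < e * rho by rewrite mulr_gt0.
have eK2 : 4 * (e * K) ^+ 2 <= e * rho.
  have : e * (e * (4 * (K ^+ 2 + 1))) <= e * rho by rewrite ler_pM2l.
  by have : 0 <= e ^+ 2 by [exact: sqr_ge0]; nra.
exists (Num.sqrt (1 - e * rho)).
  by rewrite sqrtr_ge0 -[ltRHS]sqrtr1 ltr_sqrt; lra.
move=> z.
rewrite -(@ler_pXn2r _ 2) ?nnegrE ?mulr_ge0 ?sqrtr_ge0 // exprMn.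
rewrite (@sqr_sqrtr _ (1 - e * rho)); last by lra.
pose s := ((cj b)^T *m z) 0 0; pose w := z - s *: b.
have h (x y : 'M[C]_1) : (x + y) 0 0 = x 0 0 + y 0 0 by rewrite mxE.
have hZ (k : C) (x : 'M[C]_1) : (k *: x) 0 0 = k * x 0 0 by rewrite mxE.
have bw : ((cj b)^T *m w) 0 0 = 0.
  by rewrite mulmxBr -scalemxAr h -scaleN1r !hZ -/s vnorm_dot nb expr1n mulr1 mulN1r subrr.
have ez : z = s *: b + w by rewrite addrC subrK.
have nz : vnorm z ^+ 2 = normc s ^+ 2 + vnorm w ^+ 2.
  rewrite {1}ez vnormD_sqr vnormZ nb mulr1 adjZ -scalemxAl hZ bw mulr0 /=.
  by rewrite mulr0 addr0.
have -> : (a *m (cj b)^T - e%:C%C *: Y) *m z = s *: a + (- (e%:C%C)) *: (Y *m z).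
  rewrite mulmxDl scaleNr mulNmx -scalemxAl; congr (_ - _).
  by rewrite -mulmxA [_ *m z]mx11_scalar mul_mx_scalar.
rewrite vnormD_sqr !vnormZ na mulr1 adjZ -scalemxAl hZ -scalemxAr hZ.
have -> : normc (- e%:C%C) = e by rewrite normcN normc_real // ltW.
have -> : ((cj a)^T *m (Y *m z)) 0 0 = s * al + ((cj a)^T *m Y *m w) 0 0.
  by rewrite mulmxA {1}ez mulmxDr h -scalemxAr hZ.
set be := (_ *m w) 0 0.
have nbe : normc be <= K * vnorm w.
  by have := mxnorm_bil Y (cj a) w; rewrite vnorm_conj na mulr1.
have -> : complex.Re (s^* * (- e%:C%C * (s * al + be))) =
    - e * (normc s ^+ 2 * rho + complex.Re (s^* * be)).
  have -> : s^* * (- e%:C%C * (s * al + be)) = - e%:C%C * ((s^* * s) * al + s^* * be) by ring.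
  have Re_aff (n' : R) (x y : C) :
      complex.Re (- e%:C%C * (n'%:C%C * x + y)) = - e * (n' * complex.Re x + complex.Re y).
    by case: x y => [a1 a2] [b1 b2] /=; ring.
  by rewrite mulC_conj Re_aff.
have Re1 : - (normc s * (K * vnorm w)) <= complex.Re (s^* * be).
  apply: le_trans (Re_ge_normc _); rewrite lerN2 normcM normc_conj.
  by rewrite ler_wpM2l.
have Yz : vnorm (Y *m z) <= K * vnorm z by exact: vnorm_mulmx.
have Yz2 : (e * vnorm (Y *m z)) ^+ 2 <= (e * K) ^+ 2 * vnorm z ^+ 2.
  rewrite -exprMn ler_pXn2r ?nnegrE ?mulr_ge0 ?(ltW e0) //.
  by rewrite -mulrA ler_pM2l.
have n0 := vnorm_ge0 w; have s0 := normc_ge0 s.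
move: (complex.Re _) Re1 (vnorm (Y *m z)) Yz2 {Yz} => q Re1 y Yz2.
rewrite nz in Yz2 *; move: (vnorm w) (normc s) n0 s0 Re1 Yz2 => W S n0 s0 Re1 Yz2.
have Re2 : - (e * (S * (K * W))) <= e * q by rewrite -mulrN ler_pM2l.
have : (e * K) ^+ 2 * (S ^+ 2 + W ^+ 2) <= e * rho / 4 * (S ^+ 2 + W ^+ 2).
  by rewrite ler_wpM2r ?addr_ge0 ?sqr_ge0 //; lra.
have : 4 * (e * K) ^+ 2 * S ^+ 2 <= e * rho * S ^+ 2.
  by rewrite ler_wpM2r ?sqr_ge0.
have : e * rho * W ^+ 2 <= 1 / 4 * W ^+ 2 by rewrite ler_wpM2r ?sqr_ge0 //; lra.
(* This square bounds the cross term [2 e K |s| |w|] by [2 e^2 K^2 |s|^2 + |w|^2 / 2]. *)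
have := sqr_ge0 (2 * e * K * S - W).
have := sqr_ge0 W; have : 0 <= e * rho * S ^+ 2 by rewrite mulr_ge0 ?sqr_ge0 // ltW.
rewrite !mulrDl !mulrDr. lra.
Qed.

End Attained.

(** * Block algebras and Birkhoff-James orthogonality *)

Section Colour.
Variables (R : realType) (N : nat) (K : finType) (c : 'I_N -> K).
Local Notation C := R[i].
Local Notation cj := (map_mx (@Num.conj C)).
Implicit Types (X Y M : 'M[C]_N) (v w x z : 'cV[C]_N) (k : K).

(* A direct sum of matrix algebras is encoded by a colouring [c] of the indices: the blocks are
   the colour classes. *)
Definition inA M : Prop := forall i j, c i != c j -> M i j = 0.
Definition supp k x : Prop := forall i, c i != k -> x i 0 = 0.
Definition pr k x : 'cV[C]_N := \col_i (if c i == k then x i 0 else 0).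
Definition adm v w : Prop := exists k, [/\ supp k v, supp k w, v != 0 & w != 0].
(** Bilinear and not sesquilinear: transposition then exchanges the two vectors, and conjugations
    appear only where an inner product is meant. *)
Definition bf Y v w : C := (v^T *m Y *m w) 0 0.
Definition BJ X Y : Prop := forall lam : C, mxnorm X <= mxnorm (X + lam *: Y).

Lemma pr_supp k x : supp k (pr k x).
Proof. by move=> i ik; rewrite mxE (negPf ik). Qed.

Lemma pr_sum x : x = \sum_k pr k x.
Proof.
apply/matrixP => i j; rewrite ord1 summxE (bigD1 (c i)) //= mxE eqxx big1 ?addr0 // => k.
by move=> ki; rewrite mxE eq_sym (negPf ki).
Qed.

Lemma vnorm_pr x : vnorm x ^+ 2 = \sum_k vnorm (pr k x) ^+ 2.
Proof.
rewrite sqr_vnorm; under [RHS]eq_bigr => k _ do rewrite sqr_vnorm.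
rewrite exchange_big /=; apply: eq_bigr => i _.
rewrite (bigD1 (c i)) //= mxE eqxx big1 ?addr0 // => k ki.
by rewrite mxE eq_sym (negPf ki) normc0 expr0n.
Qed.

Lemma pr_eq0 x : (forall k, pr k x = 0) -> x = 0.
Proof. by move=> H; rewrite [x]pr_sum big1. Qed.

Lemma suppD k x z : supp k x -> supp k z -> supp k (x + z).
Proof. by move=> sx sz i ik; rewrite mxE sx // sz // addr0. Qed.

Lemma suppZ k a x : supp k x -> supp k (a *: x).
Proof. by move=> sx i ik; rewrite mxE sx // mulr0. Qed.

Lemma supp_map (f : {rmorphism C -> C}) k x : supp k x -> supp k (map_mx f x).
Proof. by move=> sx i ik; rewrite mxE sx // rmorph0. Qed.

Lemma supp_delta i : supp (c i) (delta_mx i 0).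
Proof. by move=> j ji; rewrite mxE; case: (eqVneq j i) => // e; rewrite e eqxx in ji. Qed.

Lemma supp_inj k k' x : x != 0 -> supp k x -> supp k' x -> k = k'.
Proof.
move=> x0 sk sk'; apply/eqP; apply: contraNT x0 => kk'; apply/eqP/matrixP => i j.
rewrite ord1 mxE; have [ik|ik] := eqVneq (c i) k; last exact: sk.
by apply: sk'; rewrite ik.
Qed.

Lemma inA0 : inA 0.
Proof. by move=> i j _; rewrite mxE. Qed.

Lemma inAD X Y : inA X -> inA Y -> inA (X + Y).
Proof. by move=> hX hY i j ij; rewrite mxE hX // hY // addr0. Qed.

Lemma inAZ a X : inA X -> inA (a *: X).
Proof. by move=> hX i j ij; rewrite mxE hX // mulr0. Qed.

Lemma inA_outer k v w : supp k v -> supp k w -> inA (v *m w^T).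
Proof.
move=> sv sw i j ij; rewrite !mxE big_ord1 mxE.
have [ik|ik] := eqVneq (c i) k; last by rewrite sv // mul0r.
by rewrite sw ?mulr0 // -ik eq_sym.
Qed.

Lemma inA_mul_supp k M x : inA M -> supp k x -> supp k (M *m x).
Proof.
move=> hM sx i ik; rewrite mxE big1 // => j _.
have [jk|jk] := eqVneq (c j) k; last by rewrite sx // mulr0.
by rewrite hM ?mul0r // jk.
Qed.

Lemma inA_mul_pr k M x : inA M -> M *m pr k x = pr k (M *m x).
Proof.
move=> hM; apply/matrixP => i j; rewrite ord1 [RHS]mxE !mxE.
case: eqVneq => ik; last first.
  rewrite big1 // => l _; rewrite mxE; case: eqVneq => // lk; last by rewrite mulr0.
  by rewrite hM ?mul0r // lk.
apply: eq_bigr => l _; rewrite mxE; case: eqVneq => // lk.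
by rewrite hM ?mul0r // ik eq_sym.
Qed.

Lemma mxnorm_le_class M (t : R) : inA M -> 0 <= t ->
  (forall k x, supp k x -> vnorm (M *m x) <= t * vnorm x) -> mxnorm M <= t.
Proof.
move=> hM t0 H; apply: mxnorm_le => // x.
rewrite -(@ler_pXn2r _ 2) ?nnegrE ?mulr_ge0 // exprMn.
rewrite (vnorm_pr (M *m x)) (vnorm_pr x) mulr_sumr.
apply: ler_sum => k _; rewrite -inA_mul_pr // -exprMn.
rewrite ler_pXn2r ?nnegrE ?mulr_ge0 //.
by apply: H; apply: pr_supp.
Qed.

Lemma mxnorm_le_bil_class M (t : R) : inA M -> 0 <= t ->
  (forall k v w, supp k v -> supp k w -> normc (bf M v w) <= t * vnorm v * vnorm w) ->
  mxnorm M <= t.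
Proof.
move=> hM t0 H; apply: mxnorm_le_class => // k x sx.
have [->|Mx0] := eqVneq (M *m x) 0; first by rewrite vnorm0 mulr_ge0.
have n0 : 0 < vnorm (M *m x) by rewrite vnorm_gt0.
rewrite -(ler_pM2r n0) -expr2.
have := H k (cj (M *m x)) x (supp_map _ (inA_mul_supp hM sx)) sx.
rewrite /bf -mulmxA vnorm_dot vnorm_conj.
by rewrite normc_real ?sqr_ge0 // mulrAC.
Qed.

(** The defects of the block components of a norming vector are nonnegative and sum to zero, so
    every nonzero component is norming as well. *)
Lemma mxnorm_attained_class M : inA M -> M != 0 ->
  exists k x, [/\ supp k x, x != 0 & vnorm (M *m x) = mxnorm M * vnorm x].
Proof.
move=> hM /mxnorm_attained[x x0 ex].
have [k xk0] : exists k, pr k x != 0.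
  apply: contrapT => H; case/eqP: x0; apply: pr_eq0 => k; apply/eqP/negPn/negP => xk.
  by apply: H; exists k.
exists k, (pr k x); split; [exact: pr_supp | exact: xk0 | apply/eqP].
have le j : vnorm (M *m pr j x) ^+ 2 <= (mxnorm M * vnorm (pr j x)) ^+ 2.
  by rewrite ler_pXn2r ?nnegrE ?mulr_ge0 // vnorm_mulmx.
rewrite -(@eqrXn2 _ 2) ?mulr_ge0 //.
have : \sum_j ((mxnorm M * vnorm (pr j x)) ^+ 2 - vnorm (M *m pr j x) ^+ 2) = 0.
  rewrite sumrB; under eq_bigr do rewrite exprMn.
  under [X in _ - X]eq_bigr do rewrite inA_mul_pr //.
  by rewrite -mulr_sumr -(vnorm_pr (M *m x)) -(vnorm_pr x) ex exprMn subrr.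
move/eqP; rewrite psumr_eq0 => [|j _]; last by rewrite subr_ge0.
by move=> /allP/(_ k (mem_index_enum _)); rewrite /= subr_eq0 eq_sym.
Qed.

(** Since [Y z] is orthogonal to [X z], adding a multiple of [Y] cannot shorten the image of the
    norming vector [z]. This is the easy half of the Bhatia-Semrl criterion. *)
Lemma BJ_of_orth X Y z : z != 0 -> vnorm (X *m z) = mxnorm X * vnorm z ->
  ((cj (X *m z))^T *m (Y *m z)) 0 0 = 0 -> BJ X Y.
Proof.
move=> z0 ez o lam; have nz : 0 < vnorm z by rewrite vnorm_gt0.
rewrite -(ler_pM2r nz) -[leLHS]ez; apply: (le_trans _ (vnorm_mulmx (X + lam *: Y) z)).
by rewrite mulmxDl -scalemxAl vnorm_le_add_orth.
Qed.

Lemma BJZl a X Y : a != 0 -> BJ X Y -> BJ (a *: X) Y.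
Proof.
move=> a0 H lam; have -> : a *: X + lam *: Y = a *: (X + (a^-1 * lam) *: Y).
  by rewrite scalerDr scalerA mulVKf.
by rewrite !mxnormZ ler_wpM2l.
Qed.

Lemma BJZr a X Y : BJ X Y -> BJ X (a *: Y).
Proof. by move=> H lam; rewrite scalerA. Qed.

Lemma mxnorm_rank1 (a b : 'cV[C]_N) : mxnorm (a *m (cj b)^T) = vnorm a * vnorm b.
Proof.
have e z : a *m (cj b)^T *m z = ((cj b)^T *m z) 0 0 *: a.
  by rewrite -mulmxA [_ *m z]mx11_scalar mul_mx_scalar -mx11_scalar.
apply/eqP; rewrite eq_le; apply/andP; split.
  apply: mxnorm_le => [|z]; first exact: mulr_ge0.
  rewrite e vnormZ mulrC -mulrA ler_wpM2l // -(vnorm_conj b).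
  exact: dot_CauchySchwarz.
have [->|b0] := eqVneq b 0; first by rewrite vnorm0 mulr0.
have nb : 0 < vnorm b by rewrite vnorm_gt0.
rewrite -(ler_pM2r nb); apply: le_trans (vnorm_mulmx _ b).
by rewrite e vnorm_dot vnormZ normc_real ?sqr_ge0 // expr2 -mulrA mulrC.
Qed.

(** A rank one matrix has a single norming line, that of [w], so orthogonality becomes a linear
    condition. If [al = bf Y v w] is nonzero, a small step along [- al^* Y] lowers the norm by
    [rank1_decrease]. *)
Lemma BJ_rank1 v w Y : v != 0 -> w != 0 -> BJ (cj (v *m w^T)) Y <-> bf Y v w = 0.
Proof.
move=> v0 w0; have nv : vnorm v != 0 by rewrite vnorm_eq0.
have nw : vnorm w != 0 by rewrite vnorm_eq0.
have eX : cj (v *m w^T) = cj v *m (cj w)^T by rewrite map_mxM -map_trmx.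
have eXw : cj (v *m w^T) *m w = (vnorm w ^+ 2)%:C%C *: cj v.
  by rewrite eX -mulmxA [_ *m w]mx11_scalar vnorm_dot mul_mx_scalar.
split=> [|o]; last first.
  apply: (@BJ_of_orth _ _ w) => //.
    rewrite eXw vnormZ normc_real ?sqr_ge0 // eX mxnorm_rank1 vnorm_conj.
    by rewrite expr2 mulrC mulrA.
  by rewrite eXw adjZ map_conjK -scalemxAl mxE mulmxA -/(bf _ _ _) o mulr0.
pose a := ((vnorm v)^-1)%:C%C *: cj v; pose b := ((vnorm w)^-1)%:C%C *: w.
have na : vnorm a = 1 by rewrite vnormZ vnorm_conj normc_real ?invr_ge0 // mulVf.
have nb : vnorm b = 1 by rewrite vnormZ normc_real ?invr_ge0 // mulVf.
set s := ((vnorm v)^-1 * (vnorm w)^-1)%:C%C.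
have s0 : s != 0 by rewrite fmorph_eq0 mulf_neq0 ?invr_eq0.
have eab : a *m (cj b)^T = s *: cj (v *m w^T).
  rewrite eX /a adjZ -scalemxAl -scalemxAr scalerA; congr (_ *: _).
  by rewrite /s rmorphM /= [X in _ * X](conjc_real (vnorm w)^-1).
move=> HBJ; apply/eqP/negPn/negP => bf0.
set al := bf Y v w in bf0.
have Hbj : BJ (a *m (cj b)^T) (al^* *: Y) by rewrite eab; apply/BJZr/BJZl.
have : 0 < complex.Re (((cj a)^T *m (al^* *: Y) *m b) 0 0).
  rewrite /a adjZ /b map_conjK.
  have -> : (((vnorm v)^-1)%:C%C^* *: v^T *m (al^* *: Y) *m (((vnorm w)^-1)%:C%C *: w)) 0 0
     = s * (al^* * al).
    have hZ (q : C) (x : 'M[C]_1) : (q *: x) 0 0 = q * x 0 0 by rewrite mxE.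
    rewrite -scalemxAr -scalemxAl -scalemxAr -!scalemxAl !scalerA hZ -/(bf Y v w) -/al.
    have -> : (((vnorm v)^-1)%:C%C)^* = ((vnorm v)^-1)%:C%C by exact: conjc_real.
    by rewrite /s rmorphM /=; ring.
  rewrite mulC_conj /s -rmorphM /= mulr_gt0 ?exprn_gt0 //.
    by rewrite mulr_gt0 ?invr_gt0 ?lt_def ?nv ?nw /=.
  by rewrite lt_def normc_eq0 bf0 /=.
case/(rank1_decrease na nb) => e0 e00 /(_ e0 e00 (lexx _)) [t /andP[t0 t1] Ht].
have := Hbj (- e0%:C%C); rewrite scaleNr mxnorm_rank1 na nb mulr1.
by apply/negP; rewrite -ltNge; apply: le_lt_trans t1; apply: mxnorm_le.
Qed.

(** A norming vector [x] supported in one block is paired with the conjugate of [X x]. Every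
    [X^perp] with [X] nonzero thus contains a hyperplane of rank one type. *)
Lemma BJ_rank1_below X : inA X -> X != 0 ->
  exists v w, adm v w /\ forall Y, bf Y v w = 0 -> BJ X Y.
Proof.
move=> hX X0; have [k [x [sx x0 ex]]] := mxnorm_attained_class hX X0.
exists (cj (X *m x)), x; split.
  exists k; split=> //; first exact/supp_map/inA_mul_supp.
  rewrite -vnorm_eq0 vnorm_conj ex mulf_neq0 ?vnorm_eq0 //.
  by apply: contra X0 => /eqP/mxnorm_eq0 ->.
by move=> Y o; apply: (BJ_of_orth x0 ex); rewrite mulmxA.
Qed.

Lemma BJ0l Y : BJ 0 Y.
Proof. by move=> lam; rewrite mxnorm0. Qed.

Lemma BJ_self X : BJ X X -> X = 0.
Proof.
move=> /(_ (-1)); rewrite scaleN1r subrr mxnorm0 => n0; apply: mxnorm_eq0.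
by apply/eqP; rewrite eq_le n0 mxnorm_ge0.
Qed.

Lemma bf_delta Y i j : bf Y (delta_mx i 0) (delta_mx j 0) = Y i j.
Proof. by rewrite /bf trmx_delta -rowE -colE !mxE. Qed.

Lemma adm_delta i j : c i = c j -> adm (delta_mx i 0) (delta_mx j 0).
Proof.
move=> ij; have d0 (l : 'I_N) : (delta_mx l 0 : 'cV[C]_N) != 0.
  by rewrite -vnorm_eq0 vnorm_delta oner_eq0.
by exists (c i); split=> //; [exact: supp_delta | rewrite ij; exact: supp_delta].
Qed.

End Colour.

(** * Rank one tensors over a field *)

Section Parallel.
Variable F : fieldType.

(** Equality of points of a projective space. *)
Definition par m (a b : 'cV[F]_m) : Prop := exists2 k : F, k != 0 & a = k *: b.

Lemma par_refl m (a : 'cV[F]_m) : par a a.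
Proof. by exists 1; rewrite ?oner_eq0 // scale1r. Qed.

Lemma par_sym m (a b : 'cV[F]_m) : par a b -> par b a.
Proof. by case=> k k0 ->; exists k^-1; rewrite ?invr_eq0 // scalerK. Qed.

Lemma par_trans m (b a x : 'cV[F]_m) : par a b -> par b x -> par a x.
Proof. by case=> k k0 -> [l l0 ->]; exists (k * l); rewrite ?mulf_neq0 // scalerA. Qed.

Lemma vec_neq0 m (a : 'cV[F]_m) : a != 0 -> exists i, a i 0 != 0.
Proof.
move=> a0; apply: contrapT => H; case/eqP: a0; apply/matrixP => i j.
by rewrite ord1 mxE; apply/eqP/negPn/negP => ai; apply: H; exists i.
Qed.

Lemma outer_neq0 m n (a : 'cV[F]_m) (b : 'cV[F]_n) : a != 0 -> b != 0 -> a *m b^T != 0.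
Proof.
move=> /vec_neq0[i ai] /vec_neq0[j bj]; apply/negP => /eqP/matrixP/(_ i j).
by move/eqP; rewrite !mxE big_ord1 mxE mulf_eq0 (negPf ai) (negPf bj).
Qed.

Lemma outerE m n (a : 'cV[F]_m) (b : 'cV[F]_n) i j : (a *m b^T) i j = a i 0 * b j 0.
Proof. by rewrite mxE big_ord1 mxE. Qed.

Lemma outer_eq m n (a x : 'cV[F]_m) (b y : 'cV[F]_n) k : a != 0 -> b != 0 ->
  a *m b^T = k *: (x *m y^T) -> par a x /\ par b y.
Proof.
move=> a0 b0 e.
have E i j : a i 0 * b j 0 = k * (x i 0 * y j 0) by rewrite -!outerE e mxE.
have [i ai] := vec_neq0 a0; have [j bj] := vec_neq0 b0.
have ea : a = (k * y j 0 / b j 0) *: x.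
  apply/matrixP => p q; rewrite ord1 mxE; apply: (mulIf bj); rewrite E.
  by field.
have eb : b = (k * x i 0 / a i 0) *: y.
  apply/matrixP => p q; rewrite ord1 mxE; apply: (mulfI ai); rewrite E.
  by field.
split; [exists (k * y j 0 / b j 0) | exists (k * x i 0 / a i 0)] => //.
  by apply: contra a0 => /eqP h; rewrite ea h scale0r.
by apply: contra b0 => /eqP h; rewrite eb h scale0r.
Qed.

Lemma minor_neq0 m (a b : 'cV[F]_m) : a != 0 -> b != 0 -> ~ par a b ->
  exists p q, a p 0 * b q 0 - a q 0 * b p 0 != 0.
Proof.
move=> a0 b0 nab; apply: contrapT => H; apply: nab.
have [p bp] := vec_neq0 b0.
have e : a = (a p 0 / b p 0) *: b.
  apply/matrixP => q j; rewrite ord1 mxE.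
  have /eqP : a p 0 * b q 0 - a q 0 * b p 0 = 0.
    by apply/eqP/negPn/negP => h; apply: H; exists p, q.
  by rewrite subr_eq0 => /eqP h; rewrite mulrAC h mulfK.
by exists (a p 0 / b p 0) => //; apply: contra a0 => /eqP h; rewrite e h scale0r.
Qed.

(** If [v1] and [v2] are not parallel, a functional [x |-> x p * v2 q - x q * v2 p] kills [v2] and
    not [v1]. Contracting with it makes [w1] a multiple of [w3], and by symmetry [w2] is one too. *)
Lemma outer_sum m n (v1 v2 v3 : 'cV[F]_m) (w1 w2 w3 : 'cV[F]_n) a b :
  a != 0 -> b != 0 -> v1 != 0 -> v2 != 0 -> w1 != 0 -> w2 != 0 ->
  v3 *m w3^T = a *: (v1 *m w1^T) + b *: (v2 *m w2^T) -> par v1 v2 \/ par w1 w2.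
Proof.
move=> a0 b0 v10 v20 w10 w20 e; have [|nv] := pselect (par v1 v2); [by left | right].
have [p [q]] := minor_neq0 v10 v20 nv; set D := _ - _ => D0.
have E i j : v3 i 0 * w3 j 0 = a * (v1 i 0 * w1 j 0) + b * (v2 i 0 * w2 j 0).
  by rewrite -!outerE e !mxE.
have e1 : w1 = ((v2 q 0 * v3 p 0 - v2 p 0 * v3 q 0) / (a * D)) *: w3.
  apply/matrixP => j l; rewrite ord1 mxE.
  rewrite mulrAC mulrBl -!mulrA !E; apply: (mulIf (mulf_neq0 a0 D0)).
  by rewrite mulfVK ?mulf_neq0 // /D; ring.
have e2 : w2 = ((v1 p 0 * v3 q 0 - v1 q 0 * v3 p 0) / (b * D)) *: w3.
  apply/matrixP => j l; rewrite ord1 mxE.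
  rewrite mulrAC mulrBl -!mulrA !E; apply: (mulIf (mulf_neq0 b0 D0)).
  by rewrite mulfVK ?mulf_neq0 // /D; ring.
apply: (@par_trans _ w3).
  by exists ((v2 q 0 * v3 p 0 - v2 p 0 * v3 q 0) / (a * D)) => //;
    apply: contra w10 => /eqP h; rewrite e1 h scale0r.
by apply: par_sym; exists ((v1 p 0 * v3 q 0 - v1 q 0 * v3 p 0) / (b * D)) => //;
  apply: contra w20 => /eqP h; rewrite e2 h scale0r.
Qed.

(* Double annihilator: a matrix lies in the span of finitely many others as soon as every
   linear functional killing those kills it. *)
Lemma mx_in_span m n p (Q : 'I_p -> 'M[F]_(m, n)) (Q0 : 'M[F]_(m, n)) :
  (forall Y : 'M[F]_(m, n), (forall k, \sum_i \sum_j Y i j * Q k i j = 0) ->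
     \sum_i \sum_j Y i j * Q0 i j = 0) ->
  exists a : 'I_p -> F, Q0 = \sum_k a k *: Q k.
Proof.
move=> H; pose A : 'M[F]_(p, m * n) := \matrix_k mxvec (Q k).
have E (Y M : 'M[F]_(m, n)) : (mxvec M *m (mxvec Y)^T) 0 0 = \sum_i \sum_j Y i j * M i j.
  rewrite mxE (reindex _ (curry_mxvec_bij _ _)) /= pair_bigA /=.
  by apply: eq_bigr => -[i j] _; rewrite mxE !mxvecE mulrC.
case: (boolP (mxvec Q0 <= A)%MS) => [/submxP[D eD]|].
  exists (fun k => D 0 k); rewrite -[Q0]mxvecK eD mulmx_sum_row linear_sum /=.
  by apply: eq_bigr => k _; rewrite linearZ /= rowK mxvecK.
rewrite submxE => /negP[]; apply/eqP/matrixP => i j; rewrite ord1.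
pose Y := vec_mx (col j (cokermx A))^T.
have eY (M : 'M[F]_(m, n)) : (mxvec M *m cokermx A) 0 j = \sum_i \sum_j Y i j * M i j.
  rewrite -E /Y vec_mxK trmxK !mxE; apply: eq_bigr => l _.
  by rewrite [col _ _ _ _]mxE.
rewrite [RHS]mxE eY; apply: H => k; rewrite -eY.
have -> : mxvec (Q k) *m cokermx A = row k (A *m cokermx A) by rewrite row_mul rowK.
by rewrite mulmx_coker !mxE.
Qed.

End Parallel.

(** * Correspondence of rank one functionals *)

Section Correspondence.
Variable R : realType.
Local Notation C := R[i].
Local Notation cj := (map_mx (@Num.conj C)).

Lemma bf_sum N (Y : 'M[C]_N) (v w : 'cV[C]_N) :
  bf Y v w = \sum_i \sum_j Y i j * (v *m w^T) i j.
Proof.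
rewrite /bf mxE exchange_big /=; apply: eq_bigr => j _; rewrite mxE mulr_suml.
by apply: eq_bigr => i _; rewrite outerE mxE mulrA (mulrC (v i 0)).
Qed.

Lemma bfDl N (Y Z : 'M[C]_N) v w : bf (Y + Z) v w = bf Y v w + bf Z v w.
Proof. by rewrite /bf mulmxDr mulmxDl mxE. Qed.

Lemma bfZl N a (Y : 'M[C]_N) v w : bf (a *: Y) v w = a * bf Y v w.
Proof. by rewrite /bf -scalemxAr -scalemxAl mxE. Qed.

Lemma bf_outer N k (v w x y : 'cV[C]_N) (Y : 'M[C]_N) :
  v *m w^T = k *: (x *m y^T) -> bf Y v w = k * bf Y x y.
Proof.
move=> e; rewrite !bf_sum mulr_sumr; apply: eq_bigr => i _; rewrite mulr_sumr.
by apply: eq_bigr => j _; rewrite e mxE mulrCA.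
Qed.

Section InA.
Variables (N : nat) (K : finType) (c : 'I_N -> K).

Lemma inA_conj (X : 'M[C]_N) : inA c X -> inA c (cj X).
Proof. by move=> hX i j ij; rewrite mxE hX // rmorph0. Qed.

Lemma adm_outer (v w : 'cV[C]_N) : adm c v w -> inA c (v *m w^T).
Proof. by case=> k [sv sw _ _]; exact: inA_outer sv sw. Qed.

(** Compression to the diagonal blocks, by which a functional known on the block algebra only can be
    tested on all matrices. *)
Definition msk (Y : 'M[C]_N) : 'M[C]_N := \matrix_(i, j) (if c i == c j then Y i j else 0).

Lemma inA_msk Y : inA c (msk Y).
Proof. by move=> i j ij; rewrite mxE (negPf ij). Qed.

Lemma bf_msk Y v w : inA c (v *m w^T) -> bf (msk Y) v w = bf Y v w.
Proof.
move=> hA; rewrite !bf_sum; apply: eq_bigr => i _; apply: eq_bigr => j _.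
by rewrite [msk _ _ _]mxE; case: eqVneq => // ij; rewrite hA ?mulr0.
Qed.

Lemma bf_conj_self (v w : 'cV[C]_N) : v != 0 -> w != 0 -> bf (cj (v *m w^T)) v w != 0.
Proof.
move=> v0 w0; apply/eqP => h; have := outer_neq0 v0 w0.
have /(BJ_rank1 _ v0 w0) /BJ_self e := h.
by rewrite -(map_conjK (v *m w^T)) e map_mx0 eqxx.
Qed.

(** A kernel contained in the hyperplane [bf _ v w = 0] has codimension at most one, so it fills the
    hyperplane: if [Y] violated the conclusion, a matrix [X] outside the hyperplane could be moved
    into the kernel by a multiple of [Y]. *)
Lemma bf_ker_sym (v w x y : 'cV[C]_N) : v != 0 -> w != 0 -> inA c (v *m w^T) ->
  (forall Y, inA c Y -> bf Y x y = 0 -> bf Y v w = 0) ->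
  forall Y, inA c Y -> bf Y v w = 0 -> bf Y x y = 0.
Proof.
move=> v0 w0 hA H Y hY vY; apply/eqP/negPn/negP => xY.
have hX : inA c (cj (v *m w^T)) by exact: inA_conj.
have := bf_conj_self v0 w0; set X := cj _ => /eqP; apply.
pose t := bf X x y / bf Y x y.
have : bf (X + (- t) *: Y) v w = 0.
  apply: H; first by apply/inAD/inAZ.
  by rewrite bfDl bfZl /t mulNr divfK // subrr.
by rewrite bfDl bfZl vY mulr0 addr0.
Qed.

Lemma bf_span p (v w : 'I_p -> 'cV[C]_N) (v0 w0 : 'cV[C]_N) :
  (forall k, inA c (v k *m (w k)^T)) -> inA c (v0 *m w0^T) ->
  (forall Y, inA c Y -> (forall k, bf Y (v k) (w k) = 0) -> bf Y v0 w0 = 0) ->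
  exists a : 'I_p -> C, v0 *m w0^T = \sum_k a k *: (v k *m (w k)^T).
Proof.
move=> hA hA0 H; apply: mx_in_span => Y HY; rewrite -bf_sum -bf_msk //.
by apply: H (inA_msk _) _ => k; rewrite bf_msk // bf_sum HY.
Qed.

Lemma bf_span_sum p (v w : 'I_p -> 'cV[C]_N) (v0 w0 : 'cV[C]_N) (a : 'I_p -> C) Y :
  v0 *m w0^T = \sum_k a k *: (v k *m (w k)^T) ->
  bf Y v0 w0 = \sum_k a k * bf Y (v k) (w k).
Proof.
move=> e; rewrite bf_sum; under [RHS]eq_bigr do rewrite bf_sum mulr_sumr.
rewrite [RHS]exchange_big /=; apply: eq_bigr => i _.
under [RHS]eq_bigr do rewrite mulr_sumr.
rewrite [RHS]exchange_big /=; apply: eq_bigr => j _.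
rewrite e summxE mulr_sumr; apply: eq_bigr => k _.
by rewrite mxE mulrCA.
Qed.

End InA.

(** A bijection of block algebras given by two functions on full matrix spaces, whose values outside
    the algebras are arbitrary. The symmetric form makes every statement about [Phi] available for
    [Psi]. *)
Definition BJpair N r (K L : finType) (c : 'I_N -> K) (d : 'I_r -> L)
    (Phi : 'M[C]_N -> 'M[C]_r) (Psi : 'M[C]_r -> 'M[C]_N) : Prop :=
  [/\ forall X, inA c X -> inA d (Phi X), forall X, inA d X -> inA c (Psi X),
      forall X, inA c X -> Psi (Phi X) = X, forall X, inA d X -> Phi (Psi X) = X &
      forall X Y, inA c X -> inA c Y -> (BJ X Y <-> BJ (Phi X) (Phi Y))].

Lemma BJpair_sym N r (K L : finType) (c : 'I_N -> K) (d : 'I_r -> L) Phi Psi :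
  BJpair c d Phi Psi -> BJpair d c Psi Phi.
Proof.
move=> [h1 h2 h3 h4 h5]; split=> // X Y hX hY.
by rewrite -{1}(h4 X) // -{1}(h4 Y) //; apply: iff_sym; apply: h5; exact: h2.
Qed.

(** The induced map on rank one functionals as a relation, since a kernel determines [x] and [y]
    only up to scalars. *)
Definition cor N r (K L : finType) (c : 'I_N -> K) (d : 'I_r -> L)
    (Phi : 'M[C]_N -> 'M[C]_r) v w x y : Prop :=
  [/\ adm c v w, adm d x y & forall Y, inA c Y -> (bf Y v w = 0 <-> bf (Phi Y) x y = 0)].

Lemma cor_sym N r (K L : finType) (c : 'I_N -> K) (d : 'I_r -> L) Phi Psi v w x y :
  BJpair c d Phi Psi -> cor c d Phi v w x y -> cor d c Psi x y v w.
Proof.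
move=> [h1 h2 h3 h4 h5] [a1 a2 H]; split=> // Y hY.
by rewrite -{1}(h4 Y) //; apply: iff_sym; apply: H; exact: h2.
Qed.

Lemma adm_neq0 N (K : finType) (c : 'I_N -> K) (v w : 'cV[C]_N) :
  adm c v w -> v != 0 /\ w != 0.
Proof. by case=> k []. Qed.

Section Pair.
Variables (N r : nat) (K L : finType) (c : 'I_N -> K) (d : 'I_r -> L).
Variables (Phi : 'M[C]_N -> 'M[C]_r) (Psi : 'M[C]_r -> 'M[C]_N).
Hypothesis HP : BJpair c d Phi Psi.

Lemma BJpair_neq0 X : inA c X -> X != 0 -> Phi X != 0.
Proof.
case: HP => h1 h2 h3 h4 h5 hX X0; apply/eqP => e; case/eqP: X0.
by apply: BJ_self; apply/(h5 _ _ hX hX); rewrite e; exact: BJ0l.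
Qed.

(* The sets [X^perp], [X != 0], that are minimal for inclusion are exactly the kernels of the
   functionals [bf _ v w]. *)
Lemma cor_ex v w : adm c v w -> exists x y, cor c d Phi v w x y /\
  forall Y, inA d Y -> (BJ (Phi (cj (v *m w^T))) Y <-> bf Y x y = 0).
Proof.
case: (HP) => h1 h2 h3 h4 h5 av; have [v0 w0] := adm_neq0 av.
set X := cj (v *m w^T).
have hvw := adm_outer av.
have hX : inA c X by exact: inA_conj.
have X0 : X != 0.
  by apply/eqP => e; have := bf_conj_self v0 w0; rewrite -/X e /bf mulmx0 mul0mx mxE eqxx.
have [x [y [axy Hxy]]] := BJ_rank1_below (h1 X hX) (BJpair_neq0 hX X0).
have [x0 y0] := adm_neq0 axy.
set Z := cj (x *m y^T).
have hZ : inA d Z by apply/inA_conj/adm_outer.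
have Z0 : Z != 0.
  by apply/eqP => e; have := bf_conj_self x0 y0; rewrite -/Z e /bf mulmx0 mul0mx mxE eqxx.
have W0 : Psi Z != 0.
  apply/eqP => e; case/eqP: Z0; apply: BJ_self; rewrite -(h4 Z hZ).
  by apply/(h5 _ _ (h2 _ hZ) (h2 _ hZ)); rewrite e; exact: BJ0l.
have sub Y : inA c Y -> BJ (Psi Z) Y -> bf Y v w = 0.
  move=> hY HY; apply/(BJ_rank1 Y v0 w0)/(h5 _ _ hX hY); apply: Hxy.
  apply/(BJ_rank1 (Phi Y) x0 y0); rewrite -/Z -(h4 Z hZ).
  exact: (h5 _ _ (h2 _ hZ) hY).1.
(* [(Psi Z)^perp] lies in the hyperplane of [v], [w] and contains the hyperplane of [v2], [w2]; so
   the two hyperplanes coincide, and [(Psi Z)^perp] is equal to both. *)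
have [v2 [w2 [a2 H2]]] := BJ_rank1_below (h2 Z hZ) W0.
have eqv Y : inA c Y -> (bf Y v w = 0 <-> bf (Phi Y) x y = 0).
  move=> hY; have H5 := h5 (Psi Z) Y (h2 _ hZ) hY; rewrite h4 // in H5.
  split=> [vY|xY].
    apply/(BJ_rank1 (Phi Y) x0 y0)/H5.
    apply: (H2); apply: (bf_ker_sym v0 w0 hvw) vY => // Y' hY' vY'.
    exact: (sub Y' hY' (H2 Y' vY')).
  by apply: (sub Y hY); apply/H5/(BJ_rank1 (Phi Y) x0 y0).
exists x, y; split=> // Y hY; split=> [BY|]; last exact: Hxy.
have H5 := h5 X (Psi Y) hX (h2 _ hY); rewrite h4 // in H5.
have := eqv (Psi Y) (h2 _ hY); rewrite h4 // => -[E1 _]; apply: E1.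
by apply/(BJ_rank1 (Psi Y) v0 w0)/H5.
Qed.

(** A tensor lies in the span of others exactly when the common kernel of their functionals lies in
    its own kernel. Such inclusions are statements about sets of matrices, so they pass through the
    bijection without any linearity. *)
Lemma cor_dep p (D : pred 'I_p) (v w : 'I_p -> 'cV[C]_N) (x y : 'I_p -> 'cV[C]_r)
    v0 w0 x0 y0 (a : 'I_p -> C) :
  (forall k, D k -> cor c d Phi (v k) (w k) (x k) (y k)) -> cor c d Phi v0 w0 x0 y0 ->
  v0 *m w0^T = \sum_(k | D k) a k *: (v k *m (w k)^T) ->
  exists b : 'I_p -> C, x0 *m y0^T = \sum_(k | D k) b k *: (x k *m (y k)^T).
Proof.
case: (HP) => h1 h2 h3 h4 h5 H [a1 a2 H0] e.
have [k||Y hY HY|b eb] := @bf_span _ _ d p (fun k => if D k then x k else 0) y x0 y0.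
- case: ifP => [/H[_ /adm_outer]//|_]; rewrite mul0mx; exact: inA0.
- exact: adm_outer.
- rewrite -(h4 Y) //; apply/H0; first exact: h2.
  rewrite (@bf_span_sum _ p (fun k => if D k then v k else 0) w _ _ a); last first.
    rewrite e big_mkcond; apply: eq_bigr => k _; case: ifP => // _.
    by rewrite mul0mx scaler0.
  rewrite big1 // => k _; have := HY k; case: ifP => [Dk HYk|_ _]; last first.
    by rewrite /bf trmx0 !mul0mx mxE mulr0.
  have [_ _ Hk] := H k Dk; have /Hk : inA c (Psi Y) by exact: h2.
  by rewrite h4 // HYk => -[_ ->] //; rewrite mulr0.
exists b; rewrite eb [RHS]big_mkcond; apply: eq_bigr => k _; case: ifP => // _.
by rewrite mul0mx scaler0.
Qed.

Lemma cor_dep1 v w x y v0 w0 x0 y0 a :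
  cor c d Phi v w x y -> cor c d Phi v0 w0 x0 y0 ->
  v0 *m w0^T = a *: (v *m w^T) -> exists b, x0 *m y0^T = b *: (x *m y^T).
Proof.
move=> h h0 e.
have [|b] := @cor_dep 1 xpredT (fun=> v) (fun=> w) (fun=> x) (fun=> y) v0 w0 x0 y0 (fun=> a) (fun _ _ => h) h0.
  by rewrite big_ord1.
by rewrite big_ord1; exists (b 0).
Qed.

Lemma cor_par v w x y v0 w0 x0 y0 : cor c d Phi v w x y -> cor c d Phi v0 w0 x0 y0 ->
  par v0 v -> par w0 w -> par x0 x /\ par y0 y.
Proof.
move=> h h0 [k k0 e] [l l0 e'].
have [|b] := @cor_dep1 v w x y v0 w0 x0 y0 (k * l) h h0.
  by rewrite e e' linearZ /= -scalemxAl -scalemxAr scalerA.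
by case: h0 => _ /adm_neq0[x00 y00] _; exact: outer_eq.
Qed.

Lemma cor_dep2 v1 w1 x1 y1 v2 w2 x2 y2 v0 w0 x0 y0 a1 a2 :
  cor c d Phi v1 w1 x1 y1 -> cor c d Phi v2 w2 x2 y2 -> cor c d Phi v0 w0 x0 y0 ->
  v0 *m w0^T = a1 *: (v1 *m w1^T) + a2 *: (v2 *m w2^T) ->
  exists b1 b2, x0 *m y0^T = b1 *: (x1 *m y1^T) + b2 *: (x2 *m y2^T).
Proof.
move=> h1 h2 h0 e.
pose s (T : Type) (p q : T) := fun k : 'I_2 => if k == 0 then p else q.
have [k _||b] := @cor_dep 2 xpredT (s _ v1 v2) (s _ w1 w2) (s _ x1 x2) (s _ y1 y2) v0 w0 x0 y0 (s _ a1 a2) _ h0.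
- by rewrite /s; case: ifP.
- by rewrite !big_ord_recl big_ord0 addr0.
by rewrite !big_ord_recl big_ord0 addr0 /s /=; exists (b 0), (b (lift 0 0)).
Qed.

End Pair.

Lemma cor_parP N r (K L : finType) (c : 'I_N -> K) (d : 'I_r -> L) Phi Psi v w x y v0 w0 x0 y0 :
  BJpair c d Phi Psi ->
  cor c d Phi v w x y -> cor c d Phi v0 w0 x0 y0 ->
  par x0 x /\ par y0 y <-> par v0 v /\ par w0 w.
Proof.
move=> HP h h0; split=> -[p q]; last exact: cor_par HP _ _ _ _ _ _ _ _ h h0 p q.
by apply: (cor_par (BJpair_sym HP) (cor_sym HP h) (cor_sym HP h0)).
Qed.

Lemma cor_change N r (K L : finType) (c : 'I_N -> K) (d : 'I_r -> L) Phi v w x y v0 w0 x0 y0 :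
  cor c d Phi v w x y -> par v v0 -> par w w0 -> par x x0 -> par y y0 ->
  cor c d Phi v0 w0 x0 y0.
Proof.
have admp n (M : finType) (e : 'I_n -> M) (a b a0 b0 : 'cV[C]_n) :
    adm e a b -> par a a0 -> par b b0 -> adm e a0 b0.
  move=> [k [sa sb na nb]] /par_sym[l l0 ->] /par_sym[m m0 ->]; exists k.
  by split; rewrite ?scaler_eq0 ?negb_or ?l0 ?m0 //; apply: suppZ.
move=> [h1 h2 H] pv pw px py; split; [exact: admp pv pw | exact: admp px py |].
have bfp n (Y : 'M[C]_n) a b a0 b0 : par a a0 -> par b b0 -> (bf Y a b = 0 <-> bf Y a0 b0 = 0).
  move=> [l l0 ->] [m m0 ->]; rewrite (@bf_outer _ (l * m) _ _ a0 b0); last first.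
    by rewrite linearZ /= -scalemxAl -scalemxAr scalerA.
  split=> [/eqP|->]; last by rewrite mulr0.
  by rewrite !mulf_eq0 (negPf l0) (negPf m0) => /eqP.
by move=> Y hY; rewrite -(bfp _ Y v w) // -(bfp _ (Phi Y) x y) //; exact: H.
Qed.

(** If [w1] and [w2] are not parallel, the image of [v2] tensor [w1 + w2] has rank one and combines
    the images of the two summands with nonzero coefficients, so these images share a factor. *)
Lemma cor_adj_l N r (K L : finType) (c : 'I_N -> K) (d : 'I_r -> L) Phi Psi
    v1 w1 x1 y1 v2 w2 x2 y2 : BJpair c d Phi Psi ->
  cor c d Phi v1 w1 x1 y1 -> cor c d Phi v2 w2 x2 y2 -> par v1 v2 -> par x1 x2 \/ par y1 y2.
Proof.
move=> HP h1 h2 pv.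
have [pw|npw] := pselect (par w1 w2).
  by left; have [] := cor_par HP h2 h1 pv pw.
have h1' := cor_change h1 pv (par_refl _) (par_refl _) (par_refl _).
have s0 : w1 + w2 != 0.
  apply/eqP => /eqP; rewrite addr_eq0 => /eqP e; apply: npw; exists (-1).
    by rewrite oppr_eq0 oner_eq0.
  by rewrite scaleN1r.
have a3 : adm c v2 (w1 + w2).
  case: h1' => -[k [sv sw nv nw]] _ _; case: h2 => -[k' [sv' sw' _ _]] _ _.
  have e := supp_inj nv sv sv'; rewrite -e in sv' sw'.
  by exists k; split=> //; exact: suppD.
have [x3 [y3 [h3 _]]] := cor_ex HP a3.
have [|b1 [b2 e]] := cor_dep2 HP h1' h2 h3 (_ : _ = 1 *: _ + 1 *: _).
  by rewrite !scale1r linearD /= mulmxDr.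
have [n1 n2] := (let: And3 _ p _ := h1 in adm_neq0 p).
have [n3 n4] := (let: And3 _ p _ := h2 in adm_neq0 p).
have [n5 n6] := (let: And3 _ p _ := h3 in adm_neq0 p).
have nw (u : 'cV[C]_N) : par (w1 + w2) u -> u = w1 \/ u = w2 -> False.
  move=> [l l0 e3] e4; apply: npw; case: e4 => e4; rewrite e4 in e3.
    have e5 : w2 = (l - 1) *: w1 by rewrite scalerBl scale1r -e3 addrAC subrr add0r.
    apply/par_sym; exists (l - 1) => //; apply/eqP => l1.
    by case: h2 => /adm_neq0[_] /eqP; rewrite e5 l1 scale0r.
  have e5 : w1 = (l - 1) *: w2 by rewrite scalerBl scale1r -e3 addrK.
  exists (l - 1) => //; apply/eqP => l1.
  by case: h1 => /adm_neq0[_] /eqP; rewrite e5 l1 scale0r.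
have b10 : b1 != 0.
  apply/eqP => z; rewrite z scale0r add0r in e.
  have [px py] := outer_eq n5 n6 e.
  have [_ pw] := (cor_parP HP h2 h3).1 (conj px py).
  by apply: (nw w2) => //; right.
have b20 : b2 != 0.
  apply/eqP => z; rewrite z scale0r addr0 in e.
  have [px py] := outer_eq n5 n6 e.
  have [_ pw] := (cor_parP HP h1' h3).1 (conj px py).
  by apply: (nw w1) => //; left.
exact: outer_sum b10 b20 n1 n3 n2 n4 e.
Qed.

Lemma adm_sym N (K : finType) (c : 'I_N -> K) (v w : 'cV[C]_N) : adm c v w -> adm c w v.
Proof. by case=> k [h1 h2 h3 h4]; exists k. Qed.

Lemma inA_tr N (K : finType) (c : 'I_N -> K) (X : 'M[C]_N) : inA c X -> inA c X^T.
Proof. by move=> hX i j ij; rewrite mxE hX // eq_sym. Qed.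

Lemma BJ_tr N (X Y : 'M[C]_N) : BJ X Y -> BJ X^T Y^T.
Proof.
move=> H lam; have -> : X^T + lam *: Y^T = (X + lam *: Y)^T by rewrite linearD linearZ.
by rewrite !mxnorm_tr; apply: H.
Qed.

Lemma BJpair_tr N r (K L : finType) (c : 'I_N -> K) (d : 'I_r -> L) Phi Psi :
  BJpair c d Phi Psi -> BJpair c d (fun X => (Phi X^T)^T) (fun X => (Psi X^T)^T).
Proof.
move=> [h1 h2 h3 h4 h5]; split.
- by move=> X hX; apply/inA_tr/h1/inA_tr.
- by move=> X hX; apply/inA_tr/h2/inA_tr.
- by move=> X hX; rewrite trmxK h3 ?trmxK //; exact: inA_tr.
- by move=> X hX; rewrite trmxK h4 ?trmxK //; exact: inA_tr.
move=> X Y hX hY; have H5 := h5 _ _ (inA_tr hX) (inA_tr hY); split=> H.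
  exact/BJ_tr/H5/BJ_tr.
by rewrite -(trmxK X) -(trmxK Y); apply/BJ_tr/H5; rewrite -(trmxK (Phi X^T)) -(trmxK (Phi Y^T));
  apply: BJ_tr.
Qed.

Lemma cor_tr N r (K L : finType) (c : 'I_N -> K) (d : 'I_r -> L) Phi v w x y :
  cor c d Phi v w x y -> cor c d (fun X => (Phi X^T)^T) w v y x.
Proof.
move=> [a1 a2 H]; split; [exact: adm_sym | exact: adm_sym | move=> Y hY].
by have := H Y^T (inA_tr hY); rewrite /bf !bil_tr.
Qed.

Lemma cor_adj_r N r (K L : finType) (c : 'I_N -> K) (d : 'I_r -> L) Phi Psi
    v1 w1 x1 y1 v2 w2 x2 y2 : BJpair c d Phi Psi ->
  cor c d Phi v1 w1 x1 y1 -> cor c d Phi v2 w2 x2 y2 -> par w1 w2 -> par x1 x2 \/ par y1 y2.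
Proof.
move=> HP h1 h2 pw.
by have [|] := cor_adj_l (BJpair_tr HP) (cor_tr h1) (cor_tr h2) pw; [right | left].
Qed.

End Correspondence.

(** * Lines of rank one tensors and the exchange of the factors *)

Section Slices.
Variable R : realType.
Local Notation C := R[i].

(** A set covered by two equivalence relations is a single class of one of them: if [a] and [b] are
    not [P1]-related, they are [P2]-related, and no element is [P1]-related to both. *)
Lemma two_equivalences (T : Type) (P1 P2 : T -> T -> Prop) (D : T -> Prop) :
  (forall x y, P1 x y -> P1 y x) -> (forall y x z, P1 x y -> P1 y z -> P1 x z) ->
  (forall x y, P2 x y -> P2 y x) -> (forall y x z, P2 x y -> P2 y z -> P2 x z) ->
  (forall x y, D x -> D y -> P1 x y \/ P2 x y) ->
  (forall x y, D x -> D y -> P1 x y) \/ (forall x y, D x -> D y -> P2 x y).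
Proof.
move=> s1 t1 s2 t2 H; have [|n1] := pselect (forall x y, D x -> D y -> P1 x y); first by left.
have [a [b [Da Db nab]]] : exists a b, [/\ D a, D b & ~ P1 a b].
  apply: contrapT => h; apply: n1 => x y Dx Dy; apply: contrapT => nxy.
  by apply: h; exists x, y.
have p2ab : P2 a b by case: (H a b).
have Ha x : D x -> P2 x a.
  move=> Dx; have [p|//] := H x a Dx Da; have [q|q] := H x b Dx Db.
    by case: nab; apply: t1 q; exact: s1.
  by apply: t2 q _; exact: s2.
by right=> x y Dx Dy; apply: t2 (Ha _ Dx) _; apply/s2/Ha.
Qed.

Variables (N r : nat) (K L : finType) (c : 'I_N -> K) (d : 'I_r -> L).
Variables (Phi : 'M[C]_N -> 'M[C]_r) (Psi : 'M[C]_r -> 'M[C]_N).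
Hypothesis HP : BJpair c d Phi Psi.
Variables (k : K) (i0 i1 : 'I_N).
Hypotheses (ci0 : c i0 = k) (ci1 : c i1 = k) (i01 : i0 != i1).

Definition inV (v : 'cV[C]_N) : Prop := supp c k v /\ v != 0.

Lemma inV_delta i : c i = k -> inV (delta_mx i 0).
Proof.
move=> ci; split; last by rewrite -vnorm_eq0 vnorm_delta oner_eq0.
by rewrite -ci; exact: supp_delta.
Qed.

Lemma inV_adm v w : inV v -> inV w -> adm c v w.
Proof. by move=> [h1 h2] [h3 h4]; exists k. Qed.

Lemma par_delta i j : par (delta_mx i 0 : 'cV[C]_N) (delta_mx j 0) -> i = j.
Proof.
case=> a a0 /matrixP/(_ i 0); rewrite !mxE !eqxx; case: eqVneq => //= _.
by rewrite mulr0 => /eqP; rewrite oner_eq0.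
Qed.

Lemma inV_nonpar v : inV v -> exists2 w, inV w & ~ par v w.
Proof.
move=> Vv; have [p0|] := pselect (par v (delta_mx i0 0)); last first.
  by exists (delta_mx i0 0) => //; apply: inV_delta.
exists (delta_mx i1 0); first exact: inV_delta.
move=> p1; case/eqP: i01; apply: par_delta; apply: par_trans p1; exact: par_sym.
Qed.

(* Either the lines [w = const] and [v = const] of rank one functionals are mapped to lines of the
   same kind, or the two kinds are exchanged. *)
Lemma cor_split : exists (sw : bool) (S T : 'cV[C]_N -> 'cV[C]_r), forall v w, inV v -> inV w ->
  if sw then cor c d Phi v w (T w) (S v) else cor c d Phi v w (S v) (T w).
Proof.
have /choice[f Hf] : forall p : 'cV[C]_N * 'cV[C]_N, exists q : 'cV[C]_r * 'cV[C]_r,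
    adm c p.1 p.2 -> cor c d Phi p.1 p.2 q.1 q.2.
  move=> -[v w] /=; have [a|] := pselect (adm c v w); last by exists (0, 0).
  by have [x [y [h _]]] := cor_ex HP a; exists (x, y).
have H v w : inV v -> inV w -> cor c d Phi v w (f (v, w)).1 (f (v, w)).2.
  by move=> Vv Vw; exact: (Hf (v, w) (inV_adm Vv Vw)).
pose P1 p q := par (f p).1 (f q).1; pose P2 p q := par (f p).2 (f q).2.
have s1 p q : P1 p q -> P1 q p by exact: par_sym.
have s2 p q : P2 p q -> P2 q p by exact: par_sym.
have t1 q p u : P1 p q -> P1 q u -> P1 p u by exact: par_trans.
have t2 q p u : P2 p q -> P2 q u -> P2 p u by exact: par_trans.
have adj_r v1 w1 v2 w2 : inV v1 -> inV w1 -> inV v2 -> inV w2 -> par w1 w2 ->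
    P1 (v1, w1) (v2, w2) \/ P2 (v1, w1) (v2, w2).
  move=> a1 b1 a2 b2 pw; exact: cor_adj_r HP (H _ _ a1 b1) (H _ _ a2 b2) pw.
have adj_l v1 w1 v2 w2 : inV v1 -> inV w1 -> inV v2 -> inV w2 -> par v1 v2 ->
    P1 (v1, w1) (v2, w2) \/ P2 (v1, w1) (v2, w2).
  move=> a1 b1 a2 b2 pw; exact: cor_adj_l HP (H _ _ a1 b1) (H _ _ a2 b2) pw.
have adj1 v1 w1 v2 w2 : inV v1 -> inV w1 -> inV v2 -> inV w2 ->
    P1 (v1, w1) (v2, w2) -> par v1 v2 \/ par w1 w2.
  move=> a1 b1 a2 b2; apply: cor_adj_l (BJpair_sym HP) _ _; apply: cor_sym HP _; exact: H.
have adj2 v1 w1 v2 w2 : inV v1 -> inV w1 -> inV v2 -> inV w2 ->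
    P2 (v1, w1) (v2, w2) -> par v1 v2 \/ par w1 w2.
  move=> a1 b1 a2 b2; apply: cor_adj_r (BJpair_sym HP) _ _; apply: cor_sym HP _; exact: H.
have Lw w : inV w -> (forall v v', inV v -> inV v' -> P1 (v, w) (v', w)) \/
                     (forall v v', inV v -> inV v' -> P2 (v, w) (v', w)).
  move=> Vw; apply: (@two_equivalences _ (fun v v' => P1 (v, w) (v', w))
      (fun v v' => P2 (v, w) (v', w))) => [x y|y x z|x y|y x z|x y Vx Vy].
  - exact: s1.
  - exact: t1.
  - exact: s2.
  - exact: t2.
  by apply: adj_r => //; exact: par_refl.
have Mv v : inV v -> (forall w w', inV w -> inV w' -> P1 (v, w) (v, w')) \/
                     (forall w w', inV w -> inV w' -> P2 (v, w) (v, w')).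
  move=> Vv; apply: (@two_equivalences _ (fun w w' => P1 (v, w) (v, w'))
      (fun w w' => P2 (v, w) (v, w'))) => [x y|y x z|x y|y x z|x y Vx Vy].
  - exact: s1.
  - exact: t1.
  - exact: s2.
  - exact: t2.
  by apply: adj_l => //; exact: par_refl.
(* If both lines through [(v, w)] had the same type, a point on one and a point on the other would
   have adjacent images although neither of their coordinates agree. Such points exist because the
   block has a second index. *)
have no1 v w : inV v -> inV w -> (forall v v', inV v -> inV v' -> P1 (v, w) (v', w)) ->
    ~ (forall w w', inV w -> inV w' -> P1 (v, w) (v, w')).
  move=> Vv Vw h1 h2; have [v2 Vv2 nv] := inV_nonpar Vv; have [w2 Vw2 nw] := inV_nonpar Vw.
  have p12 : P1 (v2, w) (v, w2) by apply: t1 (h2 w w2 Vw Vw2); exact: h1.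
  by have [/par_sym|] := adj1 v2 w v w2 Vv2 Vw Vv Vw2 p12.
have no2 v w : inV v -> inV w -> (forall v v', inV v -> inV v' -> P2 (v, w) (v', w)) ->
    ~ (forall w w', inV w -> inV w' -> P2 (v, w) (v, w')).
  move=> Vv Vw h1 h2; have [v2 Vv2 nv] := inV_nonpar Vv; have [w2 Vw2 nw] := inV_nonpar Vw.
  have p12 : P2 (v2, w) (v, w2) by apply: t2 (h2 w w2 Vw Vw2); exact: h1.
  by have [/par_sym|] := adj2 v2 w v w2 Vv2 Vw Vv Vw2 p12.
have Ve := inV_delta ci0; set e := delta_mx i0 0 in Ve.
have [l1|l2] := Lw e Ve.
  have m2 v : inV v -> forall w w', inV w -> inV w' -> P2 (v, w) (v, w').
    by move=> Vv; have [/(no1 _ _ Vv Ve l1)|] := Mv v Vv.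
  have l1' w : inV w -> forall v v', inV v -> inV v' -> P1 (v, w) (v', w).
    by move=> Vw; have [//|h] := Lw w Vw; case: (no2 _ _ Ve Vw h (m2 e Ve)).
  exists true, (fun v => (f (v, e)).2), (fun w => (f (e, w)).1) => v w Vv Vw.
  by apply: cor_change (H v w Vv Vw) _ _ _ _; [exact: par_refl | exact: par_refl
    | apply: l1' | apply: m2].
have m1 v : inV v -> forall w w', inV w -> inV w' -> P1 (v, w) (v, w').
  by move=> Vv; have [//|/(no2 _ _ Vv Ve l2)] := Mv v Vv.
have l2' w : inV w -> forall v v', inV v -> inV v' -> P2 (v, w) (v', w).
  by move=> Vw; have [h|//] := Lw w Vw; case: (no1 _ _ Ve Vw h (m1 e Ve)).
exists false, (fun v => (f (v, e)).1), (fun w => (f (e, w)).2) => v w Vv Vw.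
by apply: cor_change (H v w Vv Vw) _ _ _ _; [exact: par_refl | exact: par_refl
  | apply: m1 | apply: l2'].
Qed.

End Slices.

(** * Collineations of rank one tensors *)

Section OneMap.
Variables (F : fieldType) (N r : nat) (Q : pred 'I_N) (i0 : 'I_N).
Hypothesis Qi0 : Q i0.
Local Notation e i := (delta_mx i 0 : 'cV[F]_N).

Definition onQ (v : 'cV[F]_N) : Prop := (forall i, ~~ Q i -> v i 0 = 0) /\ v != 0.

Variable S : 'cV[F]_N -> 'cV[F]_r.
Hypothesis S0 : forall v, onQ v -> S v != 0.
Hypothesis Sdep : forall p (D : pred 'I_p) (v : 'I_p -> 'cV[F]_N) v0 a,
  (forall k, D k -> onQ (v k)) -> onQ v0 ->
  v0 = \sum_(k | D k) a k *: v k -> exists b, S v0 = \sum_(k | D k) b k *: S (v k).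
Hypothesis Sdep' : forall p (D : pred 'I_p) (v : 'I_p -> 'cV[F]_N) v0 a,
  (forall k, D k -> onQ (v k)) -> onQ v0 ->
  S v0 = \sum_(k | D k) a k *: S (v k) -> exists b, v0 = \sum_(k | D k) b k *: v k.

Lemma delta_neq0 i : e i != 0.
Proof. by apply/eqP => /matrixP/(_ i 0)/eqP; rewrite !mxE !eqxx oner_eq0. Qed.

Lemma onQ_delta i : Q i -> onQ (e i).
Proof.
move=> Qi; split; last exact: delta_neq0.
by move=> j nj; rewrite mxE; case: eqVneq => // ej; rewrite ej Qi in nj.
Qed.

Lemma par_dep u v : onQ u -> onQ v -> par (S u) (S v) -> par u v.
Proof.
move=> Vu Vv [a a0 ea].
have [|b] := @Sdep' 1 xpredT (fun=> v) u (fun=> a) (fun _ _ => Vv) Vu.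
  by rewrite big_ord1.
rewrite big_ord1 => eb; exists (b 0) => //; apply/eqP => b0.
by case: Vu => _; rewrite eb b0 scale0r eqxx.
Qed.

Lemma dep_par u v : onQ u -> onQ v -> par u v -> par (S u) (S v).
Proof.
move=> Vu Vv [a a0 ea].
have [|b] := @Sdep 1 xpredT (fun=> v) u (fun=> a) (fun _ _ => Vv) Vu.
  by rewrite big_ord1.
rewrite big_ord1 => eb; exists (b 0) => //; apply/eqP => b0.
by have := S0 Vu; rewrite eb b0 scale0r eqxx.
Qed.

Lemma dep2 v1 v2 v0 a1 a2 : onQ v1 -> onQ v2 -> onQ v0 -> v0 = a1 *: v1 + a2 *: v2 ->
  exists b1 b2, S v0 = b1 *: S v1 + b2 *: S v2.
Proof.
move=> V1 V2 V0 e0.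
pose s (T : Type) (p q : T) := fun k : 'I_2 => if k == 0 then p else q.
have [k _||b] := @Sdep 2 xpredT (s _ v1 v2) v0 (s _ a1 a2) _ V0.
- by rewrite /s; case: ifP.
- by rewrite !big_ord_recl big_ord0 addr0.
by rewrite !big_ord_recl big_ord0 addr0 /s /=; exists (b 0), (b (lift 0 0)).
Qed.

Lemma onQ_affine i a : Q i -> i != i0 -> onQ (e i0 + a *: e i).
Proof.
move=> Qi ii; split=> [j nj|].
  have [n1 n2] : j != i0 /\ j != i by split; apply: contraNneq nj => ->.
  by rewrite !mxE (negPf n1) (negPf n2) mulr0 addr0.
apply/eqP => /matrixP/(_ i0 0)/eqP.
by rewrite !mxE !eqxx (eq_sym i0) (negPf ii) mulr0 addr0 oner_eq0.
Qed.

Lemma affine_nonpar i a : i != i0 -> ~ par (e i0 + a *: e i) (e i).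
Proof.
move=> ii [k k0] /matrixP/(_ i0 0)/eqP.
by rewrite !mxE !eqxx (eq_sym i0) (negPf ii) !mulr0 addr0 oner_eq0.
Qed.

Lemma affine_par i a a' : i != i0 -> par (e i0 + a *: e i) (e i0 + a' *: e i) -> a = a'.
Proof.
move=> ii [k k0] h; have /matrixP/(_ i0 0) := h; have /matrixP/(_ i 0) := h.
rewrite !mxE !eqxx (eq_sym i0) (negPf ii) /= !mulr0 !addr0 !mulr1 !add0r => + k1.
by rewrite -k1 mul1r.
Qed.

(* [S] is a collineation: it sends the line through [e i0] and [e i] to the line through
   [s i0] and [s i], and [tau i] is the resulting coordinate change. *)
Lemma affine_image i a : Q i -> i != i0 ->
  exists t, par (S (e i0 + a *: e i)) (S (e i0) + t *: S (e i)).
Proof.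
move=> Qi ii; have V := onQ_affine a Qi ii.
have [|b1 [b2 e1]] := dep2 (onQ_delta Qi0) (onQ_delta Qi) V (_ : _ = 1 *: _ + a *: _).
  by rewrite scale1r.
have [b10|b10] := eqVneq b1 0.
  have [] := @affine_nonpar i a ii; apply: par_dep => //; first exact: onQ_delta.
  exists b2; last by rewrite e1 b10 scale0r add0r.
  by apply/eqP => b20; have := S0 V; rewrite e1 ?scale1r // b10 b20 !scale0r addr0 eqxx.
exists (b2 / b1); exists b1 => //.
by rewrite e1 scalerDr scalerA mulrCA mulfV // mulr1.
Qed.

(** Normalisation of a projective frame: without the unit points [e i0 + e i] each coordinate would
    be fixed only up to a scalar. *)
Lemma frame : exists s : 'I_N -> 'cV[F]_r, exists kap : 'I_N -> F,
  [/\ forall i, kap i != 0, forall i, s i = kap i *: S (e i), kap i0 = 1 &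
   forall i, Q i -> i != i0 -> par (S (e i0 + e i)) (s i0 + s i)].
Proof.
have /choice[kap Hk] : forall i, exists t, t != 0 /\
    (Q i -> i != i0 -> par (S (e i0 + e i)) (S (e i0) + t *: S (e i))).
  move=> i; have [Qi|nQi] := boolP (Q i); last by exists 1; rewrite oner_eq0; split.
  have [->|ii] := eqVneq i i0; first by exists 1; rewrite oner_eq0; split=> // _; rewrite eqxx.
  have [t pt] := @affine_image i 1 Qi ii; rewrite scale1r in pt.
  exists t; split=> //; apply/eqP => t0; move: pt; rewrite t0 scale0r addr0 => pt.
  have V := onQ_affine 1 Qi ii; rewrite scale1r in V.
  have := par_dep V (onQ_delta Qi0) pt; rewrite -[X in par _ X]addr0 -(scale0r (e i)).
  rewrite -{1}(scale1r (e i)) => /(affine_par ii)/eqP; by rewrite oner_eq0.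
pose kp i := if i == i0 then 1 else kap i.
exists (fun i => kp i *: S (e i)), kp; split=> //.
- by move=> i; rewrite /kp; case: ifP => _; [exact: oner_neq0 | have [] := Hk i].
- by rewrite /kp eqxx.
by move=> i Qi ii; rewrite /kp eqxx (negPf ii) scale1r; have [_] := Hk i; apply.
Qed.

Variables (s : 'I_N -> 'cV[F]_r) (kap : 'I_N -> F).
Hypotheses (kap0 : forall i, kap i != 0) (sE : forall i, s i = kap i *: S (e i)).
Hypotheses (kap1 : kap i0 = 1).
Hypothesis s_unit : forall i, Q i -> i != i0 -> par (S (e i0 + e i)) (s i0 + s i).

Lemma frame_free (g : 'I_N -> F) : \sum_(i | Q i) g i *: s i = 0 -> forall i, Q i -> g i = 0.
Proof.
move=> h p Qp; apply/eqP/negPn/negP => gp.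
have eS : S (e p) = \sum_(i | Q i && (i != p)) (- (g i * kap i) / (g p * kap p)) *: S (e i).
  have gk : g p * kap p != 0 by rewrite mulf_neq0.
  apply: (scalerI gk); rewrite scaler_sumr; apply/eqP; rewrite -subr_eq0 -sumrN.
  move/eqP: h; rewrite (bigD1 p) //= sE scalerA.
  congr (_ + _ == _); apply: eq_bigr => i _.
  by rewrite scalerA mulrC divfK // sE scalerA scaleNr opprK.
have [|b eb] := Sdep' _ (onQ_delta Qp) eS.
  by move=> i /andP[Qi _]; exact: onQ_delta.
have /matrixP/(_ p 0)/eqP := eb; rewrite !mxE !eqxx summxE big1 ?oner_eq0 // => i /andP[_ ip].
by rewrite !mxE eq_sym (negPf ip) mulr0.
Qed.

Lemma frame_free2 i a b : Q i -> i != i0 -> a *: s i0 + b *: s i = 0 -> a = 0 /\ b = 0.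
Proof.
move=> Qi ii h; pose g j := if j == i0 then a else if j == i then b else 0.
have hg : \sum_(j | Q j) g j *: s j = 0.
  rewrite (bigD1 i0) //= (bigD1 i) /=; last by rewrite Qi.
  rewrite /g !eqxx (negPf ii) big1 ?addr0 // => j /andP[/andP[_ n1] n2].
  by rewrite (negPf n1) (negPf n2) scale0r.
have := frame_free hg Qi0; have := frame_free hg Qi.
by rewrite /g !eqxx (negPf ii).
Qed.

Lemma coord_ex : exists tau : 'I_N -> F -> F, forall i, Q i -> i != i0 ->
  forall a, par (S (e i0 + a *: e i)) (s i0 + tau i a *: s i).
Proof.
have H i : exists t : F -> F, forall a, Q i -> i != i0 ->
    par (S (e i0 + a *: e i)) (s i0 + t a *: s i).
  suff /choice[t Ht] : forall a, exists t, Q i -> i != i0 ->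
      par (S (e i0 + a *: e i)) (s i0 + t *: s i) by exists t.
  move=> a; have [Qi|nQi] := boolP (Q i); last by exists 0.
  have [_|ii] := eqVneq i i0; first by exists 0.
  have [t pt] := affine_image a Qi ii; exists (t / kap i) => _ _.
  by rewrite !sE kap1 scale1r scalerA divfK.
by have /choice[tau Ht] := H; exists tau => i Qi ii a; apply: Ht.
Qed.

Variable tau : 'I_N -> F -> F.
Hypothesis tauE : forall i, Q i -> i != i0 ->
  forall a, par (S (e i0 + a *: e i)) (s i0 + tau i a *: s i).

Lemma coord_uniq i a t : Q i -> i != i0 ->
  par (S (e i0 + a *: e i)) (s i0 + t *: s i) -> tau i a = t.
Proof.
move=> Qi ii /par_sym p; have [k k0 ek] := par_trans p (tauE Qi ii a).
have [|h1 h2] := @frame_free2 i (1 - k) (t - k * tau i a) Qi ii.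
  rewrite !scalerBl scale1r -scalerA addrACA ek scalerDr -opprD.
  by rewrite subrr.
have k1 : k = 1 by apply/eqP; rewrite eq_sym -subr_eq0 h1.
by move/eqP: h2; rewrite k1 mul1r subr_eq0 => /eqP.
Qed.

Lemma coord0 i : Q i -> i != i0 -> tau i 0 = 0.
Proof.
move=> Qi ii; apply: coord_uniq => //.
by rewrite !scale0r !addr0 sE kap1 scale1r; exact: par_refl.
Qed.

Lemma coord1 i : Q i -> i != i0 -> tau i 1 = 1.
Proof. by move=> Qi ii; apply: coord_uniq => //; rewrite !scale1r; exact: s_unit. Qed.

Lemma coord_inj i : Q i -> i != i0 -> injective (tau i).
Proof.
move=> Qi ii a a' h; apply: (affine_par ii); apply: par_dep; [exact: onQ_affine.. |].
by apply: par_trans (tauE Qi ii a) _; rewrite h; apply/par_sym/tauE.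
Qed.

(** The point [e i0 + v_k e k] is spanned by [v] and the [e j] with [j] different from [i0] and [k].
    Comparing coordinates of the images shows that the [k]-th coordinate of [S v], relative to the
    one at [i0], depends on [v k 0] alone. *)
Lemma coord_gen i1 v : Q i1 -> i1 != i0 -> onQ v -> v i0 0 = 1 ->
  par (S v) (s i0 + \sum_(i | Q i && (i != i0)) tau i (v i 0) *: s i).
Proof.
move=> Q1 i10 Vv v1.
have [b eb] : exists b : 'I_N -> F, S v = \sum_(i | Q i) b i *: s i.
  have [||b eb] := @Sdep N Q (fun i => e i) v (fun i => v i 0) _ Vv.
  - by move=> i; exact: onQ_delta.
  - apply/matrixP => j l; rewrite ord1 summxE; have [Qj|nQj] := boolP (Q j).
      rewrite (bigD1 j) //= big1 => [|i /andP[_ ij]]; rewrite !mxE ?eqxx ?mulr1 ?addr0 //.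
      by rewrite eq_sym (negPf ij) mulr0.
    rewrite big1 => [|i Qi]; first by case: Vv => h _; exact: h.
    rewrite !mxE; case: eqVneq => [ji|]; last by rewrite mulr0.
    by rewrite ji Qi in nQj.
  exists (fun i => b i / kap i); rewrite eb; apply: eq_bigr => i _.
  by rewrite sE scalerA divfK.
have key k : Q k -> k != i0 -> b i0 != 0 /\ b k = tau k (v k 0) * b i0.
  move=> Qk kk; pose D := [pred j | Q j && (j != i0)].
  (* [v] takes the slot [k], where [e k] must not occur. *)
  pose fam j := if j == k then v else e j.
  pose cf j := if j == k then 1 else - v j 0.
  have [||g eg] := @Sdep N D fam (e i0 + v k 0 *: e k) cf _ (onQ_affine _ Qk kk).
  - by move=> j /andP[Qj _]; rewrite /fam; case: ifP => // _; exact: onQ_delta.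
  - rewrite (bigD1 k) /=; last by rewrite Qk.
    rewrite /fam /cf eqxx scale1r; apply/matrixP => j l; rewrite ord1 [RHS]mxE summxE.
    rewrite (eq_bigr (fun i => - v i 0 * (j == i)%:R)); last first.
      by move=> i /andP[_ ik]; rewrite (negPf ik) !mxE eqxx andbT.
    have [Qj|nQj] := boolP (Q j); last first.
      rewrite big1 => [|i /andP[/andP[Qi _] _]]; last first.
        by case: eqVneq => [ji|]; rewrite ?mulr0 //; rewrite ji Qi in nQj.
      have [n1 n2] : j != i0 /\ j != k by split; apply: contraNneq nQj => ->.
      rewrite !mxE (negPf n1) (negPf n2) mulr0 !addr0.
      by case: Vv => h _; rewrite h.
    have [->|ji0] := eqVneq j i0.
      rewrite big1 => [|i /andP[/andP[_ n1] _]]; last by rewrite eq_sym (negPf n1) mulr0.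
      by rewrite !mxE !eqxx (eq_sym i0) (negPf kk) mulr0 v1.
    have [->|jk] := eqVneq j k.
      rewrite big1 => [|i /andP[_ n1]]; last by rewrite eq_sym (negPf n1) mulr0.
      by rewrite !mxE !eqxx (negPf kk) mulr1 add0r addr0.
    rewrite (bigD1 j) /=; last by rewrite Qj ji0 jk.
    rewrite big1 => [|i /andP[_ n1]]; last by rewrite eq_sym (negPf n1) mulr0.
    by rewrite !mxE !eqxx (negPf ji0) (negPf jk) !mulr0 mulr1 !addr0 subrr.
  have [m m0 em] := tauE Qk kk (v k 0).
  pose h j := (if j == i0 then m else if j == k then m * tau k (v k 0) else 0)
    - g k * b j - (if (j == i0) || (j == k) then 0 else g j / kap j).
  have h0 : \sum_(j | Q j) h j *: s j = 0.
    have : \sum_(j | Q j) (if j == i0 then m else if j == k then m * tau k (v k 0) else 0) *: s j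
        = S (e i0 + v k 0 *: e k).
      rewrite em (bigD1 i0) //= (bigD1 k) /=; last by rewrite Qk.
      rewrite !eqxx (negPf kk) big1 ?addr0 ?scalerDr ?scalerA // => j /andP[/andP[_ n1] n2].
      by rewrite (negPf n1) (negPf n2) scale0r.
    have : \sum_(j | Q j) (if (j == i0) || (j == k) then 0 else g j / kap j) *: s j
        = S (e i0 + v k 0 *: e k) - g k *: S v.
      rewrite eg (bigD1 k (P := D)) /=; last by rewrite Qk.
      rewrite {1}/fam eqxx [RHS]addrAC subrr [RHS]add0r (bigD1 i0) //= eqxx scale0r add0r (bigD1 k) /=.
        rewrite eqxx orbT scale0r add0r; apply: eq_bigr => j /andP[/andP[_ n1] n2].
        by rewrite /fam (negPf n1) (negPf n2) sE scalerA divfK.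
      by rewrite Qk.
    move=> h2 h1; rewrite /h; under eq_bigr do rewrite !scalerBl -scalerA.
    by rewrite !sumrB -scaler_sumr -eb h1 h2 subrr.
  have := frame_free h0 Qi0; have := frame_free h0 Qk.
  rewrite /h !eqxx orbT (negPf kk) !subr0 => /eqP; rewrite subr_eq0 => /eqP e1 /eqP.
  rewrite subr_eq0 => /eqP e2.
  have : g k * b i0 != 0 by rewrite -e2.
  rewrite mulf_eq0 negb_or => /andP[gk bi]; split=> //.
  by apply: (mulfI gk); rewrite -e1 e2; ring.
have [b0 _] := key _ Q1 i10.
exists (b i0) => //; rewrite eb (bigD1 i0) //= scalerDr scaler_sumr; congr (_ + _).
apply: eq_bigr => i /andP[Qi ii]; have [_ ->] := key i Qi ii.
by rewrite scalerA mulrC.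
Qed.

Variable f : F -> F.
Hypotheses (f0 : f 0 = 0) (f1 : f 1 = 1) (fM : {morph f : x y / x * y}) (fI : injective f).
Hypothesis ft : forall i, Q i -> i != i0 -> tau i =1 f.

(** Points with nonzero coordinate at [i0] are rescaled into the affine chart. A point [v] at
    infinity is where the line through [e i0] and [e i0 + v] meets the hyperplane spanned by the
    other [e i]. *)
Lemma semilinear_one i1 : Q i1 -> i1 != i0 ->
  forall v, onQ v -> par (S v) (\sum_(i | Q i) f (v i 0) *: s i).
Proof.
move=> Qi1 i10; pose F' (v : 'cV[F]_N) := \sum_(i | Q i) f (v i 0) *: s i.
have g v : onQ v -> v i0 0 = 1 -> par (S v) (F' v).
  move=> Vv v1; rewrite /F' (bigD1 i0) //= v1 f1 scale1r.
  rewrite (eq_bigr (fun i => tau i (v i 0) *: s i)); first exact: (coord_gen Qi1).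
  by move=> i /andP[Qi ii]; rewrite ft.
move=> v Vv; have [v0|v0] := eqVneq (v i0 0) 0; last first.
  have V : onQ ((v i0 0)^-1 *: v).
    case: Vv => h n; split; last first.
      by apply: contra n => /eqP h'; rewrite -(scalerKV v0 v) h' scaler0.
    by move=> i ni; rewrite mxE (h i ni) mulr0.
  have p : par v ((v i0 0)^-1 *: v) by exists (v i0 0) => //; rewrite scalerKV.
  have q : par (S v) (S ((v i0 0)^-1 *: v)) by exact: dep_par Vv V p.
  apply: par_trans q _; apply: par_trans (g _ V _) _; first by rewrite mxE mulVf.
  exists (f (v i0 0)^-1).
    by rewrite -f0 (inj_eq fI) invr_eq0.
  rewrite /F' scaler_sumr; apply: eq_bigr => i _.
  by rewrite mxE fM scalerA.
have V : onQ (e i0 + v).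
  case: Vv => h n; split=> [i ni|].
    rewrite !mxE h // addr0; case: eqVneq => // ii; by rewrite ii Qi0 in ni.
  by apply/eqP => /matrixP/(_ i0 0)/eqP; rewrite !mxE v0 !eqxx addr0 oner_eq0.
have [|b1 [b2 e1]] := dep2 V (onQ_delta Qi0) Vv (_ : _ = 1 *: _ + (-1) *: _).
  by rewrite scale1r scaleN1r addrC addKr.
have [|m m0 em] := g _ V; first by rewrite !mxE v0 !eqxx addr0.
have eF : F' (e i0 + v) = s i0 + F' v.
  rewrite /F' (bigD1 i0) //= [in RHS](bigD1 i0) //= v0 f0 scale0r add0r.
  rewrite !mxE v0 !eqxx addr0 f1 scale1r; congr (_ + _).
  by apply: eq_bigr => i /andP[_ ii]; rewrite !mxE (negPf ii) add0r.
have es0 : S (e i0) = s i0 by rewrite sE kap1 scale1r.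
rewrite em eF es0 scalerDr scalerDr in e1.
have [b eb] : exists b, S v = \sum_(i | Q i && (i != i0)) b i *: S (e i).
  apply: (@Sdep N [pred i | Q i && (i != i0)] (fun i => e i) v (fun i => v i 0)) => //.
    by move=> i /andP[Qi _]; exact: onQ_delta.
  apply/matrixP => j l; rewrite ord1 summxE.
  have [Qj|nQj] := boolP (Q j && (j != i0)).
    rewrite (bigD1 j) //= big1 => [|i /andP[_ ij]]; rewrite !mxE ?eqxx ?mulr1 ?addr0 //.
    by rewrite eq_sym (negPf ij) mulr0.
  rewrite big1 => [|i Qi].
    move: nQj; rewrite negb_and negbK => /orP[nQj|/eqP-> //]; case: Vv => h _; exact: h.
  rewrite !mxE; case: eqVneq => [ji|]; last by rewrite mulr0.
  by move: Qi; rewrite /= -ji (negPf nQj).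
pose h i := if i == i0 then b1 * m + b2 else b1 * m * f (v i 0) - b i / kap i.
have h0 : \sum_(i | Q i) h i *: s i = 0.
  have eF0 : F' v = \sum_(i | Q i && (i != i0)) f (v i 0) *: s i.
    by rewrite /F' (bigD1 i0) //= v0 f0 scale0r add0r.
  rewrite (bigD1 i0) //= {1}/h eqxx.
  have -> : \sum_(i | Q i && (i != i0)) h i *: s i = (b1 * m) *: F' v - S v.
    rewrite eF0 eb scaler_sumr -sumrB; apply: eq_bigr => i /andP[Qi ii].
    rewrite /h (negPf ii) scalerBl !scalerA; congr (_ - _).
    by rewrite sE scalerA divfK.
  by rewrite e1; apply/matrixP => p q; rewrite !mxE; ring.
have hi := frame_free h0.
have := hi i0 Qi0; rewrite /h eqxx => hb.
have eS : S v = (b1 * m) *: F' v.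
  rewrite e1 addrAC !scalerA -scalerDl hb scale0r add0r.
  by [].
exists (b1 * m) => //; apply/eqP => z; have := S0 Vv.
by rewrite eS z scale0r eqxx.
Qed.

End OneMap.

Section TwoMaps.
Variables (F : fieldType) (N r : nat) (Q : pred 'I_N) (i0 i1 : 'I_N).
Hypotheses (Qi0 : Q i0) (Qi1 : Q i1) (i10 : i1 != i0).
Local Notation e i := (delta_mx i 0 : 'cV[F]_N).
Local Notation onQ := (@onQ F N Q).

Definition preserves_dep m (S : 'cV[F]_N -> 'cV[F]_m) (T : 'cV[F]_N -> 'cV[F]_m) : Prop :=
  forall p (D : pred 'I_p) (v w : 'I_p -> 'cV[F]_N) v0 w0 a,
  (forall k, D k -> onQ (v k) /\ onQ (w k)) -> onQ v0 -> onQ w0 ->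
  v0 *m w0^T = \sum_(k | D k) a k *: (v k *m (w k)^T) ->
  exists b, S v0 *m (T w0)^T = \sum_(k | D k) b k *: (S (v k) *m (T (w k))^T).

Definition reflects_dep m (S : 'cV[F]_N -> 'cV[F]_m) (T : 'cV[F]_N -> 'cV[F]_m) : Prop :=
  forall p (D : pred 'I_p) (v w : 'I_p -> 'cV[F]_N) v0 w0 a,
  (forall k, D k -> onQ (v k) /\ onQ (w k)) -> onQ v0 -> onQ w0 ->
  S v0 *m (T w0)^T = \sum_(k | D k) a k *: (S (v k) *m (T (w k))^T) ->
  exists b, v0 *m w0^T = \sum_(k | D k) b k *: (v k *m (w k)^T).

Lemma sum_tr m n p (D : pred 'I_p) (x : 'I_p -> 'cV[F]_m) (y : 'I_p -> 'cV[F]_n) (a : 'I_p -> F) :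
  (\sum_(k | D k) a k *: (x k *m (y k)^T))^T = \sum_(k | D k) a k *: (y k *m (x k)^T).
Proof.
rewrite linear_sum /=; apply: eq_bigr => k _.
by rewrite linearZ /= trmx_mul trmxK.
Qed.

Lemma preserves_sym m (S T : 'cV[F]_N -> 'cV[F]_m) : preserves_dep S T -> preserves_dep T S.
Proof.
move=> H p D v w v0 w0 a Vk V0 W0 e0.
have [||||b eb] := @H p D w v w0 v0 a.
- by move=> k /Vk[].
- by [].
- by [].
- by rewrite -sum_tr -e0 trmx_mul trmxK.
by exists b; rewrite -sum_tr -eb trmx_mul trmxK.
Qed.

Lemma reflects_sym m (S T : 'cV[F]_N -> 'cV[F]_m) : reflects_dep S T -> reflects_dep T S.
Proof.
move=> H p D v w v0 w0 a Vk V0 W0 e0.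
have [||||b eb] := @H p D w v w0 v0 a.
- by move=> k /Vk[].
- by [].
- by [].
- by rewrite -sum_tr -e0 trmx_mul trmxK.
by exists b; rewrite -sum_tr -eb trmx_mul trmxK.
Qed.

Lemma outer_cancel m n (x y : 'cV[F]_m) (t : 'cV[F]_n) : t != 0 -> x *m t^T = y *m t^T -> x = y.
Proof.
move=> t0 h; apply/eqP; rewrite -subr_eq0; apply/negPn/negP => n0.
by have := outer_neq0 n0 t0; rewrite mulmxBl h subrr eqxx.
Qed.

Lemma preserves_one m (S T : 'cV[F]_N -> 'cV[F]_m) : (forall v, onQ v -> T v != 0) ->
  preserves_dep S T -> forall p (D : pred 'I_p) (v : 'I_p -> 'cV[F]_N) v0 a,
  (forall k, D k -> onQ (v k)) -> onQ v0 ->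
  v0 = \sum_(k | D k) a k *: v k -> exists b, S v0 = \sum_(k | D k) b k *: S (v k).
Proof.
move=> T0 H p D v v0 a Vk V0 e0; have Ve := onQ_delta F Qi0.
have [||b eb] := @H p D v (fun=> e i0) v0 (e i0) a _ V0 Ve.
- by move=> k /Vk.
- by rewrite e0 mulmx_suml; apply: eq_bigr => k _; rewrite scalemxAl.
exists b; apply: (outer_cancel (T0 _ Ve)); rewrite eb mulmx_suml.
by apply: eq_bigr => k _; rewrite scalemxAl.
Qed.

Lemma reflects_one m (S T : 'cV[F]_N -> 'cV[F]_m) :
  reflects_dep S T -> forall p (D : pred 'I_p) (v : 'I_p -> 'cV[F]_N) v0 a,
  (forall k, D k -> onQ (v k)) -> onQ v0 ->
  S v0 = \sum_(k | D k) a k *: S (v k) -> exists b, v0 = \sum_(k | D k) b k *: v k.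
Proof.
move=> H p D v v0 a Vk V0 e0; have Ve := onQ_delta F Qi0.
have [||b eb] := @H p D v (fun=> e i0) v0 (e i0) a _ V0 Ve.
- by move=> k /Vk.
- by rewrite e0 mulmx_suml; apply: eq_bigr => k _; rewrite scalemxAl.
exists b; apply: (outer_cancel (delta_neq0 F i0)); rewrite eb mulmx_suml.
by apply: eq_bigr => k _; rewrite scalemxAl.
Qed.

Variables (S T : 'cV[F]_N -> 'cV[F]_r).
Hypotheses (S0 : forall v, onQ v -> S v != 0) (T0 : forall v, onQ v -> T v != 0).
Hypotheses (Hp : preserves_dep S T) (Hr : reflects_dep S T).

(** The tensor of [e i0 + a e i] and [e i0 + b e j] has the coordinates [1, b, a, a b]. A multiple
    of [e i] tensor [e j] absorbs the last one, so dependence of the four tensors encodes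
    collinearity of the points [(a1, b1)], [(a2, b2)], [(a3, b3)]. *)
Lemma affine_collinear i j (s t : 'I_N -> 'cV[F]_r) (tau rho : 'I_N -> F -> F) :
  Q i -> i != i0 -> Q j -> j != i0 ->
  (forall a, par (S (e i0 + a *: e i)) (s i0 + tau i a *: s i)) ->
  (forall a, par (T (e i0 + a *: e j)) (t i0 + rho j a *: t j)) ->
  (exists2 m, m != 0 & s i = m *: S (e i)) -> (exists2 m, m != 0 & t j = m *: T (e j)) ->
  (forall a b, a *: s i0 + b *: s i = 0 -> a = 0 /\ b = 0) ->
  (forall a b, a *: t i0 + b *: t j = 0 -> a = 0 /\ b = 0) ->
  forall l m a1 b1 a2 b2 a3 b3, l + m = 1 ->
  l * a1 + m * a2 = a3 -> l * b1 + m * b2 = b3 ->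
  exists l' m', [/\ l' + m' = 1, l' * tau i a1 + m' * tau i a2 = tau i a3 &
    l' * rho j b1 + m' * rho j b2 = rho j b3].
Proof.
move=> Qi ii Qj ji Htau Hrho [ks ks0 es] [kt kt0 et] fs ft l m a1 b1 a2 b2 a3 b3 lm ea eb.
pose u a := e i0 + a *: e i; pose w b := e i0 + b *: e j.
have Vu a : onQ (u a) by exact: onQ_affine.
have Vw b : onQ (w b) by exact: onQ_affine.
pose sel (X : Type) (x y z : X) := fun k : 'I_3 => if k == 0 then x else if k == 1 then y else z.
have [||||z ez] := @Hp 3 xpredT (sel _ (u a1) (u a2) (e i)) (sel _ (w b1) (w b2) (e j))
    (u a3) (w b3) (sel _ l m (a3 * b3 - l * a1 * b1 - m * a2 * b2)).
- move=> k _; rewrite /sel; case: ifP => _ //; case: ifP => _ //.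
  by split; exact: onQ_delta.
- exact: Vu.
- exact: Vw.
- rewrite !big_ord_recl big_ord0 addr0 /sel /= /u /w -ea -eb.
  have o (x y : F) : (e i0 + x *: e i) *m (e i0 + y *: e j)^T = e i0 *m (e i0)^T +
      y *: (e i0 *m (e j)^T) + x *: (e i *m (e i0)^T) + (x * y) *: (e i *m (e j)^T).
    rewrite linearD linearZ /= mulmxDl !mulmxDr -!scalemxAr -!scalemxAl scalerA.
    by rewrite (mulrC y) !addrA.
  rewrite !o; move: (_ *m _) (_ *m _) (_ *m _) (_ *m _) => A B D E.
  have -> : l = 1 - m by rewrite -lm addrK.
  by apply/matrixP => p q; rewrite !mxE; ring.
rewrite !big_ord_recl big_ord0 addr0 /sel /= in ez.
have [c1 c10 e1] := Htau a1; have [c2 c20 e2] := Htau a2; have [c3 c30 e3] := Htau a3.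
have [d1 d10 f1] := Hrho b1; have [d2 d20 f2] := Hrho b2; have [d3 d30 f3] := Hrho b3.
rewrite /u /w e1 e2 e3 f1 f2 f3 in ez.
set x1 := z 0 in ez; set x2 := z (lift 0 0) in ez; set x3 := z _ in ez.
have eS : S (e i) = ks^-1 *: s i by rewrite es scalerK.
have eT : T (e j) = kt^-1 *: t j by rewrite et scalerK.
rewrite eS eT in ez.
pose l' := x1 * c1 * d1 / (c3 * d3); pose m' := x2 * c2 * d2 / (c3 * d3).
pose n' := x3 / (ks * kt) / (c3 * d3).
pose A := (1 - l' - m') *: t i0 + (rho j b3 - l' * rho j b1 - m' * rho j b2) *: t j.
pose B := (tau i a3 - l' * tau i a1 - m' * tau i a2) *: t i0 +
  (tau i a3 * rho j b3 - l' * tau i a1 * rho j b1 - m' * tau i a2 * rho j b2 - n') *: t j.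
have AB q : A q 0 = 0 /\ B q 0 = 0.
  apply: fs; apply/matrixP => p o; rewrite ord1.
  have /matrixP/(_ p q) := ez; rewrite !mxE !big_ord1 !mxE => E.
  apply: (mulfI (mulf_neq0 c30 d30)); rewrite mulr0.
  move/eqP: E; rewrite -subr_eq0 => /eqP <-.
  by rewrite /l' /m' /n'; field; rewrite ks0 kt0 c30 d30.
have A0 : A = 0 by apply/matrixP => q o; rewrite ord1 [RHS]mxE; case: (AB q).
have B0 : B = 0 by apply/matrixP => q o; rewrite ord1 [RHS]mxE; case: (AB q).
have [h1 h2] := ft _ _ A0; have [h3 _] := ft _ _ B0.
exists l', m'; split; apply/eqP; rewrite eq_sym -subr_eq0 opprD addrA; exact/eqP.
Qed.

(* Fundamental theorem of projective geometry for rank one tensors: collinear triples of points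
   [(tau a, rho b)] first force [tau = rho], then multiplicativity and additivity. *)
Lemma semilinear_pair : exists (tau : F -> F) (s t : 'I_N -> 'cV[F]_r),
  [/\ {morph tau : x y / x + y}, {morph tau : x y / x * y}, tau 1 = 1,
     forall v, onQ v -> par (S v) (\sum_(i | Q i) tau (v i 0) *: s i) &
     forall v, onQ v -> par (T v) (\sum_(i | Q i) tau (v i 0) *: t i)].
Proof.
have Sd := preserves_one T0 Hp; have Sr := reflects_one Hr.
have Td := preserves_one S0 (preserves_sym Hp); have Tr := reflects_one (reflects_sym Hr).
have [s [ks [ks0 sE ks1 su]]] := frame Qi0 S0 Sd Sr.
have [t [kt [kt0 tE kt1 tu]]] := frame Qi0 T0 Td Tr.
have [tau tauE] := coord_ex Qi0 S0 Sd Sr ks0 sE ks1.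
have [rho rhoE] := coord_ex Qi0 T0 Td Tr kt0 tE kt1.
have sf i a b Qi ii := @frame_free2 _ _ _ _ _ Qi0 _ Sr _ _ ks0 sE i a b Qi ii.
have tf i a b Qi ii := @frame_free2 _ _ _ _ _ Qi0 _ Tr _ _ kt0 tE i a b Qi ii.
have sk i : exists2 m, m != 0 & s i = m *: S (e i) by exists (ks i).
have tk i : exists2 m, m != 0 & t i = m *: T (e i) by exists (kt i).
have aff i j (Qi : Q i) (ii : i != i0) (Qj : Q j) (ji : j != i0) :=
  affine_collinear Qi ii Qj ji (tauE i Qi ii) (rhoE j Qj ji)
    (sk i) (tk j)
    (fun a b => sf i a b Qi ii) (fun a b => tf j a b Qj ji).
have t0 i : Q i -> i != i0 -> tau i 0 = 0 by exact: (coord0 Qi0 Sr ks0 sE ks1 tauE).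
have r0 i : Q i -> i != i0 -> rho i 0 = 0 by exact: (coord0 Qi0 Tr kt0 tE kt1 rhoE).
have t1 i : Q i -> i != i0 -> tau i 1 = 1 by exact: (coord1 Qi0 Sr ks0 sE su tauE).
have r1 i : Q i -> i != i0 -> rho i 1 = 1 by exact: (coord1 Qi0 Tr kt0 tE tu rhoE).
have ti i : Q i -> i != i0 -> injective (tau i).
  move=> Qi ii; exact: (coord_inj Qi0 Sr tauE Qi ii).
have eqtr i j x : Q i -> i != i0 -> Q j -> j != i0 -> tau i x = rho j x.
  move=> Qi ii Qj ji.
  (* The points [(1, 1)], [(0, 0)], [(x, x)] on the diagonal. *)
  have [|||l [m [_]]] := @aff i j Qi ii Qj ji x (1 - x) 1 1 0 0 x x; try ring.
  by rewrite t1 // r1 // t0 // r0 // !mulr0 !mulr1 !addr0 => <-.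
pose f := tau i1.
have ft i : Q i -> i != i0 -> tau i =1 f.
  by move=> Qi ii x; rewrite (eqtr i i1) // -(eqtr i1 i1).
have fr i : Q i -> i != i0 -> rho i =1 f by move=> Qi ii x; rewrite /f -(eqtr i1 i).
have f0 : f 0 = 0 by exact: t0.
have f1 : f 1 = 1 by exact: t1.
have fI : injective f by exact: ti.
have aff1 := @aff i1 i1 Qi1 i10 Qi1 i10.
have fM x y : f (x * y) = f x * f y.
  (* The points [(1, y)], [(0, 0)], [(x, x y)]. *)
  have [|||l [m [_]]] := @aff1 x (1 - x) 1 y 0 0 x (x * y); try ring.
  rewrite -/f !(fr i1) // f0 f1 !mulr0 !addr0 mulr1 => -> <-.
  by [].
have fN1 : f (-1) = -1.
  have /eqP : f (-1) * f (-1) = 1 by rewrite -fM mulrNN mul1r f1.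
  rewrite -expr2 sqrf_eq1 => /orP[/eqP h|/eqP //].
  have /eqP : -1 = 1 :> F by apply: fI; rewrite h f1.
  by move/eqP => ->.
have fN x : f (- x) = - f x by rewrite -mulN1r fM fN1 mulN1r.
have fD x b : f (x + b) = f x + f b.
  have [->|b0] := eqVneq b 0; first by rewrite f0 !addr0.
  (* The points [(0, b)], [(- b, 0)], [(x, x + b)] on a line of slope one; this is why
     [f (- b) = - f b] is settled beforehand. *)
  have [|||l [m [lm]]] := @aff1 ((x + b) / b) (- x / b) 0 b (- b) 0 x (x + b); try by field.
  rewrite -/f !(fr i1) // f0 fN !mulr0 !addr0 add0r => <- <-.
  have -> : l = 1 - m by rewrite -lm addrK.
  by ring.
exists f, s, t; split=> //.
- exact: (semilinear_one Qi0 S0 Sd Sr ks0 sE ks1 tauE f0 f1 fM fI ft Qi1 i10).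
- exact: (semilinear_one Qi0 T0 Td Tr kt0 tE kt1 rhoE f0 f1 fM fI fr Qi1 i10).
Qed.

End TwoMaps.

(** * Endomorphisms of the real and complex fields *)

Section RealEndo.
Variable R : realType.
Local Notation C := R[i].

(** Squares go to squares, so [f] preserves the order, and it fixes the integers. Hence [n x] and
    [n (f x)] lie in the same unit interval between integers for every [n], which is impossible for
    large [n] unless [f x = x]. *)
Lemma real_ring_endo_id (f : R -> R) : {morph f : x y / x + y} -> {morph f : x y / x * y} ->
  f 1 = 1 -> f =1 id.
Proof.
move=> fD fM f1.
have f0 : f 0 = 0 by apply: (addrI (f 0)); rewrite -fD !addr0.
have fN x : f (- x) = - f x by apply/eqP; rewrite -addr_eq0 -fD addNr f0.
have fge0 x : 0 <= x -> 0 <= f x.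
  by move=> x0; rewrite -(sqr_sqrtr x0) expr2 fM -expr2 sqr_ge0.
have fle x y : x <= y -> f x <= f y.
  by move=> xy; rewrite -subr_ge0 -fN -fD fge0 // subr_ge0.
have fn (n : nat) : f n%:R = n%:R.
  by elim: n => // n IH; rewrite -natr1 fD IH f1.
have fz (m : int) : f m%:~R = m%:~R.
  by case: m => n; [exact: fn | rewrite NegzE mulrNz fN; congr (- _); exact: fn].
move=> x; apply/eqP; rewrite -subr_eq0 -normr_eq0; apply/eqP.
apply/eqP; rewrite eq_le normr_ge0 andbT leNgt; apply/negP => d0.
set dl := `|f x - x| in d0.
pose n := (Num.truncn (2 / dl)).+1.
have n0 : 0 < n%:R :> R by rewrite ltr0n.
have hn : 2 < dl * n%:R.
  rewrite mulrC -ltr_pdivrMr //; apply: truncnS_gt.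
pose m := Num.floor (n%:R * x).
have m1 : m%:~R <= n%:R * x by exact: floor_le_tmp.
have m2 : n%:R * x <= (m + 1)%:~R by exact/ltW/floorD1_gt.
have := fle _ _ m1; have := fle _ _ m2; rewrite !fM !fz fn => h2 h1.
have : dl * n%:R <= 1.
  rewrite /dl -[X in _ * X](ger0_norm (ltW n0)) -normrM ler_norml.
  rewrite intrD in h2 m2; apply/andP; split; lra.
lra.
Qed.

(** Commuting with conjugation keeps the reals invariant; this excludes the wild endomorphisms of
    the complex field and leaves only the choice of the image of [i]. *)
Lemma complex_ring_endo (f : C -> C) : {morph f : x y / x + y} -> {morph f : x y / x * y} ->
  f 1 = 1 -> (forall z, f z^* = (f z)^*) ->
  (forall z, f z = z) \/ (forall z, f z = z^*).
Proof.
move=> fD fM f1 fJ.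
have real z : z^* = z -> f z = (complex.Re (f z))%:C%C.
  move=> zz; have := fJ z; rewrite zz; case: (f z) => a b [] /eqP.
  by rewrite -addr_eq0 -mulr2n mulrn_eq0 /= => /eqP ->.
pose g x := complex.Re (f x%:C%C).
have fg x : f x%:C%C = (g x)%:C%C by apply: real; exact: conjc_real.
have g_id : g =1 id.
  apply: real_ring_endo_id => [x y|x y|]; last by rewrite /g f1.
    by apply: complexI; rewrite -fg !rmorphD /= fD !fg.
  by apply: complexI; rewrite -fg !rmorphM /= fM !fg.
have fr x : f x%:C%C = x%:C%C by rewrite fg g_id.
have i2 : f 'i%C = 'i%C \/ f 'i%C = - 'i%C.
  have : f 'i%C ^+ 2 = 'i%C ^+ 2.
    rewrite expr2 -fM -expr2 sqr_i.
    have -> : -1 = (-1)%:C%C :> C by rewrite rmorphN1.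
    exact: fr.
  by move/eqP; rewrite eqf_sqr => /orP[/eqP ->|/eqP ->]; [left | right].
case: i2 => fi; [left | right] => z.
  by rewrite [z]complexE fD fM fi !fr.
rewrite [z]complexE fD fM fi !fr rmorphD rmorphM /=.
have -> : (complex.Re z)%:C%C^* = (complex.Re z)%:C%C by exact: conjc_real.
have -> : (complex.Im z)%:C%C^* = (complex.Im z)%:C%C by exact: conjc_real.
congr (_ + _ * _); by apply/eqP; rewrite eq_complex /= oppr0 !eqxx.
Qed.

End RealEndo.

(** * Isometry underlying a BJ isomorphism *)

Section Structure.
Variable R : realType.
Local Notation C := R[i].
Local Notation cj := (map_mx (@Num.conj C)).

Section OneClass.
Variables (N r : nat) (K L : finType) (c : 'I_N -> K) (d : 'I_r -> L).
Variables (Phi : 'M[C]_N -> 'M[C]_r) (Psi : 'M[C]_r -> 'M[C]_N).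
Hypothesis HP : BJpair c d Phi Psi.
Variables (k : K).

Lemma onQ_inV (v : 'cV[C]_N) : onQ (fun i => c i == k) v <-> inV c k v.
Proof. by []. Qed.

Lemma class_semilinear (i0 i1 : 'I_N) : c i0 = k -> c i1 = k -> i1 != i0 ->
  exists (sw : bool) (tau : C -> C) (s t : 'I_N -> 'cV[C]_r),
  [/\ {morph tau : x y / x + y}, {morph tau : x y / x * y}, tau 1 = 1 &
   forall v w, inV c k v -> inV c k w ->
     let x := \sum_(i | c i == k) tau (v i 0) *: s i in
     let y := \sum_(i | c i == k) tau (w i 0) *: t i in
     if sw then cor c d Phi v w y x else cor c d Phi v w x y].
Proof.
move=> ci0 ci1 i10.
have i01 : i0 != i1 by rewrite eq_sym.
have [sw [S [T HST]]] := cor_split HP ci0 ci1 i01.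
pose Q : pred 'I_N := fun i => c i == k.
have V0 := inV_delta R ci0.
have S0 v : onQ Q v -> S v != 0.
  by move=> /onQ_inV Vv; have := HST v _ Vv V0; case: (sw) => -[_ /adm_neq0[]].
have T0 v : onQ Q v -> T v != 0.
  by move=> /onQ_inV Vv; have := HST _ v V0 Vv; case: (sw) => -[_ /adm_neq0[]].
have Hp : preserves_dep Q S T.
  move=> p D v w v0 w0 a HV Vv Vw e0.
  have H0 := HST v0 w0 Vv Vw.
  have H1 q : D q -> _ := fun Dq => HST (v q) (w q) (HV q Dq).1 (HV q Dq).2.
  case: (sw) H0 H1 => H0 H1; last exact: (cor_dep HP H1 H0 e0).
  have [b eb] := cor_dep HP H1 H0 e0.
  by exists b; rewrite -sum_tr -eb trmx_mul trmxK.
have Hr : reflects_dep Q S T.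
  move=> p D v w v0 w0 a HV Vv Vw e0.
  have H0 := HST v0 w0 Vv Vw.
  have H1 q : D q -> _ := fun Dq => HST (v q) (w q) (HV q Dq).1 (HV q Dq).2.
  case: (sw) H0 H1 => H0 H1.
    apply: (cor_dep (a := a) (BJpair_sym HP) (fun q Dq => cor_sym HP (H1 q Dq)) (cor_sym HP H0)).
    by rewrite -sum_tr -e0 trmx_mul trmxK.
  exact: (cor_dep (BJpair_sym HP) (fun q Dq => cor_sym HP (H1 q Dq)) (cor_sym HP H0) e0).
have Q0 : Q i0 by apply/eqP.
have Q1 : Q i1 by apply/eqP.
have [tau [s [t [tD tM t1 Hs Ht]]]] := semilinear_pair Q0 Q1 i10 S0 T0 Hp Hr.
exists sw, tau, s, t; split=> // v w Vv Vw x y.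
have := HST v w Vv Vw; case: (sw) => h.
  by apply: cor_change h (par_refl _) (par_refl _) (Ht w Vw) (Hs v Vv).
by apply: cor_change h (par_refl _) (par_refl _) (Hs v Vv) (Ht w Vw).
Qed.

End OneClass.

(** [a] always determines [x] and [b] determines [y]; the flag [sw] tells which of [a] and [b] is
    the left vector in the source. *)
Definition scor N r (K L : finType) (c : 'I_N -> K) (d : 'I_r -> L)
    (Phi : 'M[C]_N -> 'M[C]_r) (sw : bool) (a b : 'cV[C]_N) (x y : 'cV[C]_r) : Prop :=
  if sw then cor c d Phi b a x y else cor c d Phi a b x y.

Lemma bf_cj_outer N (v w a b : 'cV[C]_N) :
  bf (cj (v *m w^T)) a b = ((cj v)^T *m a) 0 0 * ((cj w)^T *m b) 0 0.
Proof.
rewrite /bf map_mxM -map_trmx.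
have -> : a^T *m (cj v *m (cj w)^T) *m b = (a^T *m cj v) *m ((cj w)^T *m b) by rewrite !mulmxA.
rewrite [LHS]mxE big_ord1; congr (_ * _).
have -> : (cj v)^T *m a = (a^T *m cj v)^T by rewrite trmx_mul trmxK.
by rewrite [RHS]mxE.
Qed.

Lemma bf_affl N (Y : 'M[C]_N) (a b w : 'cV[C]_N) t :
  bf Y (a - t *: b) w = bf Y a w - t * bf Y b w.
Proof.
have h (x y : 'M[C]_1) : (x - t *: y) 0 0 = x 0 0 - t * y 0 0 by rewrite !mxE.
have e : (a - t *: b)^T = a^T - t *: b^T by apply/matrixP => i j; rewrite !mxE.
by rewrite /bf e !mulmxBl -!scalemxAl h.
Qed.

Lemma bf_affr N (Y : 'M[C]_N) (a b w : 'cV[C]_N) t :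
  bf Y w (a - t *: b) = bf Y w a - t * bf Y w b.
Proof.
have h (x y : 'M[C]_1) : (x - t *: y) 0 0 = x 0 0 - t * y 0 0 by rewrite !mxE.
by rewrite /bf !mulmxBr -!scalemxAr h.
Qed.

Lemma dot_delta N (u : 'cV[C]_N) i : ((cj u)^T *m (delta_mx i 0 : 'cV[C]_N)) 0 0 = (u i 0)^*.
Proof.
rewrite mxE (bigD1 i) //= !mxE !eqxx mulr1 big1 ?addr0 // => j /negPf ji.
by rewrite !mxE ji mulr0.
Qed.

Section Global.
Variables (N r : nat) (K L : finType) (c : 'I_N -> K) (d : 'I_r -> L).
Variables (Phi : 'M[C]_N -> 'M[C]_r) (Psi : 'M[C]_r -> 'M[C]_N).
Hypothesis HP : BJpair c d Phi Psi.
Hypothesis c2 : forall i, exists2 j, j != i & c j = c i.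

(** The frames of the separate blocks become the columns of two matrices. On an exchanged block the
    columns of [A] come from the frame of the second variable, so that [A] always produces the left
    vector of the image. *)
Lemma global_semilinear : exists (sw : K -> bool) (tau : K -> C -> C) (A B : 'M[C]_(r, N)),
  (forall k, [/\ {morph tau k : x y / x + y}, {morph tau k : x y / x * y} & tau k 1 = 1]) /\
  forall k a b, inV c k a -> inV c k b ->
    scor c d Phi (sw k) a b (A *m map_mx (tau k) a) (B *m map_mx (tau k) b).
Proof.
have /choice[f Hf] : forall k, exists q : bool * (C -> C) * ('I_N -> 'cV[C]_r) * ('I_N -> 'cV[C]_r),
  [/\ {morph q.1.1.2 : x y / x + y}, {morph q.1.1.2 : x y / x * y}, q.1.1.2 1 = 1 &
   forall v w, inV c k v -> inV c k w ->
     let x := \sum_(i | c i == k) q.1.1.2 (v i 0) *: q.1.2 i in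
     let y := \sum_(i | c i == k) q.1.1.2 (w i 0) *: q.2 i in
     if q.1.1.1 then cor c d Phi v w y x else cor c d Phi v w x y].
  move=> k; have [[i0 ci0]|n0] := pselect (exists i, c i = k).
    have [i1 i10 ci1] := c2 i0; rewrite ci0 in ci1.
    have [sw [tau [s [t H]]]] := class_semilinear HP ci0 ci1 i10.
    by exists (sw, tau, s, t).
  exists (false, id, (fun=> 0), (fun=> 0)); split=> // v w [sv v0].
  case/eqP: v0; apply/matrixP => i j; rewrite ord1 mxE sv //.
  by apply/eqP => ci; apply: n0; exists i.
pose sw k := (f k).1.1.1; pose tau k := (f k).1.1.2.
pose A : 'M[C]_(r, N) := \matrix_(i, j) (if sw (c j) then (f (c j)).2 j i 0 else (f (c j)).1.2 j i 0).
pose B : 'M[C]_(r, N) := \matrix_(i, j) (if sw (c j) then (f (c j)).1.2 j i 0 else (f (c j)).2 j i 0).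
exists sw, tau, A, B; split=> [k|k a b Va Vb]; first by have [] := Hf k.
have [tD tM t1 H] := Hf k.
have t0 : tau k 0 = 0 by apply: (addrI (tau k 0)); rewrite -tD !addr0.
have E (u : 'cV[C]_N) (M : 'M[C]_(r, N)) (s : 'I_N -> 'cV[C]_r) : inV c k u ->
    (forall j, c j = k -> forall i, M i j = s j i 0) ->
    M *m map_mx (tau k) u = \sum_(i | c i == k) tau k (u i 0) *: s i.
  move=> [su _] HM; apply/matrixP => i j; rewrite ord1 mxE summxE [RHS]big_mkcond.
  apply: eq_bigr => q _; rewrite !mxE; case: eqVneq => [cq|cq].
    by rewrite (HM q cq) mulrC.
  by rewrite su // t0 mulr0.
rewrite /scor; case sk : (sw k).
  rewrite (E a A (f k).2) //; last by move=> j cj' i; rewrite mxE cj' sk.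
  rewrite (E b B (f k).1.2) //; last by move=> j cj' i; rewrite mxE cj' sk.
  by have := H b a Vb Va; rewrite -/(sw k) sk.
rewrite (E a A (f k).1.2) //; last by move=> j cj' i; rewrite mxE cj' sk.
rewrite (E b B (f k).2) //; last by move=> j cj' i; rewrite mxE cj' sk.
by have := H a b Va Vb; rewrite -/(sw k) sk.
Qed.

Variables (sw : K -> bool) (tau : K -> C -> C) (A B : 'M[C]_(r, N)).
Hypothesis Htau : forall k,
  [/\ {morph tau k : x y / x + y}, {morph tau k : x y / x * y} & tau k 1 = 1].
Hypothesis HAB : forall k a b, inV c k a -> inV c k b ->
    scor c d Phi (sw k) a b (A *m map_mx (tau k) a) (B *m map_mx (tau k) b).

Lemma tau0 k : tau k 0 = 0.
Proof. by have [tD _ _] := Htau k; apply: (addrI (tau k 0)); rewrite -tD !addr0. Qed.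

Lemma tauN k x : tau k (- x) = - tau k x.
Proof. by have [tD _ _] := Htau k; apply/eqP; rewrite -addr_eq0 -tD addNr tau0. Qed.

Lemma map_tau_delta k i : map_mx (tau k) (delta_mx i 0 : 'cV[C]_N) = delta_mx i 0.
Proof.
apply/matrixP => p q; rewrite !mxE; have [_ _ t1] := Htau k.
by case: (_ && _); rewrite ?t1 ?tau0.
Qed.

Lemma scor_delta i j : c i = c j -> scor c d Phi (sw (c i)) (delta_mx i 0) (delta_mx j 0)
  (col i A) (col j B).
Proof.
move=> ij; have := HAB (inV_delta R (erefl (c i))) (inV_delta R (esym ij)).
by rewrite !map_tau_delta -!colE.
Qed.

Lemma scor_adm b v w x y : scor c d Phi b v w x y -> adm d x y.
Proof. by case: b => -[]. Qed.

Lemma cor_delta i : cor c d Phi (delta_mx i 0) (delta_mx i 0) (col i A) (col i B).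
Proof. by have := scor_delta (erefl (c i)); rewrite /scor; case: ifP. Qed.

Lemma par_supp (u v : 'cV[C]_N) k : supp c k v -> par u v -> supp c k u.
Proof. by move=> sv [m m0 ->]; exact: suppZ. Qed.

(** If columns [i] and [j] lie in one class of [d], then column [i] of [A] and column [j] of [B]
    form an admissible pair. Its preimage shares a factor with both [e_i] tensor [e_i] and [e_j]
    tensor [e_j], which puts [i] and [j] in one block. *)
Lemma col_class : exists ell : 'I_N -> L,
  [/\ forall i, supp d (ell i) (col i A), forall i, supp d (ell i) (col i B) &
      forall i j, ell i = ell j <-> c i = c j].
Proof.
have /choice[ell He] : forall i, exists l, supp d l (col i A) /\ supp d l (col i B).
  by move=> i; have [_ [l [h1 h2 _ _]] _] := cor_delta i; exists l.
have n0 i : col i A != 0 /\ col i B != 0.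
  by have [_ /adm_neq0] := cor_delta i.
exists ell; split=> [i|i|i j]; [by have [] := He i | by have [] := He i | split=> [e|ij]].
  have a : adm d (col i A) (col j B).
    exists (ell i); split; [exact: (He i).1 | rewrite e; exact: (He j).2
      | exact: (n0 i).1 | exact: (n0 j).2].
  have [v [w [h _]]] := cor_ex (BJpair_sym HP) a.
  have [_ [k [sv sv' v0 w0]] _] := h.
  have h1 := cor_adj_l (BJpair_sym HP) (cor_sym HP (cor_delta i)) h (par_refl _).
  have h2 := cor_adj_r (BJpair_sym HP) (cor_sym HP (cor_delta j)) h (par_refl _).
  have E (u : 'cV[C]_N) q : supp c k u -> par (delta_mx q 0 : 'cV[C]_N) u -> c q = k.
    move=> su /(par_supp su) sd.
    have q0 : (delta_mx q 0 : 'cV[C]_N) != 0 by exact: delta_neq0.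
    exact: (supp_inj q0 (@supp_delta R N K c q) sd).
  have -> : c i = k by case: h1; apply: E.
  by case: h2 => /E <-.
have [l [sA sB _ _]] := scor_adm (scor_delta ij).
rewrite (supp_inj (n0 i).1 (He i).1 sA).
by rewrite (supp_inj (n0 j).2 (He j).2 sB).
Qed.

Lemma scor_preimage x y : adm d x y -> exists k a b, [/\ inV c k a, inV c k b &
  par x (A *m map_mx (tau k) a) /\ par y (B *m map_mx (tau k) b)].
Proof.
move=> /(cor_ex (BJpair_sym HP))[v [w [/(cor_sym (BJpair_sym HP)) h _]]].
have [[k [sv sv' v0 w0]] _ _] := h.
case sk : (sw k); [exists k, w, v | exists k, v, w]; split=> //.
  have := @HAB k w v (conj sv' w0) (conj sv v0); rewrite /scor sk => h'.
  by apply/(cor_parP HP h' h); split; exact: par_refl.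
have := @HAB k v w (conj sv v0) (conj sv' w0); rewrite /scor sk => h'.
by apply/(cor_parP HP h' h); split; exact: par_refl.
Qed.

Lemma right_inverse (M : 'M[C]_(r, N)) :
  (forall j, exists k a, par (delta_mx j 0) (M *m map_mx (tau k) a)) ->
  exists M' : 'M[C]_(N, r), M *m M' = 1%:M.
Proof.
move=> H; have /choice[f Hf] : forall j, exists y : 'cV[C]_N, M *m y = delta_mx j 0.
  move=> j; have [k [a [m m0 e]]] := H j; exists (m *: map_mx (tau k) a).
  by rewrite -scalemxAr -e.
exists (\matrix_(i, j) f j i 0); apply/matrixP => i j.
have /matrixP/(_ i 0) := Hf j; rewrite !mxE eqxx andbT => <-.
by apply: eq_bigr => q _; rewrite mxE.
Qed.

Lemma right_inverseA : exists A' : 'M[C]_(N, r), A *m A' = 1%:M.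
Proof.
apply: right_inverse => j.
have [k [a [b [_ _ [h _]]]]] := scor_preimage (adm_delta R (erefl (d j))).
by exists k, a.
Qed.

Lemma right_inverseB : exists B' : 'M[C]_(N, r), B *m B' = 1%:M.
Proof.
apply: right_inverse => j.
have [k [a [b [_ _ [_ h]]]]] := scor_preimage (adm_delta R (erefl (d j))).
by exists k, b.
Qed.

Lemma bf_supp0 (Z : 'M[C]_r) l l' x y : inA d Z -> supp d l x -> supp d l' y -> l != l' ->
  bf Z x y = 0.
Proof.
move=> hZ sx sy ll; rewrite bf_sum big1 // => i _; rewrite big1 // => j _.
rewrite outerE; have [il|il] := eqVneq (d i) l; last by rewrite sx // mul0r mulr0.
have [jl|jl] := eqVneq (d j) l'; last by rewrite sy // !mulr0.
by rewrite hZ ?mul0r // il jl.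
Qed.

Lemma bf_pull (Z : 'M[C]_r) (y z : 'cV[C]_N) :
  bf (A^T *m Z *m B) y z = bf Z (A *m y) (B *m z).
Proof. by rewrite /bf trmx_mul !mulmxA. Qed.

Definition swp (T : Type) (b : bool) (p q : T) := if b then q else p.

(** Testing [Phi X] on the image of [e_i - t e_p], with [t] making this vector orthogonal to [a],
    shows that each row of the block of the pulled back matrix is a multiple of the row [p]; columns
    are treated likewise with [b]. Entries outside the block vanish, and the right inverses of [A]
    and [B] transport the factorisation to [Phi X]. *)
Lemma image_rank1 k a b : inV c k a -> inV c k b ->
  exists x y : 'cV[C]_r, Phi (cj (swp (sw k) a b *m (swp (sw k) b a)^T)) = x *m y^T.
Proof.
move=> Va Vb; set X := cj _; set Z := Phi X.
have hX : inA c X.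
  apply/inA_conj; case: (Va) (Vb) => sa _ [sb _]; rewrite /swp.
  by case: ifP => _; [exact: inA_outer sb sa | exact: inA_outer sa sb].
have hZ : inA d Z by have [h1 _ _ _ _] := HP; exact: h1.
have kerZ a2 b2 : inV c k a2 -> inV c k b2 ->
    ((cj a)^T *m a2) 0 0 * ((cj b)^T *m b2) 0 0 = 0 ->
    bf Z (A *m map_mx (tau k) a2) (B *m map_mx (tau k) b2) = 0.
  move=> V2 W2 z0; have := HAB V2 W2; rewrite /scor; move: hX; rewrite /Z /X /swp.
  case: ifP => _ hX' [_ _ h]; apply/(h _ hX'); rewrite bf_cj_outer //.
  by rewrite mulrC.
have [tD tM t1] := Htau k.
have [p ap] := vec_neq0 Va.2; have [q bq] := vec_neq0 Vb.2.
have ap' : (a p 0)^* != 0 by rewrite conjC_eq0.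
have bq' : (b q 0)^* != 0 by rewrite conjC_eq0.
have cp : c p = k by apply/eqP/negPn/negP => /(Va.1) h; rewrite h eqxx in ap.
have cq : c q = k by apply/eqP/negPn/negP => /(Vb.1) h; rewrite h eqxx in bq.
pose G := A^T *m Z *m B.
have Gd i j : G i j = bf Z (col i A) (col j B).
  by rewrite -bf_delta bf_pull -!colE.
have mapD (u : 'cV[C]_N) (i m : 'I_N) (t : C) :
   map_mx (tau k) (delta_mx i 0 - t *: delta_mx m 0 : 'cV[C]_N) =
   delta_mx i 0 - tau k t *: delta_mx m 0.
  apply/matrixP => i' j'; rewrite !mxE tD tauN tM.
  by case: (_ && _); case: (_ && _); rewrite ?t1 ?tau0.
have dotD (u : 'cV[C]_N) i m t :
   ((cj u)^T *m (delta_mx i 0 - t *: delta_mx m 0 : 'cV[C]_N)) 0 0 = (u i 0)^* - t * (u m 0)^*.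
  have h (x y : 'M[C]_1) : (x - t *: y) 0 0 = x 0 0 - t * y 0 0 by rewrite !mxE.
  by rewrite mulmxBr -scalemxAr h !dot_delta.
have GA i j : c i = k -> c j = k -> G i j = tau k ((a i 0)^* / (a p 0)^*) * G p j.
  move=> ci cj'; set t := _ / _.
  have : bf Z (A *m map_mx (tau k) (delta_mx i 0 - t *: delta_mx p 0))
              (B *m map_mx (tau k) (delta_mx j 0)) = 0.
    have [e0|n0] := eqVneq (delta_mx i 0 - t *: delta_mx p 0 : 'cV[C]_N) 0.
      rewrite e0; have -> : map_mx (tau k) (0 : 'cV[C]_N) = 0.
        by apply/matrixP => ? ?; rewrite !mxE tau0.
      by rewrite mulmx0 /bf trmx0 !mul0mx mxE.
    apply: kerZ; last by rewrite dotD /t divfK // subrr mul0r.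
      split=> //; rewrite -scaleNr; apply: suppD; first by rewrite -ci; exact: supp_delta.
      by apply: suppZ; rewrite -cp; exact: supp_delta.
    exact: inV_delta.
  rewrite mapD // map_tau_delta -!bf_pull -/G => h; apply/eqP; rewrite -subr_eq0 -h.
  by rewrite -!bf_delta bf_affl.
have GB j : c j = k -> G p j = tau k ((b j 0)^* / (b q 0)^*) * G p q.
  move=> cj'; set t := _ / _.
  have : bf Z (A *m map_mx (tau k) (delta_mx p 0))
              (B *m map_mx (tau k) (delta_mx j 0 - t *: delta_mx q 0)) = 0.
    have [e0|n0] := eqVneq (delta_mx j 0 - t *: delta_mx q 0 : 'cV[C]_N) 0.
      rewrite e0; have -> : map_mx (tau k) (0 : 'cV[C]_N) = 0.
        by apply/matrixP => ? ?; rewrite !mxE tau0.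
      by rewrite mulmx0 /bf mulmx0 mxE.
    apply: kerZ; last by rewrite dotD /t divfK // subrr mulr0.
      exact: inV_delta.
    split=> //; rewrite -scaleNr; apply: suppD; first by rewrite -cj'; exact: supp_delta.
    by apply: suppZ; rewrite -cq; exact: supp_delta.
  rewrite mapD // map_tau_delta -!bf_pull -/G => h; apply/eqP; rewrite -subr_eq0 -h.
  by rewrite -!bf_delta bf_affr.
pose al : 'cV[C]_N := \col_i tau k ((a i 0)^* / (a p 0)^*).
pose be : 'cV[C]_N := \col_j tau k ((b j 0)^* / (b q 0)^*).
have zero (u : 'cV[C]_N) i x : inV c k u -> c i != k -> tau k ((u i 0)^* / x) = 0.
  by move=> [su _] ci; rewrite su // conjC0 mul0r tau0.
have eG : G = G p q *: (al *m be^T).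
  apply/matrixP => i j; rewrite [RHS]mxE outerE [al _ _]mxE [be _ _]mxE.
  have [ci|ci] := eqVneq (c i) k; have [cj'|cj'] := eqVneq (c j) k.
  - by rewrite GA // GB //; ring.
  - rewrite [X in _ * (_ * X)]zero // !mulr0 Gd.
    have [ell [h1 h2 h3]] := col_class; apply: (bf_supp0 hZ (h1 i) (h2 j)).
    by apply/eqP => /h3 e; rewrite -e ci eqxx in cj'.
  - rewrite [X in _ * (X * _)]zero // mul0r !mulr0 Gd.
    have [ell [h1 h2 h3]] := col_class; apply: (bf_supp0 hZ (h1 i) (h2 j)).
    by apply/eqP => /h3 e; rewrite e cj' eqxx in ci.
  rewrite [X in _ * (_ * X)]zero // !mulr0 Gd.
  have [ij|ij] := eqVneq (c i) (c j); last first.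
    have [ell [h1 h2 h3]] := col_class; apply: (bf_supp0 hZ (h1 i) (h2 j)).
    by apply/eqP => /h3 e; rewrite e eqxx in ij.
  have z u : inV c k u -> ((cj u)^T *m (delta_mx i 0 : 'cV[C]_N)) 0 0 = 0.
    by move=> [su _]; rewrite dot_delta su // conjC0.
  have := scor_delta ij; rewrite /scor; move: hX; rewrite /Z /X; case: ifP => _ hX' [_ _ h].
    apply/(h _ hX'); rewrite bf_cj_outer /swp; case: ifP => _.
      by rewrite (z a Va) mulr0.
    by rewrite (z b Vb) mulr0.
  apply/(h _ hX'); rewrite bf_cj_outer /swp; case: ifP => _.
    by rewrite (z b Vb) mul0r.
  by rewrite (z a Va) mul0r.
have [A' hA] := right_inverseA; have [B' hB] := right_inverseB.
have eZ : Z = A'^T *m G *m B'.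
  by rewrite /G !mulmxA -trmx_mul hA trmx1 mul1mx -mulmxA hB mulmx1.
exists (G p q *: (A'^T *m al)), (B'^T *m be).
move: eZ; rewrite {1}eG => ->.
by rewrite trmx_mul trmxK -scalemxAr -!scalemxAl !mulmxA.
Qed.

Lemma image_rank1_adm v w : adm c v w -> exists x y : 'cV[C]_r, Phi (cj (v *m w^T)) = x *m y^T.
Proof.
move=> [k [sv sw' v0 w0]].
case sk : (sw k).
  by have := @image_rank1 k w v (conj sw' w0) (conj sv v0); rewrite /swp sk.
by have := @image_rank1 k v w (conj sv v0) (conj sw' w0); rewrite /swp sk.
Qed.

(** The set to which [Phi X] is orthogonal is itself the kernel of a rank one functional, by
    [cor_ex]. As [Phi X] has rank one, that functional is the one built from its own factors. *)
Lemma image_outer v w x y : cor c d Phi v w x y ->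
  exists2 m, m != 0 & Phi (cj (v *m w^T)) = m *: cj (x *m y^T).
Proof.
move=> h; have [av axy _] := h; have [h1 h2 h3 h4 h5] := HP.
have [x1 [y1 [h' HB]]] := cor_ex HP av.
have [x' [y' eZ]] := image_rank1_adm av.
set Z := Phi _ in HB eZ *.
have hX : inA c (cj (v *m w^T)) by exact/inA_conj/adm_outer.
have hZ : inA d Z by exact: h1.
have [v0 w0] := adm_neq0 av.
have Z0 : Z != 0.
  apply: (BJpair_neq0 HP hX); apply/eqP => e; have := outer_neq0 v0 w0.
  by rewrite -(map_conjK (v *m w^T)) e map_mx0 eqxx.
have x'0 : cj x' != 0.
  apply: contra Z0 => /eqP e; rewrite eZ -(map_conjK x') e map_mx0 mul0mx //.
have y'0 : cj y' != 0.
  apply: contra Z0 => /eqP e; rewrite eZ -(map_conjK y') e map_mx0 trmx0 mulmx0 //.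
have eZ' : Z = cj (cj x' *m (cj y')^T) by rewrite map_mxM -map_trmx !map_conjK.
have hZc : inA d (cj x' *m (cj y')^T) by rewrite -[X in inA _ X]map_conjK -eZ'; exact: inA_conj.
have [a1 _] : adm d x1 y1 /\ True by case: h'.
have [_||Y hY HY|b] := @bf_span R r L d 1 (fun=> x1) (fun=> y1) (cj x') (cj y').
- exact: adm_outer.
- exact: hZc.
- by apply/(BJ_rank1 _ x'0 y'0); rewrite -eZ'; apply/(HB Y hY); exact: (HY 0).
rewrite big_ord1 => eb.
have [p1 p2] := outer_eq x'0 y'0 eb.
have [p3 p4] : par x1 x /\ par y1 y by apply/(cor_parP HP h h'); split; exact: par_refl.
have [m1 m10 e1] := par_trans p1 p3; have [m2 m20 e2] := par_trans p2 p4.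
exists (m1 * m2)^*; first by rewrite conjC_eq0 mulf_neq0.
by rewrite eZ' e1 e2 linearZ /= -scalemxAl -scalemxAr scalerA map_mxZ.
Qed.

(** The left side says that the functional of [v2], [w2] kills the conjugated tensor of [v1], [w1],
    and [Phi] sends this matrix to a multiple of the corresponding one. *)
Lemma cor_orth v1 w1 x1 y1 v2 w2 x2 y2 : cor c d Phi v1 w1 x1 y1 -> cor c d Phi v2 w2 x2 y2 ->
  ((cj v1)^T *m v2) 0 0 * ((cj w1)^T *m w2) 0 0 = 0 <->
  ((cj x1)^T *m x2) 0 0 * ((cj y1)^T *m y2) 0 0 = 0.
Proof.
move=> h1 h2; rewrite -!bf_cj_outer.
have [m m0 e] := image_outer h1; have [_ _ H] := h2.
have [a1 _ _] := h1; have hX : inA c (cj (v1 *m w1^T)) by exact/inA_conj/adm_outer.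
split=> [/(H _ hX)|z]; last by apply/(H _ hX); rewrite e bfZl z mulr0.
by rewrite e bfZl => /eqP; rewrite mulf_eq0 (negPf m0) => /eqP.
Qed.

End Global.
End Structure.

(** * Semilinear maps that preserve orthogonality *)

Section Unitary.
Variable R : realType.
Local Notation C := R[i].
Local Notation cj := (map_mx (@Num.conj C)).

Definition dot m (x y : 'cV[C]_m) : C := ((cj x)^T *m y) 0 0.

Lemma dotDr m (x y z : 'cV[C]_m) : dot x (y + z) = dot x y + dot x z.
Proof. by rewrite /dot mulmxDr mxE. Qed.

Lemma dotZr m (x y : 'cV[C]_m) t : dot x (t *: y) = t * dot x y.
Proof. by rewrite /dot -scalemxAr mxE. Qed.

Lemma dotC m (x y : 'cV[C]_m) : dot y x = (dot x y)^*.
Proof. exact: dot_conj. Qed.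

Lemma dotDl m (x y z : 'cV[C]_m) : dot (x + y) z = dot x z + dot y z.
Proof. by rewrite dotC dotDr rmorphD /= -!dotC. Qed.

Lemma dotZl m (x y : 'cV[C]_m) t : dot (t *: x) y = t^* * dot x y.
Proof. by rewrite dotC dotZr rmorphM /= -dotC. Qed.

Lemma dot_self m (x : 'cV[C]_m) : dot x x = (vnorm x ^+ 2)%:C%C.
Proof. exact: vnorm_dot. Qed.

Lemma dot_self_eq0 m (x : 'cV[C]_m) : (dot x x == 0) = (x == 0).
Proof. by rewrite dot_self fmorph_eq0 sqrf_eq0 vnorm_eq0. Qed.

Lemma dotE m n (M : 'M[C]_(m, n)) i j : ((cj M)^T *m M) i j = dot (col i M) (col j M).
Proof. by rewrite /dot !mxE; apply: eq_bigr => l _; rewrite !mxE. Qed.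

Lemma dot_deltas m (i j : 'I_m) :
  dot (delta_mx i 0 : 'cV[C]_m) (delta_mx j 0) = (i == j)%:R.
Proof. by rewrite /dot dot_delta mxE eqxx andbT eq_sym; case: eqVneq => _; rewrite ?conjC1 ?conjC0. Qed.

Lemma dot_supp0 m (L : finType) (d : 'I_m -> L) l l' (x y : 'cV[C]_m) :
  supp d l x -> supp d l' y -> l != l' -> dot x y = 0.
Proof.
move=> sx sy ll; rewrite /dot mxE big1 // => i _; rewrite !mxE.
have [il|il] := eqVneq (d i) l; last by rewrite sx // conjC0 mul0r.
by rewrite sy ?mulr0 // il.
Qed.

Section Semiunitary.
Variables (N r : nat) (K L : finType) (c : 'I_N -> K) (d : 'I_r -> L).
Hypothesis c2 : forall i, exists2 j, j != i & c j = c i.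
Variables (tau : K -> C -> C) (M : 'M[C]_(r, N)).
Hypothesis Htau : forall k,
  [/\ {morph tau k : x y / x + y}, {morph tau k : x y / x * y} & tau k 1 = 1].
Hypothesis orth : forall k a b, inV c k a -> inV c k b ->
  (dot a b = 0 <-> dot (M *m map_mx (tau k) a) (M *m map_mx (tau k) b) = 0).

Lemma mul_map_two k i j t : M *m map_mx (tau k) (delta_mx i 0 + t *: delta_mx j 0) =
  col i M + tau k t *: col j M.
Proof.
have [tD tM t1] := Htau k; have t0 := tau0 Htau k.
have -> : map_mx (tau k) (delta_mx i 0 + t *: delta_mx j 0 : 'cV[C]_N) =
   delta_mx i 0 + tau k t *: delta_mx j 0.
  apply/matrixP => i' j'; rewrite !mxE tD tM.
  by case: (_ && _); case: (_ && _); rewrite ?t1 ?t0.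
by rewrite mulmxDr -scalemxAr -!colE.
Qed.

Lemma inV_two k i j t : c i = k -> c j = k -> i != j ->
  inV c k (delta_mx i 0 + t *: delta_mx j 0 : 'cV[C]_N).
Proof.
move=> ci cj' ij; split.
  apply: suppD; first by rewrite -ci; exact: supp_delta.
  by apply: suppZ; rewrite -cj'; exact: supp_delta.
apply/eqP => /matrixP/(_ i 0)/eqP; rewrite !mxE !eqxx (negPf ij) mulr0 addr0.
by rewrite oner_eq0.
Qed.

Lemma orth_two k i j s t : c i = k -> c j = k -> i != j -> 1 + s^* * t = 0 ->
  dot (col i M + tau k s *: col j M) (col i M + tau k t *: col j M) = 0.
Proof.
move=> ci cj' ij st; rewrite -!mul_map_two; apply/orth; try exact: inV_two.
by rewrite !dotDl !dotDr !dotZl !dotZr !dot_deltas !eqxx (eq_sym j) (negPf ij);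
  rewrite !mulr0 !mulr1 addr0 add0r.
Qed.

Lemma col_orth i j : c i = c j -> i != j -> dot (col i M) (col j M) = 0.
Proof.
move=> ij nij; have := orth (inV_delta R (erefl (c i))) (inV_delta R (esym ij)).
rewrite !(map_tau_delta Htau) -!colE dot_deltas (negPf nij) => -[+ _].
exact.
Qed.

(** Comes from the orthogonality of [e_i + e_j] and [e_i - e_j]. *)
Lemma col_dot_eq i j : c i = c j -> dot (col i M) (col i M) = dot (col j M) (col j M).
Proof.
move=> ij; have [->//|nij] := eqVneq i j.
have st : 1 + 1^* * -1 = 0 :> C by rewrite conjC1 mul1r subrr.
have := orth_two (erefl (c i)) (esym ij) nij st.
have [_ _ t1] := Htau (c i); rewrite (tauN Htau) t1.
rewrite !dotDl !dotDr !dotZl !dotZr conjC1 (col_orth ij nij) (dotC (col i M) (col j M)) (col_orth ij nij).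
by rewrite conjC0 !mulr0 add0r addr0 mulN1r mul1r => /eqP; rewrite subr_eq0 => /eqP.
Qed.

Hypothesis M0 : forall i, col i M != 0.

(** Comes from the orthogonality of [e_i - z^-1 e_j] and [e_i + z^* e_j]. As the two columns have
    equal norm, it says that the conjugate of [tau z^-1] is inverse to the value of [tau] at the
    conjugate of [z]. *)
Lemma tau_conj i z : tau (c i) z^* = (tau (c i) z)^*.
Proof.
have [j nji ji] := c2 i; have nij : i != j by rewrite eq_sym.
have [tD tM t1] := Htau (c i).
have [->|z0] := eqVneq z 0; first by rewrite conjC0 (tau0 Htau) conjC0.
have st : 1 + (- z^-1)^* * z^* = 0 by rewrite rmorphN mulNr -rmorphM /= mulVf // conjC1 subrr.
have := orth_two (erefl (c i)) ji nij st.
rewrite (tauN Htau) !dotDl !dotDr !dotZl !dotZr (col_orth (esym ji) nij).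
rewrite (dotC (col i M) (col j M)) (col_orth (esym ji) nij) -(col_dot_eq (esym ji)).
rewrite conjC0 !mulr0 add0r addr0 mulrA -{1}[dot _ _]mul1r -mulrDl => /eqP.
rewrite mulf_eq0 dot_self_eq0 (negPf (M0 i)) orbF rmorphN mulNr subr_eq0 => /eqP h.
have tz : tau (c i) z * tau (c i) z^-1 = 1 by rewrite -tM mulfV.
have tzn : (tau (c i) z^-1)^* != 0.
  rewrite conjC_eq0; apply/eqP => e; move/eqP: tz.
  by rewrite e mulr0 eq_sym oner_eq0.
by apply: (mulfI tzn); rewrite -h mulrC -rmorphM /= tz conjC1.
Qed.

Lemma tau_id_or_conj i : (forall z, tau (c i) z = z) \/ (forall z, tau (c i) z = z^*).
Proof.
have [tD tM t1] := Htau (c i); apply: complex_ring_endo => // z.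
exact: tau_conj.
Qed.

Definition nmx : 'M[C]_(r, N) := \matrix_(i, j) (((vnorm (col j M))^-1)%:C%C * M i j).

Lemma col_nmx j : col j nmx = ((vnorm (col j M))^-1)%:C%C *: col j M.
Proof. by apply/matrixP => i l; rewrite !mxE. Qed.

Lemma nmx_par k a : inV c k a -> par (M *m map_mx (tau k) a) (nmx *m map_mx (tau k) a).
Proof.
move=> [sa a0]; have [i ai] := vec_neq0 a0.
have ci : c i = k by apply/eqP/negPn/negP => /sa h; rewrite h eqxx in ai.
have n0 : vnorm (col i M) != 0 by rewrite vnorm_eq0.
exists (vnorm (col i M))%:C%C; first by rewrite fmorph_eq0.
apply/matrixP => p q; rewrite ord1 !mxE mulr_sumr; apply: eq_bigr => j _.
rewrite !mxE; have [cj'|cj'] := eqVneq (c j) k; last by rewrite sa // (tau0 Htau) !mulr0.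
have -> : vnorm (col j M) = vnorm (col i M).
  apply: vnorm_sqr_eq; apply: complexI; rewrite -!dot_self; apply: col_dot_eq.
  by rewrite cj' ci.
by rewrite !mulrA -rmorphM /= mulfV // mul1r.
Qed.

Hypothesis cross : forall i j, c i != c j -> dot (col i M) (col j M) = 0.

Lemma nmx_isometry : (cj nmx)^T *m nmx = 1%:M.
Proof.
apply/matrixP => i j; rewrite dotE !col_nmx dotZl dotZr [RHS]mxE.
have [->|ij] := eqVneq i j.
  have n0 : vnorm (col j M) != 0 by rewrite vnorm_eq0.
  have -> : (((vnorm (col j M))^-1)%:C%C)^* = ((vnorm (col j M))^-1)%:C%C by exact: conjc_real.
  by rewrite dot_self -!rmorphM /= expr2 (mulKf n0) mulVf // eqxx.
have [cij|cij] := eqVneq (c i) (c j); first by rewrite col_orth // !mulr0.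
by rewrite cross // !mulr0.
Qed.

Lemma nmx_coisometry : (exists M', M *m M' = 1%:M) -> nmx *m (cj nmx)^T = 1%:M.
Proof.
move=> [M' hM].
have [M2 hM2] : exists M2, nmx *m M2 = 1%:M.
  exists (\matrix_(i, j) ((vnorm (col i M))%:C%C * M' i j)); rewrite -hM.
  apply/matrixP => i j; rewrite !mxE; apply: eq_bigr => l _; rewrite !mxE.
  have n0 : vnorm (col l M) != 0 by rewrite vnorm_eq0.
  by rewrite mulrACA -rmorphM /= mulVf // mul1r.
by rewrite -[LHS]mulmx1 -{1}hM2 mulmxA -(mulmxA nmx) nmx_isometry mulmx1.
Qed.

End Semiunitary.

Definition tw (b : bool) m n (M : 'M[C]_(m, n)) : 'M[C]_(m, n) := if b then cj M else M.

Lemma structure (N r : nat) (K L : finType) (c : 'I_N -> K) (d : 'I_r -> L) Phi Psi :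
  BJpair c d Phi Psi -> (forall i, exists2 j, j != i & c j = c i) ->
  exists (sw cf : K -> bool) (U W : 'M[C]_(r, N)) (ell : 'I_N -> L),
  [/\ [/\ (cj U)^T *m U = 1%:M, U *m (cj U)^T = 1%:M, (cj W)^T *m W = 1%:M
      & W *m (cj W)^T = 1%:M],
    [/\ forall i, supp d (ell i) (col i U), forall i, supp d (ell i) (col i W) &
      forall i j, ell i = ell j <-> c i = c j] &
    forall k a b, inV c k a -> inV c k b ->
      scor c d Phi (sw k) a b (U *m tw (cf k) a) (W *m tw (cf k) b)].
Proof.
move=> HP c2; have [sw [tau [A [B [Htau HAB]]]]] := global_semilinear HP c2.
have [ell [sA sB hell]] := col_class HP Htau HAB.
have orthAB k a b : inV c k a -> inV c k b ->
    (dot a b = 0 <-> dot (A *m map_mx (tau k) a) (A *m map_mx (tau k) b) = 0) /\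
    (dot a b = 0 <-> dot (B *m map_mx (tau k) a) (B *m map_mx (tau k) b) = 0).
  move=> Va Vb.
  (* [cor_orth] controls only a product of two inner products. Keeping the vector [a] in the other
     variable makes the second factor nonzero on both sides. *)
  have cancel (x z p q : C) : z != 0 -> p != 0 -> (x * z = 0 <-> q * p = 0) -> (x = 0 <-> q = 0).
    move=> z0 p0 [h1 h2]; split=> h.
      by have := h1; rewrite h mul0r => /(_ erefl)/eqP; rewrite mulf_eq0 (negPf p0) orbF => /eqP.
    by have := h2; rewrite h mul0r => /(_ erefl)/eqP; rewrite mulf_eq0 (negPf z0) orbF => /eqP.
  have da : dot a a != 0 by rewrite dot_self_eq0; case: Va.
  have ort v1 w1 x1 y1 v2 w2 x2 y2 : cor c d Phi v1 w1 x1 y1 -> cor c d Phi v2 w2 x2 y2 ->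
      dot v1 v2 * dot w1 w2 = 0 <-> dot x1 x2 * dot y1 y2 = 0.
    exact: (cor_orth HP Htau HAB).
  have key b0 : scor c d Phi b0 a a (A *m map_mx (tau k) a) (B *m map_mx (tau k) a) ->
     scor c d Phi b0 a b (A *m map_mx (tau k) a) (B *m map_mx (tau k) b) ->
     scor c d Phi b0 b a (A *m map_mx (tau k) b) (B *m map_mx (tau k) a) ->
    (dot a b = 0 <-> dot (A *m map_mx (tau k) a) (A *m map_mx (tau k) b) = 0) /\
    (dot a b = 0 <-> dot (B *m map_mx (tau k) a) (B *m map_mx (tau k) b) = 0).
    move=> h0 h1 h2; have /adm_neq0[xA xB] := scor_adm h0.
    rewrite -dot_self_eq0 in xA; rewrite -dot_self_eq0 in xB.
    case: b0 h0 h1 h2 => h0 h1 h2; have := ort _ _ _ _ _ _ _ _ h0 h1;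
      have := ort _ _ _ _ _ _ _ _ h0 h2.
      rewrite (mulrC (dot a a)) (mulrC (dot (A *m map_mx (tau k) a) (A *m map_mx (tau k) a))).
      by move=> e1 e2; split; [exact: cancel da xB e1 | exact: cancel da xA e2].
    rewrite (mulrC (dot a a)) (mulrC (dot (A *m map_mx (tau k) a) (A *m map_mx (tau k) a))).
    by move=> e1 e2; split; [exact: cancel da xB e1 | exact: cancel da xA e2].
  by apply: (key (sw k)); apply: HAB.
have oA k a b Va Vb := (orthAB k a b Va Vb).1.
have oB k a b Va Vb := (orthAB k a b Va Vb).2.
have nA i : col i A != 0 by have [_ /adm_neq0[]] := cor_delta Htau HAB i.
have nB i : col i B != 0 by have [_ /adm_neq0[]] := cor_delta Htau HAB i.
have cA i j : c i != c j -> dot (col i A) (col j A) = 0.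
  move=> ij; apply: (dot_supp0 (sA i) (sA j)); apply: contra ij => /eqP e.
  by apply/eqP/hell.
have cB i j : c i != c j -> dot (col i B) (col j B) = 0.
  move=> ij; apply: (dot_supp0 (sB i) (sB j)); apply: contra ij => /eqP e.
  by apply/eqP/hell.
pose cf k := ~~ `[< forall z, tau k z = z >].
exists sw, cf, (nmx A), (nmx B), ell; split.
- split; first exact: (nmx_isometry Htau oA nA cA).
  + exact: (nmx_coisometry Htau oA nA cA (right_inverseA HP HAB)).
  + exact: (nmx_isometry Htau oB nB cB).
  exact: (nmx_coisometry Htau oB nB cB (right_inverseB HP HAB)).
- by split=> // i; rewrite col_nmx; apply: suppZ.
move=> k a b Va Vb.
have ptw (v : 'cV[C]_N) : inV c k v -> map_mx (tau k) v = tw (cf k) v.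
  move=> [sv v0]; have [i vi] := vec_neq0 v0.
  have ci : c i = k by apply/eqP/negPn/negP => /sv h; rewrite h eqxx in vi.
  rewrite /tw /cf; case: asboolP => h /=; first by apply/matrixP => p q; rewrite mxE h.
  have [h'|h'] := tau_id_or_conj c2 Htau oA nA i; first by case: h; rewrite -ci.
  by apply/matrixP => p q; rewrite !mxE -ci h'.
have := HAB k a b Va Vb; rewrite -!ptw // /scor.
have pA := nmx_par Htau oA nA Va; have pB := nmx_par Htau oB nB Vb.
by case: ifP => _ h; apply: (cor_change h (par_refl _) (par_refl _) pA pB).
Qed.

End Unitary.

(** * The isometry built from the unitaries *)

Section Represent.
Variable R : realType.
Local Notation C := R[i].
Local Notation cj := (map_mx (@Num.conj C)).

(** A bilinear form is determined up to a scalar by its zeros on pairs of vectors. Vectors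
    [e_p - t e_i] tuned to be zeros of [S] settle the row and the column of a nonzero entry [S i j];
    any other entry is reached by correcting both vectors. *)
Lemma zeros_proportional N (K : finType) (c : 'I_N -> K) (k : K) (G S : 'M[C]_N) :
  (forall a b, inV c k a -> inV c k b -> (bf G a b = 0 <-> bf S a b = 0)) ->
  exists2 g, g != 0 & forall i j, c i = k -> c j = k -> G i j = g * S i j.
Proof.
move=> H.
have H1 i j : c i = k -> c j = k -> (G i j = 0 <-> S i j = 0).
  by move=> ci cj'; rewrite -!bf_delta; apply: H; exact: inV_delta.
have [[i [j [ci cj' Sij]]]|nS] :=
    pselect (exists i j, [/\ c i = k, c j = k & S i j != 0]); last first.
  exists 1; [exact: oner_neq0 | move=> i j ci cj'; rewrite mul1r].
  have s0 : S i j = 0 by apply/eqP/negPn/negP => h; apply: nS; exists i, j.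
  by rewrite s0; apply/H1.
have Gij : G i j != 0 by apply: contra Sij => /eqP/(H1 _ _ ci cj') ->.
pose g := G i j / S i j.
exists g; first by rewrite mulf_neq0 ?invr_eq0.
have Sn : S i j != 0 by [].
have two p q (t : C) : c p = k -> c q = k -> p != q ->
    inV c k (delta_mx p 0 - t *: delta_mx q 0 : 'cV[C]_N).
  by move=> cp cq pq; rewrite -scaleNr; exact: inV_two.
have Hr p : c p = k -> G p j = g * S p j.
  move=> cp; have [->|pi] := eqVneq p i; first by rewrite /g divfK.
  have /H/(_ (inV_delta R cj')) := two p i (S p j / S i j) cp ci pi.
  rewrite !bf_affl !bf_delta divfK // subrr => -[_ /(_ erefl)/eqP].
  by rewrite subr_eq0 => /eqP ->; rewrite /g; field.
have Hc q : c q = k -> G i q = g * S i q.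
  move=> cq; have [->|qj] := eqVneq q j; first by rewrite /g divfK.
  have := H _ _ (inV_delta R ci) (two q j (S i q / S i j) cq cj' qj).
  rewrite !bf_affr !bf_delta divfK // subrr => -[_ /(_ erefl)/eqP].
  by rewrite subr_eq0 => /eqP ->; rewrite /g; field.
move=> p q cp cq.
have [->|pi] := eqVneq p i; first exact: Hc.
have [->|qj] := eqVneq q j; first exact: Hr.
(* Choose [a] so that the [j]-th coefficient of [(e_p + a e_i)^T S] is [1]. *)
pose a := (1 - S p j) / S i j; pose b := - (S p q + a * S i q).
have e1 : S p j + a * S i j = 1 by rewrite /a divfK // addrC subrK.
have E (M : 'M[C]_N) : bf M (delta_mx p 0 - (- a) *: delta_mx i 0) (delta_mx q 0 - (- b) *: delta_mx j 0) =
    M p q + a * M i q + b * (M p j + a * M i j).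
  by rewrite bf_affl !bf_affr !bf_delta; ring.
have := H _ _ (two p i (- a) cp ci pi) (two q j (- b) cq cj' qj).
have e2 : S p q + a * S i q + b = 0 by rewrite /b subrr.
rewrite !E e1 mulr1 e2 (Hc _ cq) (Hr _ cp) (Hr _ ci).
move=> [_ /(_ erefl)] h.
have : G p q = - (a * (g * S i q) + b * (g * (S p j + a * S i j))).
  apply/eqP; rewrite -subr_eq0 opprK; apply/eqP; by rewrite -[RHS]h; ring.
by rewrite e1 => ->; rewrite /b; ring.
Qed.

Section Sharp.
Variables (N r : nat) (K L : finType) (c : 'I_N -> K) (d : 'I_r -> L).
Variables (sw cf : K -> bool) (U W : 'M[C]_(r, N)) (ell : 'I_N -> L).

Definition twc (b : bool) (z : C) : C := if b then z^* else z.

Lemma twcK b : involutive (twc b).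
Proof. by case: b => z //=; rewrite conjCK. Qed.

Lemma twcD b x y : twc b (x + y) = twc b x + twc b y.
Proof. by case: b; rewrite // /twc rmorphD. Qed.

Lemma twcM b x y : twc b (x * y) = twc b x * twc b y.
Proof. by case: b; rewrite // /twc rmorphM. Qed.

Lemma twc0 b : twc b 0 = 0.
Proof. by case: b; rewrite /twc ?conjC0. Qed.

Lemma twc_eq0 b x : (twc b x == 0) = (x == 0).
Proof. by case: b; rewrite /twc ?conjC_eq0. Qed.

Lemma twc_sum b (I : finType) (F : I -> C) : twc b (\sum_i F i) = \sum_i twc b (F i).
Proof. by case: b; rewrite /twc ?rmorph_sum. Qed.

Lemma normc_twc b x : normc (twc b x) = normc x.
Proof. by case: b; rewrite /twc ?normc_conj. Qed.

Lemma twE b m n (M : 'M[C]_(m, n)) i j : tw b M i j = twc b (M i j).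
Proof. by case: b; rewrite /tw /twc ?mxE. Qed.

Lemma twK b m n (M : 'M[C]_(m, n)) : tw b (tw b M) = M.
Proof. by case: b; rewrite /tw ?map_conjK. Qed.

Lemma vnorm_tw b m (x : 'cV[C]_m) : vnorm (tw b x) = vnorm x.
Proof. by case: b; rewrite /tw ?vnorm_conj. Qed.

Lemma supp_tw b k (x : 'cV[C]_N) : supp c k x -> supp c k (tw b x).
Proof. by move=> sx i ik; rewrite twE sx // twc0. Qed.

Lemma inV_tw b k (x : 'cV[C]_N) : inV c k x -> inV c k (tw b x).
Proof.
move=> [sx x0]; split; first exact: supp_tw.
by rewrite -vnorm_eq0 vnorm_tw vnorm_eq0.
Qed.

(** The part of the isometry that does not come from unitaries; it is an involution of the block
    algebra. *)
Definition sharp (X : 'M[C]_N) : 'M[C]_N :=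
  \matrix_(i, j) (if c i == c j then twc (cf (c i)) (if sw (c i) then X j i else X i j) else 0).

Lemma inA_sharp X : inA c (sharp X).
Proof. by move=> i j ij; rewrite mxE (negPf ij). Qed.

Lemma sharpK X : inA c X -> sharp (sharp X) = X.
Proof.
move=> hX; apply/matrixP => i j; rewrite !mxE; case: (eqVneq (c i) (c j)) => [ij|ij]; last first.
  by rewrite hX.
by rewrite ij; case: (sw _); rewrite twcK.
Qed.

Lemma sharpD X Y : sharp (X + Y) = sharp X + sharp Y.
Proof.
apply/matrixP => i j; rewrite !mxE; case: ifP => _; last by rewrite addr0.
by case: ifP => _; rewrite twcD.
Qed.

(** Multiplication by the central element with scalar [g k] on the block [k]. *)
Definition dg (g : K -> C) (X : 'M[C]_N) : 'M[C]_N := \matrix_(i, j) (g (c i) * X i j).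

Lemma inA_dg g X : inA c X -> inA c (dg g X).
Proof. by move=> hX i j ij; rewrite mxE hX // mulr0. Qed.

Lemma sharp_dg g X : sharp (dg g X) = dg (fun k => twc (cf k) (g k)) (sharp X).
Proof.
apply/matrixP => i j; rewrite !mxE; case: eqVneq => [ij|]; last by rewrite mulr0.
by case: ifP => _; rewrite twcM -?ij.
Qed.

Lemma bf_sharp X k a b : supp c k a -> supp c k b ->
  bf (sharp X) (tw (cf k) a) (tw (cf k) b) =
  twc (cf k) (if sw k then bf X b a else bf X a b).
Proof.
move=> sa sb.
have -> : (if sw k then bf X b a else bf X a b) =
    \sum_i \sum_j (if sw k then X j i else X i j) * (a i 0 * b j 0).
  case: (sw k); rewrite bf_sum; last first.
    by apply: eq_bigr => i _; apply: eq_bigr => j _; rewrite outerE.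
  rewrite exchange_big; apply: eq_bigr => i _; apply: eq_bigr => j _.
  by rewrite outerE (mulrC (b j 0)).
rewrite bf_sum twc_sum; apply: eq_bigr => i _; rewrite twc_sum; apply: eq_bigr => j _.
rewrite outerE !twE !twcM mxE.
have [ci|ci] := eqVneq (c i) k; last by rewrite sa // !twc0 !(mul0r, mulr0).
have [cj'|cj'] := eqVneq (c j) k; last by rewrite sb // !twc0 !mulr0.
by rewrite ci cj' eqxx.
Qed.

Lemma mxnorm_sharp_le X : inA c X -> mxnorm (sharp X) <= mxnorm X.
Proof.
move=> hX; apply: mxnorm_le_bil_class => //; first exact: inA_sharp.
move=> k v w sv sv'.
rewrite -(twK (cf k) v) -(twK (cf k) w) bf_sharp ?normc_twc ?vnorm_tw //; try exact: supp_tw.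
rewrite -(vnorm_tw (cf k) v) -(vnorm_tw (cf k) w).
case: ifP => _; last exact: mxnorm_bil.
by rewrite mulrAC; exact: mxnorm_bil.
Qed.

Lemma mxnorm_sharp X : inA c X -> mxnorm (sharp X) = mxnorm X.
Proof.
move=> hX; apply: (eq_of_le (mxnorm_sharp_le hX)).
by rewrite -{1}(sharpK hX); apply: mxnorm_sharp_le; exact: inA_sharp.
Qed.

Hypothesis UU1 : (cj U)^T *m U = 1%:M.
Hypothesis UU2 : U *m (cj U)^T = 1%:M.
Hypothesis WW1 : (cj W)^T *m W = 1%:M.
Hypothesis WW2 : W *m (cj W)^T = 1%:M.
Hypothesis sU : forall i, supp d (ell i) (col i U).
Hypothesis sW : forall i, supp d (ell i) (col i W).
Hypothesis hell : forall i j, ell i = ell j <-> c i = c j.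

(** The conjugate of [U] stands on the left because [bf] transposes its first vector: [bf (Psi0 X)]
    at [U a], [W b] is [bf (sharp X)] at [a], [b]. *)
Definition Psi0 (X : 'M[C]_N) : 'M[C]_r := cj U *m sharp X *m (cj W)^T.

Lemma conj_eq m n (M M' : 'M[C]_(m, n)) : M = M' -> cj M = cj M'.
Proof. by move->. Qed.

Lemma cU1 : U^T *m cj U = 1%:M.
Proof. by have := conj_eq UU1; rewrite map_mxM -map_trmx map_conjK map_mx1. Qed.

Lemma cU2 : cj U *m U^T = 1%:M.
Proof. by have := conj_eq UU2; rewrite map_mxM -map_trmx map_conjK map_mx1. Qed.

Lemma mx_supp (M : 'M[C]_(r, N)) p i : (forall i, supp d (ell i) (col i M)) ->
  d p != ell i -> M p i = 0.
Proof. by move=> sM pi; have := sM i p pi; rewrite mxE. Qed.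

Lemma inA_conjugate (S : 'M[C]_N) (A B : 'M[C]_(r, N)) :
  (forall i, supp d (ell i) (col i A)) -> (forall i, supp d (ell i) (col i B)) ->
  inA c S -> inA d (A *m S *m B^T).
Proof.
move=> sA sB hS p q pq; rewrite mxE big1 // => j _; rewrite mxE mulr_suml big1 // => i _.
have [pi|pi] := eqVneq (d p) (ell i); last by rewrite (mx_supp sA) // !mul0r.
have [qj|qj] := eqVneq (d q) (ell j); last by rewrite [X in _ * X]mxE (mx_supp sB) // mulr0.
rewrite hS ?mulr0 ?mul0r //; apply: contra pq => /eqP/hell e.
by rewrite pi qj e.
Qed.

Lemma supp_col_conj (M : 'M[C]_(r, N)) :
  (forall i, supp d (ell i) (col i M)) -> forall i, supp d (ell i) (col i (cj M)).
Proof. by move=> sM i p pi; rewrite !mxE (mx_supp sM) // conjC0. Qed.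

Lemma inA_Psi0 X : inA d (Psi0 X).
Proof. by apply: inA_conjugate; [exact: supp_col_conj.. | exact: inA_sharp]. Qed.

Lemma inA_pull (Z : 'M[C]_r) (A B : 'M[C]_(r, N)) :
  (forall i, supp d (ell i) (col i A)) -> (forall i, supp d (ell i) (col i B)) ->
  inA d Z -> inA c (A^T *m Z *m B).
Proof.
move=> sA sB hZ i j ij; rewrite mxE big1 // => q _; rewrite mxE mulr_suml big1 // => p _.
have [pi|pi] := eqVneq (d p) (ell i); last by rewrite mxE (mx_supp sA) // !mul0r.
have [qj|qj] := eqVneq (d q) (ell j); last by rewrite [X in _ * X](mx_supp sB) // mulr0.
rewrite hZ ?mulr0 ?mul0r //; rewrite pi qj; apply: contra ij => /eqP/hell e.
by rewrite e.
Qed.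

Lemma Psi0_surj Z : inA d Z -> exists2 X, inA c X & Psi0 X = Z.
Proof.
move=> hZ; have hS := inA_pull sU sW hZ.
exists (sharp (U^T *m Z *m W)); first exact: inA_sharp.
rewrite /Psi0 sharpK // !mulmxA cU2 mul1mx -mulmxA WW2 mulmx1 //.
Qed.

Lemma vnorm_isometry m n (A : 'M[C]_(m, n)) (x : 'cV[C]_n) :
  (cj A)^T *m A = 1%:M -> vnorm (A *m x) = vnorm x.
Proof.
move=> hA; apply: vnorm_sqr_eq; apply: complexI; rewrite -!vnorm_dot map_mxM trmx_mul.
by rewrite mulmxA -(mulmxA _ _ A) hA mulmx1.
Qed.

Lemma mxnorm_conjugate_le m n (A : 'M[C]_(m, n)) (S : 'M[C]_n) (B : 'M[C]_(n, m)) :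
  (cj A)^T *m A = 1%:M -> (cj B)^T *m B = 1%:M -> mxnorm (A *m S *m B) <= mxnorm S.
Proof.
move=> hA hB; apply: mxnorm_le => // x; rewrite -!mulmxA vnorm_isometry //.
by rewrite -[X in _ * X](vnorm_isometry x hB) vnorm_mulmx.
Qed.

Lemma mxnorm_Psi0 X : inA c X -> mxnorm (Psi0 X) = mxnorm X.
Proof.
move=> hX; rewrite -[RHS]mxnorm_sharp //; apply/eqP; rewrite eq_le; apply/andP; split.
  by apply: mxnorm_conjugate_le; rewrite ?map_conjK ?cU1 // -map_trmx !map_conjK trmxK.
have -> : sharp X = U^T *m Psi0 X *m W.
  by rewrite /Psi0 !mulmxA cU1 mul1mx -mulmxA WW1 mulmx1.
by apply: mxnorm_conjugate_le => //; rewrite -map_trmx trmxK cU2.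
Qed.

Lemma Psi0D X Y : Psi0 (X + Y) = Psi0 X + Psi0 Y.
Proof. by rewrite /Psi0 sharpD mulmxDr mulmxDl. Qed.

Lemma Psi0Z (t : C) X : t *: Psi0 X = Psi0 (dg (fun k => twc (cf k) t) X).
Proof.
have e : sharp (dg (fun k => twc (cf k) t) X) = t *: sharp X.
  by rewrite sharp_dg; apply/matrixP => i j; rewrite [LHS]mxE [RHS]mxE twcK.
by rewrite /Psi0 e -scalemxAr -scalemxAl.
Qed.

Variables (Phi : 'M[C]_N -> 'M[C]_r).
Hypothesis Phi_in : forall X, inA c X -> inA d (Phi X).
Hypothesis HUW : forall k a b, inV c k a -> inV c k b ->
      scor c d Phi (sw k) a b (U *m tw (cf k) a) (W *m tw (cf k) b).

Lemma Phi_Psi0 X : inA c X -> exists2 g : K -> C,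
  (forall k, g k != 0) & Phi X = Psi0 (dg g X).
Proof.
move=> hX; pose G := U^T *m Phi X *m W.
have hG : inA c G by apply: inA_pull => //; exact: Phi_in.
have /choice[g Hg] : forall k, exists g, g != 0 /\
    forall i j, c i = k -> c j = k -> G i j = g * sharp X i j.
  move=> k; have [|g g0 Hg] := @zeros_proportional N K c k G (sharp X); last by exists g.
  move=> a b Va Vb; rewrite -(twK (cf k) a) -(twK (cf k) b).
  have Va' := inV_tw (cf k) Va; have Vb' := inV_tw (cf k) Vb.
  rewrite bf_sharp; [|by case: Va'|by case: Vb'].
  rewrite bf_pull -(twK (cf k) a) -(twK (cf k) b) !twK.
  have := HUW Va' Vb'; rewrite !twK /scor.
  have tw0 z : twc (cf k) z = 0 <-> z = 0.
    by split=> [/eqP|->]; rewrite ?twc0 // twc_eq0 => /eqP.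
  by case: (sw k) => -[_ _ h]; rewrite tw0; apply: iff_sym; exact: h.
exists (fun k => twc (cf k) (g k)) => [k|]; first by rewrite twc_eq0; have [] := Hg k.
rewrite /Psi0 sharp_dg.
have -> : dg (fun k => twc (cf k) (twc (cf k) (g k))) (sharp X) = G.
  apply/matrixP => i j; rewrite mxE twcK; have [ij|ij] := eqVneq (c i) (c j).
    by have [_ ->] := Hg (c i).
  by rewrite hG // inA_sharp // mulr0.
by rewrite /G !mulmxA cU2 mul1mx -mulmxA WW2 mulmx1.
Qed.

End Sharp.
End Represent.

(** * Scalars on the blocks *)

Section ClassNorms.
Variables (R : realType) (N : nat) (K : finType) (c : 'I_N -> K).
Local Notation C := R[i].
Local Notation cj := (map_mx (@Num.conj C)).
Implicit Types (X Y M Z : 'M[C]_N) (k l : K).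

Definition cl k X : 'M[C]_N := \matrix_(i, j) (if (c i == k) && (c j == k) then X i j else 0).

Lemma inA_cl k X : inA c (cl k X).
Proof.
move=> i j ij; rewrite mxE; case: eqVneq => //= ik; case: eqVneq => // jk.
by rewrite ik jk eqxx in ij.
Qed.

Lemma clD k X Y : cl k (X + Y) = cl k X + cl k Y.
Proof. by apply/matrixP => i j; rewrite !mxE; case: ifP; rewrite ?addr0. Qed.

Lemma clZ k a X : cl k (a *: X) = a *: cl k X.
Proof. by apply/matrixP => i j; rewrite !mxE; case: ifP; rewrite ?mulr0. Qed.

Lemma cl_dg k (g : K -> C) X : cl k (dg c g X) = g k *: cl k X.
Proof.
apply/matrixP => i j; rewrite !mxE; case: (eqVneq (c i) k) => [->|] /=; last by rewrite mulr0.
by case: ifP; rewrite ?mulr0.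
Qed.

Lemma cl_cl k l X : cl k (cl l X) = if k == l then cl k X else 0.
Proof.
apply/matrixP => i j; case: (eqVneq k l) => [->|kl]; rewrite !mxE; first by case: ifP => // ->.
case: (eqVneq (c i) k) => //= ik; rewrite ik (negPf kl) /=.
by case: ifP.
Qed.

Lemma cl_mul k X (x : 'cV[C]_N) : supp c k x -> inA c X -> cl k X *m x = X *m x.
Proof.
move=> sx hX; apply/matrixP => i j; rewrite ord1 !mxE; apply: eq_bigr => l _; rewrite mxE.
have [lk|lk] := eqVneq (c l) k; last by rewrite sx // !mulr0.
by rewrite andbT; case: eqVneq => // ik; rewrite hX ?mul0r // lk.
Qed.

Lemma cl_mul0 k l X (x : 'cV[C]_N) : supp c l x -> l != k -> cl k X *m x = 0.
Proof.
move=> sx lk; apply/matrixP => i j; rewrite ord1 !mxE big1 // => m _; rewrite mxE.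
have [ml|ml] := eqVneq (c m) l; last by rewrite sx // mulr0.
by rewrite ml (negPf lk) andbF mul0r.
Qed.

Lemma mxnorm_cl_le k X : inA c X -> mxnorm (cl k X) <= mxnorm X.
Proof.
move=> hX; apply: (mxnorm_le_class (inA_cl k X)) => // l x sx.
have [lk|lk] := eqVneq l k; last by rewrite (cl_mul0 _ sx lk) vnorm0 mulr_ge0.
by rewrite cl_mul -?lk // vnorm_mulmx.
Qed.

Lemma mxnorm_le_cl X (t : R) : inA c X -> 0 <= t -> (forall k, mxnorm (cl k X) <= t) ->
  mxnorm X <= t.
Proof.
move=> hX t0 H; apply: (mxnorm_le_class hX) => // k x sx; rewrite -(cl_mul sx hX).
by apply: le_trans (vnorm_mulmx _ _) _; rewrite ler_wpM2r.
Qed.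

Lemma mxnorm_lt_cl X (t : R) : inA c X -> 0 < t -> (forall k, mxnorm (cl k X) < t) ->
  mxnorm X < t.
Proof.
move=> hX t0 H; have [->|X0] := eqVneq X 0; first by rewrite mxnorm0.
have [k [x [sx x0 ex]]] := mxnorm_attained_class hX X0.
have nx : 0 < vnorm x by rewrite vnorm_gt0.
rewrite -(ltr_pM2r nx) -ex -(cl_mul sx hX); apply: le_lt_trans (vnorm_mulmx _ _) _.
by rewrite ltr_pM2r.
Qed.

Lemma common_eps (P : K -> R -> Prop) :
  (forall k, exists2 e0, 0 < e0 & forall e, 0 < e -> e <= e0 -> P k e) ->
  exists2 e, 0 < e & forall k, P k e.
Proof.
move=> H; have /choice[f Hf] : forall k, exists e0, 0 < e0 /\ forall e, 0 < e -> e <= e0 -> P k e.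
  by move=> k; have [e0 h1 h2] := H k; exists e0.
have f0 k : 0 < f k by have [] := Hf k.
have S0 : 0 <= \sum_k (f k)^-1 by apply: sumr_ge0 => k _; rewrite invr_ge0 ltW.
have e0 : 0 < (1 + \sum_k (f k)^-1)^-1 by rewrite invr_gt0 ltr_wpDr.
(* An explicit positive number below every [f k], also when [K] is empty. *)
exists (1 + \sum_k (f k)^-1)^-1 => // k; have [_] := Hf k; apply=> //.
rewrite -[f k]invrK lef_pV2 ?posrE ?invr_gt0 //; last by rewrite ltr_wpDr.
rewrite (bigD1 k) //= addrCA lerDl addr_ge0 // sumr_ge0 // => l _.
by rewrite invr_ge0 ltW.
Qed.

Lemma mxnorm_sub_small M Z (m : R) : mxnorm M < m ->
  exists2 e0 : R, 0 < e0 & forall e : R, 0 < e -> e <= e0 -> mxnorm (M - e%:C%C *: Z) < m.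
Proof.
have Z1 : 0 < mxnorm Z + 1 by exact: (ltr_wpDl (mxnorm_ge0 Z) ltr01).
move=> Mm; exists ((m - mxnorm M) / (mxnorm Z + 1)).
  by rewrite divr_gt0 ?subr_gt0.
move=> e e0; rewrite (ler_pdivlMr _ _ Z1) => he.
apply: le_lt_trans (mxnormD _ _) _; rewrite -scaleNr mxnormZ normcN (normc_real (ltW e0)).
by rewrite -ltrBrDl; apply: lt_le_trans he; rewrite (ltr_pM2l e0) ltrDl.
Qed.

Lemma delta_outer (i j : 'I_N) : delta_mx i j = delta_mx i 0 *m (cj (delta_mx j 0 : 'cV[C]_N))^T.
Proof.
apply/matrixP => p q; rewrite [RHS]mxE big_ord1 !mxE !eqxx !andbT.
by case: (p == i); case: (q == j); rewrite /= ?conjC0 ?conjC1 ?mulr0 ?mul0r ?mulr1.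
Qed.

Lemma mxnorm_entry a i j : mxnorm (a *: delta_mx i j : 'M[C]_N) = normc a.
Proof. by rewrite mxnormZ delta_outer mxnorm_rank1 !vnorm_delta !mulr1. Qed.

Lemma entry_decrease (a : C) i j Z : a != 0 -> 0 < complex.Re (a^* * Z i j) ->
  exists2 e0 : R, 0 < e0 & forall e : R, 0 < e -> e <= e0 ->
    mxnorm (a *: delta_mx i j - e%:C%C *: Z) < normc a.
Proof.
move=> a0 Ha; have n0 : 0 < normc a by rewrite lt_def normc_eq0 a0 normc_ge0.
pose t := ((normc a)^-1)%:C%C : C.
pose u : 'cV[C]_N := (t * a) *: delta_mx i 0; pose v : 'cV[C]_N := delta_mx j 0.
have tr : t^* = t by exact: conjc_real.
have nu : vnorm u = 1.
  rewrite vnormZ vnorm_delta mulr1 normcM normc_real ?invr_ge0 ?ltW //.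
  by rewrite mulVf ?gt_eqF.
have nv : vnorm v = 1 by rewrite vnorm_delta.
have eu : (cj u)^T *m (t *: Z) *m v = (t * t * a^*) *: ((delta_mx i 0)^T *m Z *m delta_mx j 0).
  rewrite /u adjZ -!(scalemxAl, scalemxAr) scalerA rmorphM /= tr.
  have -> : cj (delta_mx i 0 : 'cV[C]_N) = delta_mx i 0.
    by apply/matrixP => p q; rewrite !mxE; case: (_ && _); rewrite ?conjC0 ?conjC1.
  by congr (_ *: _); ring.
have : 0 < complex.Re (((cj u)^T *m (t *: Z) *m v) 0 0).
  rewrite eu mxE -/(bf Z _ _) bf_delta -mulrA.
  have -> : t * t = ((normc a)^-1 ^+ 2)%:C%C by rewrite /t -rmorphM expr2.
  case: (a^* * Z i j) Ha => x y /= x0.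
  by rewrite mul0r subr0 mulr_gt0 // exprn_gt0 // invr_gt0.
case/(rank1_decrease nu nv) => e0 e00 H; exists e0 => // e e1 e2.
have [s /andP[s0 s1] Hs] := H e e1 e2.
have -> : a *: delta_mx i j - e%:C%C *: Z =
    (normc a)%:C%C *: (u *m (cj v)^T - e%:C%C *: (t *: Z)).
  have nt : (normc a)%:C%C * t = 1 by rewrite /t -rmorphM /= mulfV ?gt_eqF.
  rewrite scalerBr !scalerA /u -scalemxAl scalerA mulrA nt mul1r -delta_outer.
  by rewrite mulrCA nt mulr1.
rewrite mxnormZ normc_real ?normc_ge0 // -[ltRHS]mulr1 ltr_pM2l //.
by apply: le_lt_trans s1; apply: mxnorm_le.
Qed.

End ClassNorms.

(** * Directions in the complex plane *)

Section Positive.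
Variable R : realType.
Local Notation C := R[i].
Implicit Types (u v w z : C).

(** Equality of arguments; scalars are compared up to their moduli. *)
Definition pm u v : Prop := exists2 s : R, 0 < s & u = s%:C%C * v.

Lemma pm_refl u : pm u u.
Proof. by exists 1; rewrite ?ltr01 // mul1r. Qed.

Lemma pm_sym u v : pm u v -> pm v u.
Proof.
case=> s s0 ->; exists s^-1; rewrite ?invr_gt0 // mulrA -rmorphM /= mulVf ?gt_eqF //.
by rewrite mul1r.
Qed.

Lemma pm_trans v u w : pm u v -> pm v w -> pm u w.
Proof.
by case=> s s0 -> [t t0 ->]; exists (s * t); rewrite ?mulr_gt0 // rmorphM mulrA.
Qed.

Lemma pmM u v u' v' : pm u v -> pm u' v' -> pm (u * u') (v * v').
Proof.
by case=> s s0 -> [t t0 ->]; exists (s * t); rewrite ?mulr_gt0 // rmorphM /= mulrACA.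
Qed.

Lemma pmN u v : pm u v -> pm (- u) (- v).
Proof. by case=> s s0 ->; exists s; rewrite ?mulrN. Qed.

Lemma pmJ u v : pm u v -> pm u^* v^*.
Proof.
case=> s s0 ->; exists s => //; rewrite rmorphM /=; congr (_ * _); exact: conjc_real.
Qed.

Lemma pm_mulr_cancel w u v : w != 0 -> pm (u * w) (v * w) -> pm u v.
Proof. by move=> w0 [s s0 e]; exists s => //; apply: (mulIf w0); rewrite e mulrA. Qed.

Lemma pm_conj_mul z : z != 0 -> pm (z^* * z) 1.
Proof.
move=> z0; exists (normc z ^+ 2); first by rewrite exprn_gt0 // lt_def normc_eq0 z0 normc_ge0.
by rewrite mulC_conj mulr1.
Qed.

Lemma pmNself z : z != 0 -> ~ pm z (- z).
Proof.
move=> z0 [s s0 e]; have : 1 + s%:C%C = 0 :> C.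
  by apply: (mulIf z0); rewrite mul0r mulrDl mul1r {1}e mulrN addNr.
rewrite -(rmorph1 (real_complex R)) -rmorphD => /eqP; rewrite fmorph_eq0 => /eqP h.
have : 0 < 1 + s by rewrite ltr_wpDr // ltW.
by rewrite h ltxx.
Qed.

(* If no rotation moves both [u] and [v] to the right half plane, they point in opposite
   directions; the rotation [|v| u^* + |u| v^*] bisects the angle. *)
Lemma antiparallel u v : u != 0 -> v != 0 ->
  (forall lam : C, 0 < complex.Re (lam * u) -> 0 < complex.Re (lam * v) -> False) -> pm v (- u).
Proof.
move=> u0 v0 H.
have nu : 0 < normc u by rewrite lt_def normc_eq0 u0 normc_ge0.
have nv : 0 < normc v by rewrite lt_def normc_eq0 v0 normc_ge0.
set p := complex.Re (u * v^*).
pose lam := (normc v)%:C%C * u^* + (normc u)%:C%C * v^*.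

have Rr (a b : R) (y : C) : complex.Re (a%:C%C * b%:C%C + a%:C%C * y) = a * (b + complex.Re y).
  by case: y => x y /=; ring.
have n2 (z : C) : z^* * z = (normc z)%:C%C * (normc z)%:C%C.
  by rewrite mulC_conj expr2 rmorphM.
have e1 : complex.Re (lam * u) = normc u * (normc u * normc v + p).
  have -> : lam * u = (normc u)%:C%C * (normc u * normc v)%:C%C + (normc u)%:C%C * (u * v^*).
    rewrite /lam mulrDl -mulrA n2 rmorphM /=; ring.
  exact: Rr.
have e2 : complex.Re (lam * v) = normc v * (normc u * normc v + p).
  have pE : p = complex.Re (u^* * v).
    rewrite /p; have -> : u^* * v = (u * v^*)^* by rewrite rmorphM /= conjCK.
    by case: (u * v^*).
  rewrite pE.
  have -> : lam * v = (normc v)%:C%C * (normc u * normc v)%:C%C + (normc v)%:C%C * (u^* * v).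
    rewrite /lam mulrDl -(mulrA (normc u)%:C%C) n2 rmorphM /=; ring.
  exact: Rr.
have hp : p = - (normc u * normc v).
  apply/eqP; rewrite eq_le; apply/andP; split; last first.
    by have := Re_ge_normc (u * v^*); rewrite normcM normc_conj.
  rewrite leNgt; apply/negP => lt; apply: (H lam).
    by rewrite e1 mulr_gt0 //; lra.
  by rewrite e2 mulr_gt0 //; lra.
have uv : u * v^* = - (normc u * normc v)%:C%C.
  have : normc (u * v^*) = normc u * normc v by rewrite normcM normc_conj.
  move: hp; rewrite /p; case: (u * v^*) => a b /= -> nab.
  have : b ^+ 2 = 0.
    have /eqP := congr1 (fun x => x ^+ 2) nab; rewrite sqr_sqrtr ?addr_ge0 ?sqr_ge0 //.
    by rewrite sqrrN -subr_eq0 addrAC subrr add0r => /eqP.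
  by move/eqP; rewrite sqrf_eq0 => /eqP ->; apply/eqP; rewrite eq_complex /= oppr0 !eqxx.
exists (normc v / normc u); first exact: divr_gt0.
have nu' : (normc u)%:C%C != 0 :> C by rewrite fmorph_eq0 gt_eqF.
have nv' : (normc v)%:C%C != 0 :> C by rewrite fmorph_eq0 gt_eqF.
apply: (mulIf (mulf_neq0 nu' nv')).
have -> : v * ((normc u)%:C%C * (normc v)%:C%C) = - (u * (v^* * v)).
  by rewrite (mulrA u) uv rmorphM /= mulNr opprK mulrC.
rewrite n2 rmorphM /= fmorphV; field.
exact: nu'.
Qed.

End Positive.

(** * Test matrices supported in two blocks *)

Section Phases.
Variables (R : realType) (N : nat) (K : finType) (c : 'I_N -> K).
Local Notation C := R[i].
Local Notation cj := (map_mx (@Num.conj C)).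
Implicit Types (X Y M Z : 'M[C]_N) (k l : K) (i j m n : 'I_N).

Definition tst (a b : C) i j m n : 'M[C]_N := a *: delta_mx i j + b *: delta_mx m n.

Lemma cl_entry k (a : C) i j : c i = c j ->
  cl c k (a *: delta_mx i j) = if c i == k then a *: delta_mx i j else 0.
Proof.
move=> ij; apply/matrixP => p q; case: (eqVneq (c i) k) => ik; rewrite !mxE.
  case: (eqVneq p i) => [->|] //=; last by rewrite mulr0; case: ifP.
  case: (eqVneq q j) => [->|] //=; last by rewrite mulr0; case: ifP.
  by rewrite ik -ij ik eqxx.
case: (eqVneq p i) => [->|] //=; last by rewrite mulr0; case: ifP.
by rewrite (negPf ik).
Qed.

Lemma inA_entry a i j : c i = c j -> inA c (a *: delta_mx i j : 'M[C]_N).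
Proof.
move=> ij p q pq; rewrite !mxE; case: eqVneq => [pi|]; last by rewrite mulr0.
case: eqVneq => [qj|]; last by rewrite mulr0.
by rewrite pi qj ij eqxx in pq.
Qed.

Lemma inA_tst a b i j m n : c i = c j -> c m = c n -> inA c (tst a b i j m n).
Proof. by move=> ij mn; apply: inAD; exact: inA_entry. Qed.

Lemma tst_sym a b i j m n : tst a b i j m n = tst b a m n i j.
Proof. by rewrite /tst addrC. Qed.

Lemma dg_tst (g : K -> C) a b i j m n :
  dg c g (tst a b i j m n) = tst (g (c i) * a) (g (c m) * b) i j m n.
Proof.
apply/matrixP => p q; rewrite !mxE mulrDr; congr (_ + _).
  by case: (eqVneq p i) => [->|] /=; rewrite ?mulr0 // mulrA.
by case: (eqVneq p m) => [->|] /=; rewrite ?mulr0 // mulrA.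
Qed.

(** [T] is isometric on the span of [e_j] and [e_n], so every vector [u] there is norming. The
    weights [sqrt y] and [sqrt x] are those that make [X u] orthogonal to [T u]. *)
Lemma tst_BJ (z z' : C) i j m n X (x y : R) : inA c X -> c i = c j -> c m = c n -> c i != c m ->
  normc z = 1 -> normc z' = 1 -> 0 < x -> 0 < y ->
  y%:C%C * (z * X i j) + x%:C%C * (z' * X m n) = 0 -> BJ (tst z^* z'^* i j m n) X.
Proof.
move=> hX ij mn im nz nz' x0 y0 h.
set T := tst _ _ _ _ _ _.
have hT : inA c T by exact: inA_tst.
have nT : mxnorm T <= 1.
  apply: (mxnorm_le_cl hT) => // k; rewrite clD !cl_entry //.
  case: eqVneq => [ik|ik]; case: eqVneq => [mk|mk]; rewrite ?addr0 ?add0r ?mxnorm_entry ?normc_conj.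
  - by rewrite ik mk eqxx in im.
  - by rewrite nz.
  - by rewrite nz'.
  by rewrite mxnorm0.
pose sx : C := (Num.sqrt x)%:C%C; pose sy : C := (Num.sqrt y)%:C%C.
have sxx : sx * sx = x%:C%C by rewrite /sx -rmorphM -expr2 /= sqr_sqrtr // ltW.
have syy : sy * sy = y%:C%C by rewrite /sy -rmorphM -expr2 /= sqr_sqrtr // ltW.
have sxc : sx^* = sx by exact: conjc_real.
have syc : sy^* = sy by exact: conjc_real.
pose u : 'cV[C]_N := sy *: delta_mx j 0 + sx *: delta_mx n 0.
have nin : i != m by apply: contraNneq im => ->.
have njn : j != n by apply: contraNneq im => jn; rewrite ij mn jn.
have dmul p q (l : 'I_N) : (delta_mx p q : 'M[C]_N) *m (delta_mx l 0 : 'cV[C]_N) =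
   if q == l then delta_mx p 0 else 0.
  by case: eqVneq => [->|ql]; [exact: mul_delta_mx | exact: mul_delta_mx_0].
have Tu : T *m u = (sy * z^*) *: delta_mx i 0 + (sx * z'^*) *: delta_mx m 0.
  rewrite /T /tst /u mulmxDl !mulmxDr -!scalemxAl -!scalemxAr !dmul !eqxx (negPf njn).
  by rewrite (eq_sym n) (negPf njn) !scaler0 addr0 add0r !scalerA (mulrC sy) (mulrC sx).
have nrm (s t : C) p q : p != q -> vnorm (s *: delta_mx p 0 + t *: delta_mx q 0 : 'cV[C]_N) ^+ 2 =
    normc s ^+ 2 + normc t ^+ 2.
  move=> pq; rewrite vnormD_sqr !vnormZ !vnorm_delta !mulr1.
  have d0 : dot (s *: delta_mx p 0 : 'cV[C]_N) (t *: delta_mx q 0) = 0.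
    by rewrite dotZl dotZr dot_deltas (negPf pq) !mulr0.
  by move: d0; rewrite /dot => ->; rewrite /= mulr0 addr0.
have nu : vnorm (T *m u) = vnorm u.
  apply: vnorm_sqr_eq; rewrite (congr1 (@vnorm R N) Tu) (nrm _ _ _ _ nin) (nrm _ _ _ _ njn).
  by rewrite !normcM !normc_conj nz nz' !mulr1.
have u0 : u != 0.
  rewrite -vnorm_eq0 -sqrf_eq0 nrm // gt_eqF // ltr_wpDr ?sqr_ge0 // exprn_gt0 //.
  by rewrite normc_real ?sqrtr_ge0 // sqrtr_gt0.
apply: (@BJ_of_orth _ _ _ _ u) => //.
  have nu0 : 0 < vnorm u by rewrite vnorm_gt0.
  apply/eqP; rewrite eq_le vnorm_mulmx nu /=.
  by rewrite -[leRHS]mul1r ler_pM2r.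
apply: (etrans (congr1 (fun v => dot v (X *m u)) Tu)); rewrite dotDl !dotZl /u !mulmxDr -!scalemxAr !dotDr !dotZr.
have dX p q : dot (delta_mx p 0 : 'cV[C]_N) (X *m delta_mx q 0) = X p q.
  have e : cj (delta_mx p 0 : 'cV[C]_N) = delta_mx p 0.
    by apply/matrixP => r s; rewrite !mxE; case: (_ && _); rewrite ?conjC0 ?conjC1.
  by rewrite /dot e mulmxA; exact: bf_delta.
rewrite !dX (hX i n) ?(hX m j); [|by rewrite -ij eq_sym|by rewrite -mn].
rewrite !mulr0 addr0 add0r !rmorphM /= !conjCK sxc syc -[RHS]h -sxx -syy.
by ring.
Qed.

End Phases.

(** * Comparison of the phases of the block scalars *)

Section PhaseMain.
Variables (R : realType) (N : nat) (K : finType) (c : 'I_N -> K).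
Local Notation C := R[i].
Local Notation cj := (map_mx (@Num.conj C)).
Implicit Types (a b z w y lam : C) (X Y M Z T : 'M[C]_N) (k l : K) (i j m n : 'I_N).

(** Orthogonality of [Phi X] and [Phi Y] pulled back through the isometry, which [lam] passes as
    itself or as its conjugate, block by block. *)
Definition BJ2 (cf : K -> bool) (g : 'M[C]_N -> K -> C) X Y : Prop := forall lam : C,
  mxnorm (dg c (g X) X) <=
  mxnorm (dg c (g X) X + dg c (fun k => twc (cf k) lam) (dg c (g Y) Y)).

Lemma twc_real (b : bool) (e : R) (z : C) : twc b (e%:C%C * z) = e%:C%C * twc b z.
Proof. by case: b => //=; rewrite rmorphM /=; congr (_ * _); exact: conjc_real. Qed.

Lemma dg_lamZ (cf : K -> bool) (e : R) (lam : C) Z :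
  dg c (fun k => twc (cf k) (- e%:C%C * lam)) Z =
  - (e%:C%C *: dg c (fun k => twc (cf k) lam) Z).
Proof.
apply/matrixP => i j; rewrite !mxE -rmorphN twc_real rmorphN /=; ring.
Qed.

Variables (cf : K -> bool) (g : 'M[C]_N -> K -> C).
Hypothesis c2 : forall i, exists2 j, j != i & c j = c i.
Hypothesis g0 : forall X k, g X k != 0.
Hypothesis E : forall X Y, inA c X -> inA c Y -> (BJ X Y <-> BJ2 cf g X Y).

(** The rescaled [T] attains its norm on the block of [i], and on that of [m] only if the two
    entries have equal modulus. A [lam] that decreases all attaining blocks at once lowers the norm,
    against orthogonality. *)
Lemma tst_no_decrease a b i j m n X lam : inA c X -> c i = c j -> c m = c n -> c i != c m ->
  a != 0 -> b != 0 -> BJ (tst a b i j m n) X ->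
  let T := tst a b i j m n in
  let A := g T (c i) * a in let B := g T (c m) * b in
  0 < complex.Re (A^* * (twc (cf (c i)) lam * (g X (c i) * X i j))) ->
  normc B < normc A \/ (normc B = normc A /\
    0 < complex.Re (B^* * (twc (cf (c m)) lam * (g X (c m) * X m n)))) -> False.
Proof.
move=> hX ij mn im a0 b0 HBJ T A B HA HB.
have hT : inA c T by exact: inA_tst.
have A0 : A != 0 by rewrite mulf_neq0.
have B0 : B != 0 by rewrite mulf_neq0.
have nA : 0 < normc A by rewrite lt_def normc_eq0 A0 normc_ge0.
pose M := dg c (g T) T; pose Z := dg c (fun k => twc (cf k) lam) (dg c (g X) X).
have eM : M = tst A B i j m n by rewrite /M dg_tst.
have hM : inA c M by exact: inA_dg.
have hZ : inA c Z by exact/inA_dg/inA_dg.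
have clZe p q k : c p = k -> c q = k -> cl c k Z p q = Z p q by move=> pk qk; rewrite mxE pk qk eqxx.
have Ze p q : Z p q = twc (cf (c p)) lam * (g X (c p) * X p q) by rewrite !mxE.
have [e e_gt0 He] : exists2 e : R, 0 < e & forall k, mxnorm (cl c k (M - e%:C%C *: Z)) < normc A.
  apply: common_eps => k.
  have eq e : cl c k (M - e%:C%C *: Z) = cl c k M - e%:C%C *: cl c k Z.
    by rewrite clD -scaleNr clZ scaleNr.
  have [ik|ik] := eqVneq (c i) k.
    have [|e0 e00 H] := @entry_decrease R N A i j (cl c k Z) A0.
      by rewrite clZe -?ij // Ze.
    have eMi : cl c k M = A *: delta_mx i j.
      by rewrite eM clD (cl_entry _ _ ij) (cl_entry _ _ mn) -ik eqxx eq_sym (negPf im) addr0.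
    exists e0; [exact: e00 | move=> e e1 e2; rewrite eq eMi; exact: (H e e1 e2)].
  have small (D : 'M[C]_N) : mxnorm D < normc A -> cl c k M = D ->
     exists2 e0 : R, 0 < e0 & forall e : R, 0 < e -> e <= e0 ->
       mxnorm (cl c k (M - e%:C%C *: Z)) < normc A.
    move=> hD eD; have [e0 e00 H] := mxnorm_sub_small (cl c k Z) hD.
    by exists e0; [exact: e00 | move=> e e1 e2; rewrite eq eD; exact: (H e e1 e2)].
  have eMk : cl c k M = if c m == k then B *: delta_mx m n else 0.
    by rewrite eM clD (cl_entry _ _ ij) (cl_entry _ _ mn) (negPf ik) add0r.
  have [mk|mk] := eqVneq (c m) k; last first.
    by apply: (small 0); rewrite ?mxnorm0 // eMk (negPf mk).
  rewrite mk eqxx in eMk.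
  case: HB => [HB|[HBA HB]]; first by apply: small eMk; rewrite mxnorm_entry.
  have [|e0 e00 H] := @entry_decrease R N B m n (cl c k Z) B0.
    by rewrite clZe -?mn // Ze.
  by exists e0; [exact: e00 | move=> e e1 e2; rewrite eq eMk -HBA; exact: (H e e1 e2)].
have lt : mxnorm (M - e%:C%C *: Z) < normc A.
  apply: (@mxnorm_lt_cl R N K c) => //.
  by apply: inAD => //; rewrite -scaleNr; exact: inAZ.
have ge : normc A <= mxnorm M.
  apply: le_trans (mxnorm_cl_le (c i) hM).
  rewrite eM clD !cl_entry // eqxx eq_sym (negPf im) addr0 mxnorm_entry //.
have := (E hT hX).1 HBJ (- e%:C%C * lam); rewrite dg_lamZ -/M -/Z => /(le_trans ge).
by rewrite leNgt lt.
Qed.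

Lemma Re_pos (z : C) : z != 0 -> 0 < complex.Re (z^* * z).
Proof. by move=> z0; rewrite mulC_conj /= exprn_gt0 // lt_def normc_eq0 z0 normc_ge0. Qed.

Lemma unit_neq0 (z : C) : normc z = 1 -> z != 0.
Proof. by move=> nz; rewrite -normc_eq0 nz oner_eq0. Qed.

Lemma conj_unit (z : C) : normc z = 1 -> z * z^* = 1.
Proof. by move=> nz; rewrite mulrC mulC_conj nz expr1n. Qed.

Lemma tstE1 a b i j m n : c i != c m -> tst a b i j m n i j = a.
Proof.
move=> im; rewrite !mxE !eqxx; case: (eqVneq i m) => [e|_]; first by rewrite e eqxx in im.
by rewrite /= mulr1 mulr0 addr0.
Qed.

Lemma tstE2 a b i j m n : c i != c m -> tst a b i j m n m n = b.
Proof. by move=> im; rewrite tst_sym tstE1 // eq_sym. Qed.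

(** If the block of [i] dominated strictly, it alone would decide orthogonality after rescaling. But
    [T] is orthogonal to the matrix with one sign changed, where the two contributions cancel, and a
    multiple of that matrix decreases the dominating block. *)
Lemma tst_norm_le i j m n z z' : c i = c j -> c m = c n -> c i != c m ->
  normc z = 1 -> normc z' = 1 ->
  normc (g (tst z^* z'^* i j m n) (c i)) <= normc (g (tst z^* z'^* i j m n) (c m)).
Proof.
move=> ij mn im nz nz'; set T := tst _ _ _ _ _ _; rewrite leNgt; apply/negP => lt.
pose X := tst z^* (- z'^*) i j m n.
have hX : inA c X by exact: inA_tst.
have [zc zc'] : z^* != 0 /\ z'^* != 0 by rewrite !conjC_eq0 !unit_neq0.
have HBJ : BJ T X.
  apply: (@tst_BJ R N K c z z' i j m n X 1 1) => //; rewrite ?ltr01 // /X tstE1 // tstE2 //.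
  by rewrite mulrN !conj_unit // mulrN subrr.
pose w := (g T (c i) * z^*)^* * (g X (c i) * X i j).
have w0 : w != 0 by rewrite mulf_neq0 ?conjC_eq0 ?mulf_neq0 // /X tstE1.
apply: (@tst_no_decrease z^* z'^* i j m n X (twc (cf (c i)) w^*)) => //.
  by rewrite twcK mulrCA; exact: Re_pos.
by left; rewrite !normcM !normc_conj nz nz' !mulr1.
Qed.

Lemma tst_norm_eq i j m n z z' : c i = c j -> c m = c n -> c i != c m ->
  normc z = 1 -> normc z' = 1 ->
  normc (g (tst z^* z'^* i j m n) (c i)) = normc (g (tst z^* z'^* i j m n) (c m)).
Proof.
move=> ij mn im nz nz'; apply/eqP; rewrite eq_le tst_norm_le //= tst_sym tst_norm_le //.
by rewrite eq_sym.
Qed.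

(** The contributions of the two blocks have opposite phases and cancel with suitable weights, so
    [T] is orthogonal to [X]. Both blocks of the rescaled [T] have the same norm, hence no [lam]
    decreases both, and [antiparallel] turns this into a relation of phases. If just one of the
    blocks is antilinear, one contribution appears conjugated; this is the second case. *)
Lemma tst_link i j m n z z' X w : inA c X -> c i = c j -> c m = c n -> c i != c m ->
  normc z = 1 -> normc z' = 1 -> w != 0 -> pm (z * X i j) w -> pm (z' * X m n) (- w) ->
  let T := tst z^* z'^* i j m n in let k := c i in let l := c m in
  if cf k == cf l then pm (g X k * g T l) (g X l * g T k)
  else pm (g X k * g X l * w) (g T k * g T l * w^*).
Proof.
move=> hX ij mn im nz nz' w0 p1 p2 T k l.
have [zc zc'] : z^* != 0 /\ z'^* != 0 by rewrite !conjC_eq0 !unit_neq0.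
have HBJ : BJ T X.
  have [s s0 e1] := p1; have [t t0 e2] := p2.
  apply: (@tst_BJ R N K c z z' i j m n X s t) => //.
  by rewrite e1 e2 mulrN; ring.
pose P := (g T k * z^*)^* * (g X k * X i j); pose Q := (g T l * z'^*)^* * (g X l * X m n).
have eP : P = (g T k)^* * g X k * (z * X i j) by rewrite /P rmorphM /= conjCK; ring.
have eQ : Q = (g T l)^* * g X l * (z' * X m n) by rewrite /Q rmorphM /= conjCK; ring.
have P1 : pm P ((g T k)^* * g X k * w) by rewrite eP; apply: pmM p1; exact: pm_refl.
have Q1 : pm Q (- ((g T l)^* * g X l * w)).
  by rewrite eQ -mulrN; apply: pmM p2; exact: pm_refl.
have n1 : (g T k)^* * g X k * w != 0 by rewrite !mulf_neq0 ?conjC_eq0.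
have n2 : (g T l)^* * g X l * w != 0 by rewrite !mulf_neq0 ?conjC_eq0.
have P0 : P != 0 by case: P1 => s s0 ->; rewrite mulf_neq0 // fmorph_eq0 gt_eqF.
have Q0 : Q != 0 by case: Q1 => s s0 ->; rewrite mulf_neq0 ?oppr_eq0 // fmorph_eq0 gt_eqF.
have nAB : normc (g T l * z'^*) = normc (g T k * z^*).
  by rewrite !normcM !normc_conj nz nz' !mulr1 /k /l /T tst_norm_eq.
have no lam : 0 < complex.Re (twc (cf k) lam * P) -> 0 < complex.Re (twc (cf l) lam * Q) -> False.
  move=> h1 h2; apply: (@tst_no_decrease z^* z'^* i j m n X lam) => //.
    by rewrite mulrCA.
  by right; split=> //; rewrite mulrCA.
case: eqVneq => kl.
  have QP : pm Q (- P).
    by apply: antiparallel => // lam h1 h2; apply: (no (twc (cf k) lam)); rewrite -?kl twcK.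
  have : pm ((g T l)^* * g X l * w) ((g T k)^* * g X k * w).
    have := pm_trans (pm_sym Q1) (pm_trans QP (pmN P1)).
    by move/pmN; rewrite !opprK.
  move/(pm_mulr_cancel w0) => h.
  have := pmM h (pm_refl (g T k * g T l)).
  have -> : (g T l)^* * g X l * (g T k * g T l) = ((g T l)^* * g T l) * (g X l * g T k) by ring.
  have -> : (g T k)^* * g X k * (g T k * g T l) = ((g T k)^* * g T k) * (g X k * g T l) by ring.
  move=> h'; have a1 := pmM (pm_conj_mul (g0 T l)) (pm_refl (g X l * g T k)).
  have a2 := pmM (pm_conj_mul (g0 T k)) (pm_refl (g X k * g T l)).
  rewrite mul1r in a1; rewrite mul1r in a2.
  by apply: pm_trans (pm_sym a2) (pm_trans (pm_sym h') a1).
have QP : pm Q^* (- P).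
  apply: antiparallel; rewrite ?conjC_eq0 // => lam h1 h2; apply: (no (twc (cf k) lam)).
    by rewrite twcK.
  have -> : twc (cf l) (twc (cf k) lam) = lam^*.
    by move: kl; case: (cf k); case: (cf l); rewrite /= ?conjCK.
  have -> : lam^* * Q = (lam * Q^*)^* by rewrite rmorphM /= conjCK.
  by case: (lam * _) h2.
have : pm ((g T l) * (g X l)^* * w^*) ((g T k)^* * g X k * w).
  have := pm_trans (pm_sym (pmJ Q1)) (pm_trans QP (pmN P1)).
  by move/pmN; rewrite rmorphN /= !opprK !rmorphM /= conjCK.
move=> h; have := pmM h (pm_refl (g T k * g X l)).
have -> : (g T l) * (g X l)^* * w^* * (g T k * g X l) =
   ((g X l)^* * g X l) * (g T k * g T l * w^*) by ring.
have -> : (g T k)^* * g X k * w * (g T k * g X l) = ((g T k)^* * g T k) * (g X k * g X l * w) by ring.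
move=> h'; have a1 := pmM (pm_conj_mul (g0 X l)) (pm_refl (g T k * g T l * w^*)).
have a2 := pmM (pm_conj_mul (g0 T k)) (pm_refl (g X k * g X l * w)).
rewrite mul1r in a1; rewrite mul1r in a2.
by apply: pm_trans (pm_sym a2) (pm_trans (pm_sym h') a1).
Qed.

Lemma tst_off a b i j m n p q : (i, j) != (p, q) -> (m, n) != (p, q) -> tst a b i j m n p q = 0.
Proof.
move=> h1 h2; rewrite !mxE.
have -> : (p == i) && (q == j) = false.
  by apply/negP => /andP[/eqP e1 /eqP e2]; rewrite e1 e2 eqxx in h1.
have -> : (p == m) && (q == n) = false.
  by apply/negP => /andP[/eqP e1 /eqP e2]; rewrite e1 e2 eqxx in h2.
by rewrite !mulr0 addr0.
Qed.

Section TwoClasses.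
Variables (k l : K) (i0 i1 j0 j1 : 'I_N).
Hypotheses (ck0 : c i0 = k) (ck1 : c i1 = k) (cl0 : c j0 = l) (cl1 : c j1 = l).
Hypotheses (i01 : i0 != i1) (j01 : j0 != j1) (kl : k != l).

(** With entries at two disjoint pairs of positions a single matrix can be linked to two test
    matrices at once. *)
Lemma four_entries a b a' b' i j m n i' j' m' n' :
  c i = k -> c j = k -> c m = l -> c n = l -> c i' = k -> c j' = k -> c m' = l -> c n' = l ->
  (i, j) != (i', j') -> (m, n) != (m', n') ->
  let X := tst a b i j m n + tst a' b' i' j' m' n' in
  [/\ inA c X, X i j = a, X m n = b & X i' j' = a' /\ X m' n' = b'].
Proof.
move=> ci cj' cm cn ci' cj'' cm' cn' ij mn X.
have ne p q r s : c p = k -> c r = l -> (p, q) != (r, s) :> 'I_N * 'I_N.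
  move=> cp cr; apply: contraNneq kl => -[e _]; by rewrite -cp -cr e.
have h1 : c i != c m by rewrite ci cm.
have h2 : c i' != c m' by rewrite ci' cm'.
split.
- by apply: inAD; apply: inA_tst; rewrite ?ci ?cj' ?cm ?cn ?ci' ?cj'' ?cm' ?cn'.
- by rewrite mxE tstE1 // tst_off ?addr0 //; rewrite eq_sym //; exact: ne.
- by rewrite mxE tstE2 // tst_off ?addr0 //; [exact: ne | rewrite eq_sym].
split.
  by rewrite mxE tst_off ?add0r ?tstE1 //; rewrite eq_sym; exact: ne.
by rewrite mxE tst_off ?add0r ?tstE2 //; exact: ne.
Qed.

(** If the blocks differed, a link would fix the phase of [g X k * g X l] in terms of [w]. The
    matrix [Y], with [w = 1] at both pairs of positions, equates the phases of the two test
    matrices; [X], with [w = 1] and [w = i], makes them opposite. *)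
Lemma cf_eq : cf k = cf l.
Proof.
apply/eqP/negPn/negP => ne.
have n11 : normc (1 : C) = 1 by exact: normc1.
have di : (i0, i0) != (i1, i1) :> 'I_N * 'I_N by apply: contraNneq i01 => -[->].
have dj : (j0, j0) != (j1, j1) :> 'I_N * 'I_N by apply: contraNneq j01 => -[->].
pose T2 := tst (1 : C) 1 i1 i1 j1 j1.
have lk X w i j : inA c X -> w != 0 -> c i = k -> c j = l -> X i i = w -> X j j = - w ->
  pm (g X k * g X l * w) (g (tst 1 1 i i j j) k * g (tst 1 1 i i j j) l * w^*).
  move=> hX w0 ci cj' e1 e2.
  have := @tst_link i i j j 1 1 X w hX erefl erefl; rewrite ci cj' => /(_ kl n11 n11 w0).
  by cbv zeta; rewrite conjC1 !mul1r e1 e2 (negPf ne); apply; exact: pm_refl.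
have i0' : 'i%C != 0 :> C by rewrite eq_complex /= oner_eq0 andbF.
have [hX x1 x2 [x3 x4]] := @four_entries 1 (-1) 'i%C (- 'i%C) i0 i0 j0 j0 i1 i1 j1 j1
   ck0 ck0 cl0 cl0 ck1 ck1 cl1 cl1 di dj.
have [hY y1 y2 [y3 y4]] := @four_entries 1 (-1) 1 (-1) i0 i0 j0 j0 i1 i1 j1 j1
   ck0 ck0 cl0 cl0 ck1 ck1 cl1 cl1 di dj.
set X := _ + _ in hX x1 x2 x3 x4; set Y := _ + _ in hY y1 y2 y3 y4.
have one := oner_neq0 C.
have lk1 Z i j : inA c Z -> c i = k -> c j = l -> Z i i = 1 -> Z j j = -1 ->
    pm (g Z k * g Z l) (g (tst 1 1 i i j j) k * g (tst 1 1 i i j j) l).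
  move=> hZ ci cj' e1 e2; have := lk Z 1 i j hZ one ci cj' e1 e2.
  by rewrite conjC1 (mulr1 (g Z k * g Z l)) (mulr1 (_ * g _ l)).
have h1 := lk1 X i0 j0 hX ck0 cl0 x1 x2; have h2 := lk X 'i%C i1 j1 hX i0' ck1 cl1 x3 x4.
have h3 := lk1 Y i0 j0 hY ck0 cl0 y1 y2; have h4 := lk1 Y i1 j1 hY ck1 cl1 y3 y4.
have ci : 'i%C^* = - 'i%C :> C by apply/eqP; rewrite eq_complex /= oppr0 !eqxx.
rewrite ci in h2; have h5 := pm_trans (pm_sym h3) h4.
rewrite mulrN -mulNr in h2; have h6 := pm_mulr_cancel i0' h2.
have h7 := pm_trans (pm_sym h1) h6.
have n0 : g T2 k * g T2 l != 0 by rewrite mulf_neq0.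
by case: (pmNself n0); exact: (pm_trans (pm_sym h5) h7).
Qed.

(** Equality of the phases of the quotients [x.1 / x.2] and [y.1 / y.2], written without
    division. *)
Definition eqr (x y : C * C) : Prop := pm (x.1 * y.2) (x.2 * y.1).
Local Notation f X := (g X k, g X l).

Lemma eqr_sym X Y : eqr (f X) (f Y) -> eqr (f Y) (f X).
Proof. by rewrite /eqr /= => h; rewrite mulrC [X in pm _ X]mulrC; exact: pm_sym. Qed.

Lemma eqr_trans Y X Z : eqr (f X) (f Y) -> eqr (f Y) (f Z) -> eqr (f X) (f Z).
Proof.
rewrite /eqr /= => h1 h2.
have h0 : g Y k * g Y l != 0 by rewrite mulf_neq0.
apply: (pm_mulr_cancel h0); have := pmM h1 h2.
by congr pm; ring.
Qed.

Lemma link_eqr i j m n z z' X : inA c X -> c i = k -> c j = k -> c m = l -> c n = l ->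
  normc z = 1 -> normc z' = 1 -> pm (z * X i j) 1 -> pm (z' * X m n) (-1) ->
  eqr (f X) (f (tst z^* z'^* i j m n)).
Proof.
move=> hX ci cj' cm cn nz nz' p1 p2.
have := @tst_link i j m n z z' X 1 hX; rewrite ci cj' cm cn => /(_ erefl erefl kl nz nz').
by cbv zeta; rewrite cf_eq eqxx; apply; rewrite ?oner_neq0.
Qed.

Lemma tst_eqr i j m n z z' i' j' m' n' y y' :
  c i = k -> c j = k -> c m = l -> c n = l -> c i' = k -> c j' = k -> c m' = l -> c n' = l ->
  (i, j) != (i', j') -> (m, n) != (m', n') ->
  normc z = 1 -> normc z' = 1 -> normc y = 1 -> normc y' = 1 ->
  eqr (f (tst z^* z'^* i j m n)) (f (tst y^* y'^* i' j' m' n')).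
Proof.
move=> ci cj' cm cn ci' cj'' cm' cn' ij mn nz nz' ny ny'.
have [hX x1 x2 [x3 x4]] := @four_entries z^* (- z'^*) y^* (- y'^*) i j m n i' j' m' n'
  ci cj' cm cn ci' cj'' cm' cn' ij mn.
set X := _ + _ in hX x1 x2 x3 x4.
have one (u : C) : normc u = 1 -> pm (u * u^*) 1.
  by move=> nu; rewrite conj_unit //; exact: pm_refl.
apply: (@eqr_trans X); first apply: eqr_sym.
  by apply: link_eqr => //; rewrite ?x1 ?x2 ?mulrN; [exact: one | exact/pmN/one].
by apply: link_eqr => //; rewrite ?x3 ?x4 ?mulrN; [exact: one | exact/pmN/one].
Qed.

(** Test matrices that share an entry are not compared directly by [tst_eqr]; they go through a
    third one, at [(i1, i1)], [(j1, j1)] or at [(i0, i1)], [(j0, j1)], which shares no entry with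
    either. *)
Lemma tst_eqr_ref i j m n z z' :
  c i = k -> c j = k -> c m = l -> c n = l -> normc z = 1 -> normc z' = 1 ->
  eqr (f (tst z^* z'^* i j m n)) (f (tst 1^* 1^* i0 i0 j0 j0)).
Proof.
move=> ci cj' cm cn nz nz'.
have [i10 j10] : i1 != i0 /\ j1 != j0 by rewrite eq_sym i01 eq_sym j01.
have n1 : normc (1 : C) = 1 by exact: normc1.
have d (p q r s : 'I_N) : (p != r) || (q != s) -> (p, q) != (r, s).
  by rewrite -negb_and xpair_eqE.
have R21 : eqr (f (tst 1^* 1^* i1 i1 j1 j1)) (f (tst 1^* 1^* i0 i0 j0 j0)).
  by apply: tst_eqr => //; apply: d; rewrite ?i01 ?j01 ?i10 ?j10 ?orbT.
have R31 : eqr (f (tst 1^* 1^* i0 i1 j0 j1)) (f (tst 1^* 1^* i0 i0 j0 j0)).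
  by apply: tst_eqr => //; apply: d; rewrite ?i01 ?j01 ?i10 ?j10 ?orbT.
have [e1|e1] := eqVneq (i, j) (i0, i0); last first.
  have [e2|e2] := eqVneq (m, n) (j0, j0); last exact: tst_eqr.
  have [e3|e3] := eqVneq (i, j) (i1, i1).
    apply: (eqr_trans _ R31); case: e2 e3 => -> -> [-> ->].
    by apply: tst_eqr => //; apply: d; rewrite ?i01 ?j01 ?i10 ?j10 ?orbT.
  apply: (eqr_trans _ R21); apply: tst_eqr => //; rewrite e2.
  by apply: d; rewrite ?i01 ?j01 ?i10 ?j10 ?orbT.
have [e2|e2] := eqVneq (m, n) (j1, j1).
  apply: (eqr_trans _ R31); case: e2 e1 => -> -> [-> ->].
  by apply: tst_eqr => //; apply: d; rewrite ?i01 ?j01 ?i10 ?j10 ?orbT.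
apply: (eqr_trans _ R21); apply: tst_eqr => //; rewrite e1.
by apply: d; rewrite ?i01 ?j01 ?i10 ?j10 ?orbT.
Qed.

Lemma dir_unit (x : C) : x != 0 ->
  exists2 z : C, normc z = 1 & pm (z * x) 1.
Proof.
move=> x0; have n0 : normc x != 0 by rewrite normc_eq0.
exists (((normc x)^-1)%:C%C * x^*).
  by rewrite normcM normc_conj normc_real ?invr_ge0 ?normc_ge0 // mulVf.
have h : pm ((normc x)^-1)%:C%C (1 : C).
  by exists (normc x)^-1; rewrite ?mulr1 // invr_gt0 lt_def n0 normc_ge0.
by have := pmM h (pm_conj_mul x0); rewrite mulr1 mulrA.
Qed.

Lemma rho_const X Y : inA c X -> inA c Y -> cl c k X != 0 -> cl c l X != 0 ->
  cl c k Y != 0 -> cl c l Y != 0 -> pm (g X k * g Y l) (g X l * g Y k).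
Proof.
have ent q (Z : 'M[C]_N) : cl c q Z != 0 -> exists i j, [/\ c i = q, c j = q & Z i j != 0].
  move=> Z0; apply: contrapT => H; case/eqP: Z0; apply/matrixP => i j; rewrite !mxE.
  case: (eqVneq (c i) q) => //= ci; case: (eqVneq (c j) q) => //= cj'.
  by apply/eqP/negPn/negP => z; apply: H; exists i, j.
have ref (Z : 'M[C]_N) : inA c Z -> cl c k Z != 0 -> cl c l Z != 0 ->
    eqr (f Z) (f (tst 1^* 1^* i0 i0 j0 j0)).
  move=> hZ /ent[i [j [ci cj' Zij]]] /ent[m [n [cm cn Zmn]]].
  have [z nz pz] := dir_unit Zij; have [z' nz' pz'] := dir_unit Zmn.
  (* A link needs contributions of opposite phase, whence the sign of [z']. *)
  apply: (@eqr_trans (tst z^* (- z')^* i j m n)); last by apply: tst_eqr_ref; rewrite ?normcN.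
  by apply: link_eqr; rewrite ?normcN // mulNr; exact: pmN.
move=> hX hY X1 X2 Y1 Y2.
by have := eqr_trans (ref X hX X1 X2) (eqr_sym (ref Y hY Y1 Y2)).
Qed.

End TwoClasses.
End PhaseMain.

(** * Blocks that attain the norm *)

Section Norming.
Variables (R : realType) (N : nat) (K : finType) (c : 'I_N -> K).
Local Notation C := R[i].
Implicit Types (lam z : C) (X Y M Z : 'M[C]_N) (k l : K) (i j : 'I_N).
Variables (cf : K -> bool) (g : 'M[C]_N -> K -> C).
Hypothesis c2 : forall i, exists2 j, j != i & c j = c i.
Hypothesis g0 : forall X k, g X k != 0.
Hypothesis E : forall X Y, inA c X -> inA c Y -> (BJ X Y <-> BJ2 c cf g X Y).

Lemma cl_neq0 q Z : cl c q Z != 0 -> exists i, c i = q.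
Proof.
move=> Z0; apply: contrapT => H; case/eqP: Z0; apply/matrixP => i j; rewrite !mxE.
by case: (eqVneq (c i) q) => //= ci; case: H; exists i.
Qed.

Lemma rho_constant k l X Y : inA c X -> inA c Y -> cl c k X != 0 -> cl c l X != 0 ->
  cl c k Y != 0 -> cl c l Y != 0 -> pm (g X k * g Y l) (g X l * g Y k).
Proof.
move=> hX hY X1 X2 Y1 Y2.
have [<-|kl] := eqVneq k l; first exact: pm_refl.
have [i ci] := cl_neq0 X1; have [j cj] := cl_neq0 X2.
have [i' i1 ci'] := c2 i; have [j' j1 cj'] := c2 j.
rewrite eq_sym in i1; rewrite eq_sym in j1.
by apply: (@rho_const R N K c cf g g0 E k l i i' j j'); rewrite ?ci' ?cj'.
Qed.

Lemma cf_uniform : exists b, forall i, cf (c i) = b.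
Proof.
have [[i0 _]|H] := pselect (exists i : 'I_N, true); last first.
  by exists true => i; case: H; exists i.
exists (cf (c i0)) => i; have [->//|ne] := eqVneq (c i) (c i0).
have [i' i1 ci'] := c2 i; have [j' j1 cj'] := c2 i0.
rewrite eq_sym in i1; rewrite eq_sym in j1.
exact: (@cf_eq R N K c cf g g0 E (c i) (c i0) i i' i0 j' erefl ci' erefl cj' i1 j1 ne).
Qed.

Lemma clN k X : cl c k (- X) = - cl c k X.
Proof. by rewrite -scaleN1r clZ scaleN1r. Qed.

Lemma cl_rest k l X : cl c l (X - cl c k X) = if l == k then 0 else cl c l X.
Proof. by rewrite clD clN cl_cl; case: ifP; rewrite ?subrr ?subr0. Qed.

Lemma inA_rest k X : inA c X -> inA c (X - cl c k X).
Proof. by move=> hX; rewrite -scaleN1r; apply: inAD => //; exact/inAZ/inA_cl. Qed.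

Lemma mxnorm_gt0 Z : Z != 0 -> 0 < mxnorm Z.
Proof.
move=> Z0; rewrite lt_def mxnorm_ge0 andbT.
by apply: contra Z0 => /eqP /mxnorm_eq0 ->.
Qed.

Lemma normc_pos z : z != 0 -> 0 < normc z.
Proof. by move=> z0; rewrite lt_def normc_eq0 z0 normc_ge0. Qed.

Lemma half_lt (u v : R) : v <= u -> 0 < u -> 2^-1 * v < u.
Proof. by move=> *; lra. Qed.

Lemma dg_eq0 (f : K -> C) X : (forall k, f k != 0) -> dg c f X = 0 -> X = 0.
Proof.
move=> f0 /matrixP h; apply/matrixP => i j; have := h i j; rewrite !mxE => /eqP.
by rewrite mulf_eq0 (negPf (f0 _)) => /eqP.
Qed.

(** [X] is orthogonal to [Y], which is [X] without the block [k]. If the block [k] of the rescaled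
    matrix stayed below the norm, the other blocks could be shrunk together by a small multiple of
    the rescaled [Y], since by [rho_constant] a single phase serves all of them. *)
Lemma norming_push k X : inA c X -> X != 0 -> mxnorm (cl c k X) = mxnorm X ->
  normc (g X k) * mxnorm (cl c k X) = mxnorm (dg c (g X) X).
Proof.
move=> hX X0 HN; set X' := dg c (g X) X.
have hX' : inA c X' by exact: inA_dg.
have X'0 : X' != 0 by apply: contra X0 => /eqP /(dg_eq0 (g0 X)) ->.
have eN l : mxnorm (cl c l X') = normc (g X l) * mxnorm (cl c l X).
  by rewrite cl_dg mxnormZ.
have le := mxnorm_cl_le k hX'.
rewrite -(eN k).
have [lt|ge] := ltP (mxnorm (cl c k X')) (mxnorm X'); last exact: (eq_of_le le ge).
exfalso.
pose Y := X - cl c k X; have hY : inA c Y by exact: inA_rest.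
have clY l : cl c l Y = if l == k then 0 else cl c l X by exact: cl_rest.
have HBJ : BJ X Y.
  move=> lam; rewrite -{1}HN.
  have -> : cl c k X = cl c k (X + lam *: Y) by rewrite clD clZ clY eqxx scaler0 addr0.
  exact: (mxnorm_cl_le k (inAD hX (inAZ lam hY))).
have X'p := mxnorm_gt0 X'0.
have [l0 [l0k L0]] : exists l0, l0 != k /\ cl c l0 X != 0.
  apply: contrapT => H; have : mxnorm X' <= mxnorm (cl c k X').
    apply: (mxnorm_le_cl hX' (mxnorm_ge0 _)) => l.
    have [->|lk] := eqVneq l k; first exact: lexx.
    rewrite eN; have -> : cl c l X = 0.
      apply/eqP/negPn/negP => h; exact: (H (ex_intro _ l (conj lk h))).
    by rewrite mxnorm0 mulr0 mxnorm_ge0.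
  by rewrite leNgt lt.
have [b Hb] := cf_uniform.
(* [om] matches the scalars of [X] and [Y] on the block [l0], and up to positive factors on every
   other nonzero block except [k]. The [twc b] undoes the conjugation, which by [cf_uniform] is the
   same on all blocks. *)
pose om := g X l0 / g Y l0.
pose Y' := dg c (fun l => twc (cf l) (twc b om)) (dg c (g Y) Y).
have hY' : inA c Y' by exact/inA_dg/inA_dg.
have eY' l : cl c l Y' = twc (cf l) (twc b om) *: (g Y l *: cl c l Y) by rewrite /Y' !cl_dg.
have eX' l : cl c l X' = g X l *: cl c l X by exact: cl_dg.
have [e e_gt0 He] : exists2 e : R, 0 < e & forall l, mxnorm (cl c l (X' - e%:C%C *: Y')) < mxnorm X'.
  apply: common_eps => l.
  have eq (e : R) : cl c l (X' - e%:C%C *: Y') = cl c l X' - e%:C%C *: cl c l Y'.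
    by rewrite clD -scaleNr clZ scaleNr.
  have [lk|lk] := eqVneq l k.
    exists 1; [exact: ltr01 | move=> e _ _; rewrite eq].
    by rewrite eY' clY lk eqxx !scaler0 subr0.
  have [L|L] := eqVneq (cl c l X) 0.
    exists 1; [exact: ltr01 | move=> e _ _; rewrite eq].
    by rewrite eY' eX' clY (negPf lk) L !scaler0 subr0 mxnorm0.
  have [i ci] := cl_neq0 L.
  have [s s0 es] : pm (g X l * g Y l0) (g X l0 * g Y l).
    by apply: (rho_constant hX hY L L0); rewrite clY ?(negPf lk) ?(negPf l0k).
  have es' : g X l = s%:C%C * (om * g Y l).
    by apply: (mulIf (g0 Y l0)); rewrite es /om; field; exact: g0.
  have sV : s^-1%:C%C * s%:C%C = 1 :> C by rewrite -rmorphM /= mulVf ?gt_eqF.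
  have eY : cl c l Y' = s^-1%:C%C *: cl c l X'.
    rewrite eY' eX' clY (negPf lk) -ci Hb twcK ci !scalerA es'; congr (_ *: _).
    by rewrite mulrA sV mul1r.
  exists s; [exact: s0 | move=> e e1 e2]; rewrite eq eY scalerA -{1}[cl c l X']scale1r -scalerBl.
  have -> : 1 - e%:C%C * s^-1%:C%C = (1 - e / s)%:C%C :> C by rewrite rmorphB rmorphM rmorph1.
  have es1 : 0 <= 1 - e / s by rewrite subr_ge0 (ler_pdivrMr _ _ s0) mul1r.
  rewrite mxnormZ (normc_real es1); apply: (lt_le_trans _ (mxnorm_cl_le l hX')).
  have Xl : 0 < mxnorm (cl c l X').
    by rewrite eN (mulr_gt0 (normc_pos (g0 X l)) (mxnorm_gt0 L)).
  by rewrite -[ltRHS]mul1r (ltr_pM2r Xl) ltrBlDr ltrDl (divr_gt0 e1 s0).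
have : mxnorm (X' - e%:C%C *: Y') < mxnorm X'.
  apply: (mxnorm_lt_cl _ X'p He); apply: (inAD hX').
  by rewrite -scaleNr; exact: inAZ.
have := (E hX hY).1 HBJ (- e%:C%C * twc b om); rewrite dg_lamZ -/X' -/Y'.
by rewrite leNgt => /negP.
Qed.

(** Here orthogonality is clear for the rescaled matrices, because their block [k] is not moved.
    Transferred back it fails if the block [k] of [X] lies below the norm, as [X - Y / 2] halves all
    other blocks. *)
Lemma norming_pull k X : inA c X -> X != 0 ->
  normc (g X k) * mxnorm (cl c k X) = mxnorm (dg c (g X) X) ->
  mxnorm (cl c k X) = mxnorm X.
Proof.
move=> hX X0 HN; set X' := dg c (g X) X.
have hX' : inA c X' by exact: inA_dg.
have le := mxnorm_cl_le k hX.
have [lt|ge] := ltP (mxnorm (cl c k X)) (mxnorm X); last exact: (eq_of_le le ge).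
exfalso.
pose Y := X - cl c k X; have hY : inA c Y by exact: inA_rest.
have clY l : cl c l Y = if l == k then 0 else cl c l X by exact: cl_rest.
have HBJ : BJ X Y.
  apply/(E hX hY) => lam; rewrite -/X' -HN -mxnormZ -cl_dg.
  set Z := dg c _ (dg c _ _); have hZ : inA c Z by exact/inA_dg/inA_dg.
  have -> : cl c k X' = cl c k (X' + Z) by rewrite clD !cl_dg clY eqxx !scaler0 addr0.
  by apply: mxnorm_cl_le; exact: inAD.
have Xp := mxnorm_gt0 X0.
have : mxnorm (X + (- (2^-1)%:C%C) *: Y) < mxnorm X.
  apply: (mxnorm_lt_cl (inAD hX (inAZ _ hY)) Xp) => l.
  rewrite clD clZ clY; have [->|lk] := eqVneq l k; first by rewrite scaler0 addr0.
  rewrite -{1}[cl c l X]scale1r -scalerDl.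
  have -> : 1 - (2^-1)%:C%C = (2^-1)%:C%C :> C.
    by apply/eqP; rewrite eq_complex /= subrr eqxx andbT; apply/eqP; field.
  have h2 : 0 <= 2^-1 :> R by rewrite invr_ge0 ler0n.
  rewrite mxnormZ (normc_real h2).
  exact: (half_lt (mxnorm_cl_le l hX) Xp).
by have := HBJ (- (2^-1)%:C%C); rewrite leNgt => /negP.
Qed.

End Norming.

(** * Vectors on which the norm is attained *)

Section MaximalVectors.
Variables (R : realType) (N : nat) (K : finType) (c : 'I_N -> K).
Local Notation C := R[i].
Implicit Types (X Y Z : 'M[C]_N) (x : 'cV[C]_N) (k : K) (f : K -> C) (p : K -> R).

Definition maximal X x : Prop := vnorm (X *m x) = mxnorm X * vnorm x.

(** The squared defects of the block components are nonnegative and add up to that of [x]. *)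
Lemma maximal_pr X x : inA c X -> maximal X x <-> forall k, maximal X (pr c k x).
Proof.
move=> hX.
have le k : vnorm (X *m pr c k x) ^+ 2 <= (mxnorm X * vnorm (pr c k x)) ^+ 2.
  by rewrite ler_sqr ?nnegrE ?(vnorm_ge0 _) ?(mulr_ge0 (mxnorm_ge0 _) (vnorm_ge0 _)) ?vnorm_mulmx.
have e1 : vnorm (X *m x) ^+ 2 = \sum_k vnorm (X *m pr c k x) ^+ 2.
  by rewrite (vnorm_pr c); apply: eq_bigr => k _; rewrite inA_mul_pr.
have e2 : (mxnorm X * vnorm x) ^+ 2 = \sum_k (mxnorm X * vnorm (pr c k x)) ^+ 2.
  by rewrite exprMn (vnorm_pr c) mulr_sumr; apply: eq_bigr => k _; rewrite exprMn.
have sq (a b : R) : 0 <= a -> 0 <= b -> a ^+ 2 = b ^+ 2 -> a = b.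
  by move=> a0 b0 /eqP; rewrite eqrXn2 // => /eqP.
split=> [H k|H].
  have : \sum_k ((mxnorm X * vnorm (pr c k x)) ^+ 2 - vnorm (X *m pr c k x) ^+ 2) == 0.
    by rewrite sumrB -e1 -e2 H subrr.
  rewrite psumr_eq0 => [/allP/(_ k)|l _]; last by rewrite subr_ge0 le.
  rewrite mem_index_enum => /(_ isT) /=; rewrite subr_eq0 => /eqP h.
  by apply: sq; rewrite ?h ?(vnorm_ge0 _) ?(mulr_ge0 (mxnorm_ge0 _) (vnorm_ge0 _)).
apply: sq; rewrite ?(vnorm_ge0 _) ?(mulr_ge0 (mxnorm_ge0 _) (vnorm_ge0 _)) // e1 e2.
by apply: eq_bigr => k _; rewrite H.
Qed.

Lemma dg_mul_supp f X k x : supp c k x -> inA c X -> dg c f X *m x = f k *: (X *m x).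
Proof.
move=> sx hX; apply/matrixP => i j; rewrite ord1 [RHS]mxE !mxE mulr_sumr; apply: eq_bigr => m _.
rewrite mxE; have [mk|mk] := eqVneq (c m) k; last by rewrite sx // !mulr0.
have [ik|ik] := eqVneq (c i) k; first by rewrite ik mulrA.
by rewrite hX ?mulr0 ?mul0r ?mulr0 // mk.
Qed.

Lemma dgM (f h : K -> C) X : dg c f (dg c h X) = dg c (fun k => f k * h k) X.
Proof. by apply/matrixP => i j; rewrite !mxE mulrA. Qed.

Lemma dg1 X : dg c (fun _ => 1) X = X.
Proof. by apply/matrixP => i j; rewrite !mxE mul1r. Qed.

Lemma eq_dg f h X : f =1 h -> dg c f X = dg c h X.
Proof. by move=> fh; apply/matrixP => i j; rewrite !mxE fh. Qed.

Lemma dgD f X Y : dg c f (X + Y) = dg c f X + dg c f Y.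
Proof. by apply/matrixP => i j; rewrite !mxE mulrDr. Qed.

Lemma dgZ f a X : dg c f (a *: X) = a *: dg c f X.
Proof. by apply/matrixP => i j; rewrite !mxE mulrCA. Qed.

Lemma mxnorm_dg_le f X : (forall k, normc (f k) = 1) -> inA c X -> mxnorm (dg c f X) <= mxnorm X.
Proof.
move=> f1 hX; apply: (mxnorm_le_class (inA_dg f hX) (mxnorm_ge0 X)) => k x sx.
by rewrite (dg_mul_supp f sx hX) vnormZ f1 mul1r vnorm_mulmx.
Qed.

Lemma mxnorm_dg f X : (forall k, normc (f k) = 1) -> inA c X -> mxnorm (dg c f X) = mxnorm X.
Proof.
move=> f1 hX; have le := mxnorm_dg_le f1 hX.
have f2 k : normc (f k)^* = 1 by rewrite normc_conj f1.
have ge := mxnorm_dg_le f2 (inA_dg f hX); rewrite dgM in ge.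
rewrite (eq_dg (h := fun _ => 1)) in ge; last by move=> k; rewrite mulC_conj f1 expr1n.
rewrite dg1 in ge; exact: (eq_of_le le ge).
Qed.

Lemma maximal_supp X k x : inA c X -> supp c k x -> x != 0 -> maximal X x ->
  mxnorm (cl c k X) = mxnorm X.
Proof.
move=> hX sx x0 H; have le := mxnorm_cl_le k hX.
have ge : mxnorm X <= mxnorm (cl c k X).
  have xp : 0 < vnorm x by rewrite vnorm_gt0.
  by rewrite -(ler_pM2r xp) -[leLHS]H -(cl_mul sx hX); exact: vnorm_mulmx.
exact: (eq_of_le le ge).
Qed.

(** Maximality is tested on block components. A nonzero maximal component forces its block to attain
    the norm, and [Hp] says that the same blocks attain it before and after scaling; inside a block
    everything is multiplied by [p k]. *)
Lemma maximal_dg p X x : inA c X -> (forall k, 0 < p k) ->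
  (forall k, mxnorm (cl c k X) = mxnorm X <->
     p k * mxnorm (cl c k X) = mxnorm (dg c (fun k => (p k)%:C%C) X)) ->
  maximal X x <-> maximal (dg c (fun k => (p k)%:C%C) X) x.
Proof.
move=> hX p0 Hp; set Z := dg c _ X; have hZ : inA c Z by exact: inA_dg.
have np k : normc (p k)%:C%C = p k by apply: normc_real; exact: (ltW (p0 k)).
have nZ k : mxnorm (cl c k Z) = p k * mxnorm (cl c k X) by rewrite cl_dg mxnormZ np.
suff E k : maximal X (pr c k x) <-> maximal Z (pr c k x).
  by rewrite (maximal_pr _ hX) (maximal_pr _ hZ); split=> H k; apply/E.
have sx : supp c k (pr c k x) by exact: pr_supp.
have [->|x0] := eqVneq (pr c k x) 0; first by split=> _; rewrite /maximal mulmx0 vnorm0 mulr0.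
have eZ : vnorm (Z *m pr c k x) = p k * vnorm (X *m pr c k x).
  by rewrite (dg_mul_supp _ sx hX) vnormZ np.
split=> H.
  have h := maximal_supp hX sx x0 H; have h' := (Hp k).1 h.
  by rewrite /maximal eZ H -h' h mulrA.
have h := maximal_supp hZ sx x0 H; rewrite nZ in h; have h' := (Hp k).2 h.
have pk : p k != 0 by rewrite gt_eqF.
by apply: (mulfI pk); rewrite -eZ H -/Z -h h' mulrA.
Qed.

End MaximalVectors.

Lemma pm_normalize (R : realType) (u v : R[i]) :
  pm u v -> normc v = 1 -> u = (normc u)%:C%C * v.
Proof.
by case=> s s0 -> nv; rewrite normcM nv mulr1 (normc_real (ltW s0)).
Qed.

(** * The factorisation for block algebras *)

Section Core.
Variables (R : realType) (N r : nat) (K L : finType) (c : 'I_N -> K) (d : 'I_r -> L).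
Local Notation C := R[i].
Local Notation cj := (map_mx (@Num.conj C)).
Implicit Types (X Y : 'M[C]_N) (k : K).

Lemma unit_direction (z : C) : z != 0 -> exists2 u : C, normc u = 1 & pm u z.
Proof.
move=> z0; exists (((normc z)^-1)%:C%C * z).
  by rewrite normcM (normc_real (_ : 0 <= _)) ?mulVf ?normc_eq0 // invr_ge0 normc_ge0.
by exists (normc z)^-1; rewrite // invr_gt0 normc_pos.
Qed.

Lemma BJ_structure (Phi : 'M[C]_N -> 'M[C]_r) Psi :
  BJpair c d Phi Psi -> (forall i, exists2 j, j != i & c j = c i) ->
  exists (U : 'M[C]_(r, N)) (ell : 'I_N -> L) (Ps : 'M[C]_N -> 'M[C]_r)
    (gamma : 'M[C]_N -> C) (p : 'M[C]_N -> K -> R),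
  [/\ [/\ (cj U)^T *m U = 1%:M, U *m (cj U)^T = 1%:M,
        forall i, supp d (ell i) (col i U) & forall i j, ell i = ell j <-> c i = c j],
    [/\ forall X Y, Ps (X + Y) = Ps X + Ps Y,
        forall (t : R) X, Ps (t%:C%C *: X) = t%:C%C *: Ps X,
        forall X, inA c X -> mxnorm (Ps X) = mxnorm X,
        forall X, inA d (Ps X) &
        forall Z, inA d Z -> exists2 X, inA c X & Ps X = Z],
    forall X, normc (gamma X) = 1,
    forall X k, 0 < p X k &
    forall X, inA c X ->
      (forall x, maximal X x <-> maximal (dg c (fun k => (p X k)%:C%C) X) x) /\
      Phi X = Ps (gamma X *: dg c (fun k => (p X k)%:C%C) X)].
Proof.
move=> HP c2; have [sw [cf [U [W [ell [[UU1 UU2 WW1 WW2] [sU sW hell] HUW]]]]]] := structure HP c2.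
case: (HP) => h1 h2 h3 h4 h5.
have /choice[g Hg] : forall X, exists f : K -> C, (forall k, f k != 0) /\
    (inA c X -> Phi X = Psi0 c sw cf U W (dg c f X)).
  move=> X; have [hX|nX] := pselect (inA c X); last first.
    by exists (fun _ => 1); split=> // k; exact: oner_neq0.
  by have [f f0 e] := Phi_Psi0 UU2 WW2 sU sW hell h1 HUW hX; exists f.
have g0 X k : g X k != 0 by have [H _] := Hg X; exact: H.
have gE X : inA c X -> Phi X = Psi0 c sw cf U W (dg c (g X) X) by have [_ H] := Hg X.
have E X Y : inA c X -> inA c Y -> (BJ X Y <-> BJ2 c cf g X Y).
  move=> hX hY; apply: (iff_trans (h5 X Y hX hY)).
  have e lam : mxnorm (Phi X + lam *: Phi Y) =
      mxnorm (dg c (g X) X + dg c (fun k => twc (cf k) lam) (dg c (g Y) Y)).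
    rewrite (gE X hX) (gE Y hY) Psi0Z -Psi0D mxnorm_Psi0 //.
    by apply: inAD; [exact: inA_dg | exact/inA_dg/inA_dg].
  have e0 : mxnorm (Phi X) = mxnorm (dg c (g X) X).
    by rewrite (gE X hX) mxnorm_Psi0 //; exact: inA_dg.
  by split=> H lam; have := H lam; rewrite e e0.
(* All nonempty blocks of the identity are nonzero, so its scalars can serve as reference phases.
   They do not depend on [X] and go into the isometry. *)
have /choice[th Hth] : forall k, exists u, normc u = 1 /\ pm u (g 1%:M k).
  by move=> k; have [u ? ?] := unit_direction (g0 1%:M k); exists u.
have hI : inA c (1%:M : 'M[C]_N).
  by move=> i j ij; rewrite mxE; case: eqVneq => // e; rewrite e eqxx in ij.
have clI i : cl c (c i) (1%:M : 'M[C]_N) != 0.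
  by apply/eqP => /matrixP/(_ i i); rewrite !mxE !eqxx => /eqP; rewrite oner_eq0.
pose p X k := normc (g X k).
have p0 X k : 0 < p X k by exact: normc_pos.
have /choice[gamma Hgamma] : forall X, exists ga, normc ga = 1 /\
    (inA c X -> forall k, cl c k X != 0 -> g X k = ga * th k * (p X k)%:C%C).
  (* Any nonzero block [k0] determines [gamma X]; at [X = 0] and outside the algebra the value 1 is
     taken. *)
  move=> X; have [[hX [k0 X0]]|H] := pselect (inA c X /\ exists k0, cl c k0 X != 0); last first.
    exists 1; split=> [|hX k Xk]; first exact: normc1.
    by case: H; split=> //; exists k.
  have [u nu pu] := unit_direction (g0 X k0).
  have [nt pt] := Hth k0.
  have nga : normc (u * (th k0)^*) = 1 by rewrite normcM normc_conj nu nt mulr1.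
  exists (u * (th k0)^*); split=> // _ k Xk; rewrite mulrC; have [ntk ptk] := Hth k.
  apply: pm_normalize; last by rewrite normcM nga ntk mulr1.
  have [i ci] := cl_neq0 Xk; have [i0 ci0] := cl_neq0 X0.
  have rho : pm (g X k * g 1%:M k0) (g X k0 * g 1%:M k).
    by apply: (rho_constant c2 g0 E hX hI Xk X0); rewrite -?ci -?ci0.
  apply: (pm_mulr_cancel (g0 1%:M k0)); apply: (pm_trans rho).
  apply: (@pm_trans _ (u * th k * (th k0 * (th k0)^*))).
    rewrite (mulrC (th k0)) mulC_conj nt expr1n mulr1; exact: (pmM (pm_sym pu) (pm_sym ptk)).
  have -> : u * th k * (th k0 * (th k0)^*) = u * (th k0)^* * th k * th k0 by ring.
  exact: (pmM (pm_refl _) pt).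
exists U, ell, (fun X => Psi0 c sw cf U W (dg c th X)), gamma, p.
have nth k : normc (th k) = 1 by have [] := Hth k.
split=> [||X|//|X hX].
- by split.
- split=> [X Y|t X|X hX|X|Z hZ].
  + by rewrite dgD Psi0D.
  + rewrite Psi0Z dgZ; congr (Psi0 c sw cf U W _); apply/matrixP => i j; rewrite !mxE.
    congr (_ * _); rewrite /twc; case: (cf _) => //; exact/esym/conjc_real.
  + by rewrite mxnorm_Psi0 ?mxnorm_dg //; exact: inA_dg.
  + exact: inA_Psi0.
  have [X hX <-] := Psi0_surj sw cf UU2 WW2 sU sW hell hZ.
  exists (dg c (fun k => (th k)^*) X); first exact: inA_dg.
  congr (Psi0 c sw cf U W _).
  rewrite dgM -[RHS](dg1 c); apply: eq_dg => k.
  by rewrite mulrC mulC_conj nth expr1n.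
- by have [] := Hgamma X.
have eX : dg c (g X) X = dg c th (gamma X *: dg c (fun k => (p X k)%:C%C) X).
  have [_ /(_ hX) Hga] := Hgamma X.
  apply/matrixP => i j; rewrite !mxE.
  have [->|Xij] := eqVneq (X i j) 0; first by rewrite !mulr0.
  have ij : c i = c j by apply/eqP/negPn/negP => ij; rewrite hX ?eqxx in Xij.
  rewrite Hga; first ring.
  by apply: contra Xij => /eqP/matrixP/(_ i j); rewrite !mxE ij eqxx /= => ->.
split; last by rewrite (gE X hX) eX.
move=> x; apply: (maximal_dg _ hX (p0 X)) => k.
have nE : mxnorm (dg c (fun k => (p X k)%:C%C) X) = mxnorm (dg c (g X) X).
  rewrite eX (mxnorm_dg nth (inAZ _ (inA_dg _ hX))).
  by rewrite mxnormZ; have [-> _] := Hgamma X; rewrite mul1r.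
rewrite nE; have [->|X0] := eqVneq X 0.
  have -> : dg c (g 0) (0 : 'M[C]_N) = 0 by apply/matrixP => i j; rewrite !mxE mulr0.
  have -> : cl c k (0 : 'M[C]_N) = 0 by apply/matrixP => i j; rewrite !mxE if_same.
  by rewrite !mxnorm0 mulr0; exact: iff_refl.
split; first exact: (norming_push c2 g0 E hX X0).
move=> h; apply: (norming_pull E hX X0 h).
Qed.

End Core.

(** * Finite-dimensionality of the codomain *)

Section HahnBanach.
Variables (R : realType) (V : lmodType R[i]) (nrm : V -> R).
Local Notation C := R[i].
Hypothesis nrmD : forall x y, nrm (x + y) <= nrm x + nrm y.
Hypothesis nrmZ : forall (a : C) x, nrm (a *: x) = normc a * nrm x.

Lemma nrm_ge0 x : 0 <= nrm x.
Proof.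
have := nrmD x ((-1) *: x); rewrite nrmZ normcN normc1 mul1r scaleN1r subrr.
have -> : nrm 0 = 0 by rewrite -(scale0r (0 : V)) nrmZ normc0 mul0r.
by lra.
Qed.

Lemma nrmZ_real (t : R) x : 0 <= t -> nrm (t%:C%C *: x) = t * nrm x.
Proof. by move=> t0; rewrite nrmZ normc_real. Qed.

(** Functionals are defined on coefficient sequences instead of a span: the vectors may be
    dependent, and domination by the norm alone is what makes a value depend only on the vector. *)
Definition lincomb (u : nat -> V) n (t : nat -> R) : V := \sum_(i < n) (t i)%:C%C *: u i.
Definition pairing (al : nat -> R) n (t : nat -> R) : R := \sum_(i < n) t i * al i.

Lemma lincombD u n s t : lincomb u n (fun i => s i + t i) = lincomb u n s + lincomb u n t.
Proof. by rewrite -big_split; apply: eq_bigr => i _; rewrite rmorphD scalerDl. Qed.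

Lemma lincombZ u n (e : R) t : lincomb u n (fun i => e * t i) = e%:C%C *: lincomb u n t.
Proof. by rewrite scaler_sumr; apply: eq_bigr => i _; rewrite rmorphM scalerA. Qed.

Lemma pairingD al n s t : pairing al n (fun i => s i + t i) = pairing al n s + pairing al n t.
Proof. by rewrite -big_split; apply: eq_bigr => i _; rewrite mulrDl. Qed.

Lemma pairingZ al n (e : R) t : pairing al n (fun i => e * t i) = e * pairing al n t.
Proof. by rewrite mulr_sumr; apply: eq_bigr => i _; rewrite mulrA. Qed.

(** One step of Hahn-Banach: [a] is the supremum of the lower bounds imposed by negative [e], and
    the triangle inequality keeps it below the upper bounds imposed by positive [e]. *)
Lemma dominated_extension u n al :
  (forall t, pairing al n t <= nrm (lincomb u n t)) ->
  exists a : R, forall t (e : R), pairing al n t + e * a <= nrm (lincomb u n t + e%:C%C *: u n).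
Proof.
move=> H; pose S := [set pairing al n t - nrm (lincomb u n t - u n) | t in [set: nat -> R]].
have ubS s : ubound S (nrm (lincomb u n s + u n) - pairing al n s).
  move=> _ [t _ <-]; have h := H (fun i => t i + s i); rewrite pairingD lincombD in h.
  have h' := nrmD (lincomb u n t - u n) (lincomb u n s + u n).
  rewrite addrACA addNr addr0 in h'; move: h h'; clear; lra.
have supS : has_sup S.
  split; first by exists (pairing al n (fun=> 0) - nrm (lincomb u n (fun=> 0) - u n)), (fun=> 0).
  exists (nrm (lincomb u n (fun=> 0) + u n) - pairing al n (fun=> 0)); exact: ubS.
have up s : sup S <= nrm (lincomb u n s + u n) - pairing al n s.
  by apply: ge_sup; [have [] := supS | exact: ubS].
have lo s : pairing al n s - nrm (lincomb u n s - u n) <= sup S.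
  by apply: (sup_upper_bound supS); exists s.
exists (sup S) => t e; have [e0|e0|->] := ltgtP e 0; last first.
- by rewrite mul0r addr0 scale0r addr0.
- have ee : e * e^-1 = 1 by rewrite mulfV // gt_eqF.
  have -> : lincomb u n t + e%:C%C *: u n = e%:C%C *: (lincomb u n (fun i => e^-1 * t i) + u n).
    rewrite scalerDr -lincombZ; congr (lincomb u n _ + _).
    by apply: funext => i; rewrite mulrA ee mul1r.
  have -> : pairing al n t = e * pairing al n (fun i => e^-1 * t i).
    by rewrite -pairingZ; congr pairing; apply: funext => i; rewrite mulrA ee mul1r.
  rewrite (nrmZ_real _ (ltW e0)) -mulrDr (ler_pM2l e0).
  by move: (up (fun i => e^-1 * t i)); clear; lra.
pose f := - e; have f0 : 0 < f by rewrite oppr_gt0.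
have ff : f * f^-1 = 1 by rewrite mulfV // gt_eqF.
have -> : lincomb u n t + e%:C%C *: u n = f%:C%C *: (lincomb u n (fun i => f^-1 * t i) - u n).
  rewrite scalerBr -lincombZ rmorphN scaleNr opprK; congr (lincomb u n _ + _).
  by apply: funext => i; rewrite mulrA ff mul1r.
have -> : pairing al n t = f * pairing al n (fun i => f^-1 * t i).
  by rewrite -pairingZ; congr pairing; apply: funext => i; rewrite mulrA ff mul1r.
have -> : e * sup S = f * - sup S by rewrite mulrNN.
rewrite (nrmZ_real _ (ltW f0)) -mulrDr (ler_pM2l f0).
by move: (lo (fun i => f^-1 * t i)); clear; lra.
Qed.

Lemma dominated_functional u n : exists al : nat -> R,
  al 0%N = nrm (u 0%N) /\ forall t, pairing al n.+1 t <= nrm (lincomb u n.+1 t).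
Proof.
elim: n => [|n [al [al0 H]]].
  exists (fun=> nrm (u 0%N)); split=> // t; rewrite /pairing /lincomb !big_ord1.
  have [t0|t0] := leP 0 (t 0%N); first by rewrite nrmZ_real.
  by apply: (le_trans _ (nrm_ge0 _)); rewrite nmulr_rle0 ?nrm_ge0.
have [a Ha] := dominated_extension H.
exists (fun i => if i == n.+1 then a else al i); split=> // t.
rewrite /pairing /lincomb big_ord_recr /= eqxx [X in nrm X]big_ord_recr /=.
apply: (le_trans _ (Ha t (t n.+1))).
by rewrite lerD2r; under eq_bigr => i _ do rewrite ltn_eqF //.
Qed.

Lemma sum_pairs (W : nmodType) (F : nat -> W) n :
  \sum_(i < n.*2) F i = \sum_(i < n) (F i.*2 + F i.*2.+1).
Proof.
elim: n => [|n IH]; first by rewrite !big_ord0.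
by rewrite doubleS !big_ord_recr /= IH addrA.
Qed.

Lemma complex_functional (b : V) n (v : 'I_n -> V) : exists ph : 'I_n -> C,
  forall z : 'I_n -> C, \sum_i z i * ph i = 0 ->
    forall lam : C, nrm b <= nrm (b + lam *: \sum_i z i *: v i).
Proof.
pose w j := if j is j'.+1 then (if insub j' is Some i then v i else 0) else b.
pose u i := if odd i then 'i%C *: w i./2 else w i./2.
have [al [al0 Hal]] := dominated_functional u n.*2.+1.
have u0 : u 0%N = b by [].
rewrite u0 in al0.
exists (fun i => Complex (al i.+1.*2) (- al i.+1.*2.+1)) => z Hz lam.
pose q j : C := if j is j'.+1 then (if insub j' is Some i then lam * z i else 0) else 1.
pose t i := if odd i then complex.Im (q i./2) else complex.Re (q i./2).
have wS (i : 'I_n) : w i.+1 = v i by rewrite /w valK.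
have qS (i : 'I_n) : q i.+1 = lam * z i by rewrite /q valK.
have eL : lincomb u n.*2.+2 t = b + lam *: \sum_i z i *: v i.
  rewrite /lincomb -doubleS (sum_pairs (fun i => (t i)%:C%C *: u i)).
  have e (i : nat) : (t i.*2)%:C%C *: u i.*2 + (t i.*2.+1)%:C%C *: u i.*2.+1 = q i *: w i.
    rewrite /t /u /= odd_double /= uphalf_double doubleK scalerA -scalerDl; congr (_ *: _).
    by case: (q i) => x y; apply/eqP; rewrite eq_complex /= ; apply/andP; split; apply/eqP; ring.
  under eq_bigr => i _ do rewrite e.
  rewrite big_ord_recl [q _]/= [w _]/= scale1r; congr (_ + _); rewrite scaler_sumr.
  by apply: eq_bigr => i _; rewrite lift0 qS wS scalerA.
have eP : pairing al n.*2.+2 t = nrm b.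
  rewrite /pairing -doubleS (sum_pairs (fun i => t i * al i)).
  have e (i : nat) : t i.*2 * al i.*2 + t i.*2.+1 * al i.*2.+1 =
      complex.Re (q i * Complex (al i.*2) (- al i.*2.+1)).
    rewrite /t /= odd_double /= uphalf_double doubleK.
    by case: (q i) => x y /=; ring.
  under eq_bigr => i _ do rewrite e.
  rewrite -raddf_sum big_ord_recl.
  have -> : \sum_(i < n) q (lift ord0 i) *
      Complex (al (lift ord0 i).*2) (- al (lift ord0 i).*2.+1) =
      lam * \sum_i z i * Complex (al i.+1.*2) (- al i.+1.*2.+1).
    by rewrite mulr_sumr; apply: eq_bigr => i _; rewrite lift0 qS mulrA.
  by rewrite Hz mulr0 addr0 [q _]/= mul1r /= al0.
by rewrite -eP -eL.
Qed.

(* Each functional costs one linear condition. *)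
Lemma common_kernel n (I : finType) (b : I -> V) (v : 'I_n -> V) : (#|I| < n)%N ->
  exists z : 'I_n -> C, (exists i, z i != 0) /\
    forall k (lam : C), nrm (b k) <= nrm (b k + lam *: \sum_i z i *: v i).
Proof.
move=> ltn; have /choice[ph Hph] := fun k => complex_functional (b k) v.
pose A : 'M[C]_(n, #|I|) := \matrix_(i, j) ph (enum_val j) i.
have /rowV0Pn[z zk z0] : kermx A != 0.
  by rewrite -mxrank_eq0 mxrank_ker subn_eq0 -ltnNge (leq_ltn_trans (rank_leq_col A)).
have /matrixP zA : z *m A = 0 by apply/sub_kermxP.
exists (fun i => z 0 i); split.
  apply: contrapT => H; case/eqP: z0; apply/matrixP => i j; rewrite ord1 mxE.
  by apply/eqP/negPn/negP => h; apply: H; exists j.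
move=> k; apply: Hph; have := zA 0 (enum_rank k); rewrite !mxE => e; rewrite -[RHS]e.
by apply: eq_bigr => i _; rewrite mxE enum_rankK.
Qed.

End HahnBanach.

(** * Matrix units in the codomain *)

Section SelfAdjoint.
Variables (R : realType) (B : CstarAlgebra R).
Local Notation C := R[i].
Local Notation "x ** y" := (@cs_mul R B x y) (at level 40, left associativity).
Local Notation "x ^st" := (@cs_star R B x) (at level 2, format "x ^st").
Implicit Types (x y z a p q : B) (f h : {poly C}).

Lemma bmulDl x y z : (x + y) ** z = x ** z + y ** z.
Proof. by have := cs_mulDl 1 x y z; rewrite !scale1r. Qed.

Lemma bmulDr x y z : x ** (y + z) = x ** y + x ** z.
Proof. by have := cs_mulDr 1 x y z; rewrite !scale1r. Qed.

Lemma bmul0l x : 0 ** x = 0.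
Proof. by apply: (addrI (0 ** x)); rewrite -bmulDl !addr0. Qed.

Lemma bmul0r x : x ** 0 = 0.
Proof. by apply: (addrI (x ** 0)); rewrite -bmulDr !addr0. Qed.

Lemma bmulZl (t : C) x y : (t *: x) ** y = t *: (x ** y).
Proof. by have := cs_mulDl t x 0 y; rewrite addr0 bmul0l addr0. Qed.

Lemma bmulZr (t : C) x y : x ** (t *: y) = t *: (x ** y).
Proof. by have := cs_mulDr t x y 0; rewrite addr0 bmul0r addr0. Qed.

Lemma bmulNl x y : (- x) ** y = - (x ** y).
Proof. by rewrite -!(scaleN1r (_ : B)) bmulZl. Qed.

Lemma bmulNr x y : x ** (- y) = - (x ** y).
Proof. by rewrite -!(scaleN1r (_ : B)) bmulZr. Qed.

Lemma bmul_suml (I : Type) (s : seq I) (P : pred I) (F : I -> B) y :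
  (\sum_(i <- s | P i) F i) ** y = \sum_(i <- s | P i) F i ** y.
Proof. by apply: (big_morph (fun x => x ** y) (fun _ _ => bmulDl _ _ _) (bmul0l y)). Qed.

Lemma bmul_sumr (I : Type) (s : seq I) (P : pred I) (F : I -> B) y :
  y ** (\sum_(i <- s | P i) F i) = \sum_(i <- s | P i) y ** F i.
Proof. by apply: (big_morph (fun x => y ** x) (fun _ _ => bmulDr _ _ _) (bmul0r y)). Qed.

Lemma bstar0 : (0 : B)^st = 0.
Proof. by apply: (addrI (0 : B)^st); rewrite -cs_starD !addr0. Qed.

Lemma bstarN x : (- x)^st = - x^st.
Proof. by rewrite -!(scaleN1r (_ : B)) cs_starZ rmorphN rmorph1. Qed.

Lemma bstar_sum (I : Type) (s : seq I) (P : pred I) (F : I -> B) :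
  (\sum_(i <- s | P i) F i)^st = \sum_(i <- s | P i) (F i)^st.
Proof. exact: (big_morph (@cs_star R B) (@cs_starD R B) bstar0). Qed.

Lemma bnorm0 : cs_norm (0 : B) = 0.
Proof. by rewrite -(scale0r (0 : B)) cs_normZ normc0 mul0r. Qed.

Lemma bproper x : x^st ** x = 0 -> x = 0.
Proof.
by move=> e; apply: cs_norm_eq0; apply/eqP; rewrite -sqrf_eq0 -cs_Cstar e bnorm0.
Qed.

(* The powers of [a] start at [a] since [B] is not assumed to have a unit. *)
Definition pw a i : B := iter i (cs_mul a) a.
Definition ev a f : B := \sum_(i < size f) f`_i *: pw a i.

Lemma ev_widen a f n : (size f <= n)%N -> ev a f = \sum_(i < n) f`_i *: pw a i.
Proof.
move=> le; rewrite /ev (big_ord_widen n (fun i => f`_i *: pw a i) le).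
rewrite big_mkcond /=; apply: eq_bigr => i _; case: ltnP => // h.
by rewrite nth_default // scale0r.
Qed.

Lemma evB a f h : ev a (f - h) = ev a f - ev a h.
Proof.
pose n := maxn (size f) (maxn (size h) (size (f - h))).
have [l1 l2 l3] : [/\ size f <= n, size h <= n & size (f - h)%R <= n]%N.
  by rewrite /n !leq_max !leqnn !orbT.
rewrite (ev_widen a l1) (ev_widen a l2) (ev_widen a l3) -sumrB; apply: eq_bigr => i _.
by rewrite coefB scalerBl.
Qed.

Lemma evZ a (t : C) f : ev a (t *: f) = t *: ev a f.
Proof.
rewrite (ev_widen a (size_scale_leq t f)) /ev scaler_sumr; apply: eq_bigr => i _.
by rewrite coefZ scalerA.
Qed.

Lemma evX a f : ev a ('X * f) = a ** ev a f.
Proof.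
have le : (size ('X * f)%R <= (size f).+1)%N.
  by apply: (leq_trans (size_polyMleq _ _)); rewrite size_polyX.
rewrite (ev_widen a le) big_ord_recl coefXM eqxx scale0r add0r /ev bmul_sumr.
by apply: eq_bigr => i _; rewrite lift0 coefXM /= bmulZr.
Qed.

(** [ev a f] represents [a f(a)], whence the additional factor [l]. *)
Lemma ev_eigen a b (l : C) f : a ** b = l *: b -> ev a f ** b = (l * f.[l]) *: b.
Proof.
move=> e; rewrite horner_coef mulr_sumr scaler_suml /ev bmul_suml; apply: eq_bigr => i _.
rewrite bmulZl mulrCA -scalerA -exprS; congr (_ *: _).
elim: (i : nat) => [|n IH]; first by rewrite expr1.
by rewrite /pw /= -cs_mulA -/(pw a n) IH bmulZr e scalerA [in RHS]exprSr.
Qed.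

Section SA.
Variable a : B.
Hypothesis sa : a^st = a.

Lemma pw_star i : (pw a i)^st = pw a i.
Proof.
have cm n : pw a n ** a = a ** pw a n by elim: n => //= n IH; rewrite -cs_mulA IH.
by elim: i => //= i IH; rewrite cs_starM -/(pw a i) IH sa cm.
Qed.

Lemma ev_star f : (ev a f)^st = ev a (map_poly (@Num.conj C) f).
Proof.
rewrite [RHS](@ev_widen a _ (size f)) ?size_map_poly // /ev bstar_sum; apply: eq_bigr => i _.
by rewrite cs_starZ pw_star coef_map.
Qed.

Variable M : nat.
Hypothesis fd : forall v : 'I_M -> B,
  exists z : 'I_M -> C, (exists i, z i != 0) /\ \sum_i z i *: v i = 0.

Lemma annihilator : exists f, f != 0 /\ ev a f = 0.
Proof.
have [z [[i zi] e]] := fd (fun i => pw a i).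
exists (rVpoly (\row_i z i)); split.
  apply: contra zi => /eqP h; have := coef_rVpoly_ord (\row_i z i) i.
  by rewrite h coef0 mxE => <-.
rewrite (@ev_widen a _ M) ?size_poly // -[RHS]e; apply: eq_bigr => j _.
by rewrite coef_rVpoly_ord mxE.
Qed.

(* If [m] is a nonzero polynomial of minimal degree annihilating [a] and [m = (X - l) h], then
   [b = h(a)] satisfies [a b = l b], so [b^* b] is a multiple of [b], and the square of [b^* b]
   is a multiple of [b^* b]. *)
Lemma spectral_projection : a != 0 -> exists q (l : C),
  [/\ l != 0, q^st = q, q ** q = q, q != 0 & a ** q = l *: q].
Proof.
move=> a0; pose P n := `[< exists f, [/\ f != 0, ev a f = 0 & size f = n] >].
have exP : exists n, P n.
  by have [f [f0 ef]] := annihilator; exists (size f); apply/asboolP; exists f.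
case: (ex_minnP exP) => n /asboolP[m [m0 em sm]] min_n.
have sm1 : size m != 1.
  apply/negP => /eqP s1; have /eqP := em; rewrite /ev s1 big_ord1 /= scaler_eq0 (negPf a0) orbF.
  move=> /eqP m00; case/eqP: m0; apply/polyP => j; rewrite coef0.
  by case: j => [//|j]; rewrite nth_default // s1.
have /closed_rootP[l ml] := sm1.
have [h eh] := factor_theorem _ _ ml.
have h0 : h != 0 by apply: contraNneq m0 => e; rewrite eh e mul0r.
have sh : (size h < size m)%N.
  by rewrite eh size_Mmonic ?monicXsubC // size_XsubC addn2.
pose b := ev a h.
have b0 : b != 0.
  apply/negP => /eqP e; have : P (size h) by apply/asboolP; exists h.
  by move/min_n; rewrite -sm leqNgt sh.
have ab : a ** b = l *: b.
  apply/eqP; rewrite -subr_eq0 -evX -evZ -evB; apply/eqP; rewrite -[RHS]em eh.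
  by congr (ev a _); rewrite mulrBr mulrC -mul_polyC (mulrC h l%:P).
pose ka := l * (map_poly (@Num.conj C) h).[l]; pose nu := l * h.[l].
have bb : b^st ** b = ka *: b by rewrite ev_star (ev_eigen _ ab).
have b2 : b ** b = nu *: b by rewrite {1}/b (ev_eigen _ ab).
pose c := b^st ** b.
have c0 : c != 0 by apply: contraNneq b0 => /bproper ->.
have ka0 : ka != 0 by apply: contraNneq c0 => e; rewrite /c bb e scale0r.
have sc : c^st = c by rewrite /c cs_starM cs_starK.
pose mu := ka * nu.
have cc : c ** c = mu *: c.
  by rewrite /c bb bmulZl bmulZr b2 !scalerA /mu; congr (_ *: _); ring.
have mu0 : mu != 0.
  apply: contraNneq c0 => e; apply/eqP/bproper; by rewrite sc cc e scale0r.
have mur : mu^* = mu.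
  have : (mu^* - mu) *: c = 0.
    by rewrite scalerBl -cc -{1}sc -cs_starZ -cc cs_starM sc subrr.
  by move/eqP; rewrite scaler_eq0 (negPf c0) orbF subr_eq0 => /eqP.
have muri : (mu^-1)^* = mu^-1.
  by apply: (mulIf mu0); rewrite -{2}mur -rmorphM mulVf // rmorph1.
exists (mu^-1 *: c), l; split.
- by apply: contraNneq ka0 => e; rewrite /ka e mul0r.
- by rewrite cs_starZ sc muri.
- by rewrite bmulZl bmulZr cc !scalerA -mulrA mulVf // mulr1.
- by rewrite scaler_eq0 negb_or invr_eq0 mu0.
by rewrite bmulZr /c bb bmulZr ab !scalerA; congr (_ *: _); ring.
Qed.

End SA.
End SelfAdjoint.

(** * Minimal projections *)

Section Projections.
Variables (R : realType) (B : CstarAlgebra R) (M : nat).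
Local Notation C := R[i].
Local Notation "x ** y" := (@cs_mul R B x y) (at level 40, left associativity).
Local Notation "x ^st" := (@cs_star R B x) (at level 2, format "x ^st").
Implicit Types (x y z a p q : B).
Hypothesis fd : forall v : 'I_M -> B,
  exists z : 'I_M -> C, (exists i, z i != 0) /\ \sum_i z i *: v i = 0.

Definition proj q : Prop := [/\ q^st = q, q ** q = q & q != 0].
Definition orthfam n (p : 'I_n -> B) : Prop :=
  (forall i, proj (p i)) /\ (forall i j, i != j -> p i ** p j = 0).

Lemma orthfam_size n (p : 'I_n -> B) : orthfam p -> (n <= M)%N.
Proof.
move=> [Hp Ho]; rewrite leqNgt; apply/negP => lt.
have [z [[i zi] e]] := fd (fun i => p (widen_ord (ltnW lt) i)).
have [_ pp p0] := Hp (widen_ord (ltnW lt) i).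
have := congr1 (fun y => p (widen_ord (ltnW lt) i) ** y) e.
rewrite bmul0r bmul_sumr (bigD1 i) //= big1.
  by rewrite bmulZr pp addr0 => /eqP; rewrite scaler_eq0 (negPf zi) (negPf p0).
by move=> j ji; rewrite bmulZr Ho ?scaler0 // eq_sym -(inj_eq val_inj).
Qed.

Lemma orthfam_add n (p : 'I_n -> B) q : orthfam p -> proj q -> (forall i, p i ** q = 0) ->
  exists p' : 'I_n.+1 -> B, orthfam p'.
Proof.
move=> [Hp Ho] Hq Hpq; exists (fun i => if unlift ord_max i is Some j then p j else q).
have Hqp i : q ** p i = 0.
  have [sq _ _] := Hq; have [sp _ _] := Hp i.
  by rewrite -sq -sp -cs_starM Hpq bstar0.
split=> [i|i j]; first by case: unliftP.
case: (unliftP ord_max i) => [i' ->|->]; case: (unliftP ord_max j) => [j' ->|->] //.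
  by rewrite (inj_eq lift_inj); exact: Ho.
by rewrite eqxx.
Qed.

Lemma orthfam_replace n (p : 'I_n -> B) i q : orthfam p -> proj q -> p i ** q = q ->
  orthfam (fun j => if j == i then q else p j).
Proof.
move=> [Hp Ho] Hq piq.
have pjq j : j != i -> p j ** q = 0 by move=> ji; rewrite -piq cs_mulA Ho // bmul0l.
have qpj j : j != i -> q ** p j = 0.
  move=> ji; have [sq _ _] := Hq; have [sp _ _] := Hp j.
  by rewrite -sq -sp -cs_starM pjq // bstar0.
split=> [j|j k]; first by case: ifP.
have [->|ji] := eqVneq j i; have [_|ki] := eqVneq k i => //= jk.
- exact: qpj.
- exact: pjq.
exact: Ho.
Qed.

Lemma maximal_orthfam : exists n (p : 'I_n -> B), orthfam p /\
  forall p' : 'I_n.+1 -> B, ~ orthfam p'.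
Proof.
pose P n := `[< exists p : 'I_n -> B, orthfam p >].
have ex : exists n, P n.
  by exists 0; apply/asboolP; exists (fun _ => 0); split=> [[]|[]].
have bd n : P n -> (n <= M)%N by move=> /asboolP[p]; exact: orthfam_size.
case: (ex_maxnP ex bd) => n /asboolP[p Hp] mx; exists n, p; split=> // p' Hp'.
have : P n.+1 by apply/asboolP; exists p'.
by move/mx; rewrite ltnn.
Qed.

(** The family has the largest possible size. A self-adjoint element of the corner of [p i] that is
    not a multiple of [p i] has a spectral projection [q] splitting [p i] into [q] and [p i - q]. If
    [x] differed from the sum of the [p i ** x] by [y], a spectral projection of [y ** y^st] would
    be orthogonal to the whole family. The sum of the family thus acts as a unit. *)
Lemma minimal_projections : exists n (p : 'I_n -> B),
  [/\ orthfam p, forall i x, exists t : C, p i ** x ** p i = t *: p i,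
    forall x, \sum_i p i ** x = x & forall x, \sum_i x ** p i = x].
Proof.
have [n [p [Hfam Hmax]]] := maximal_orthfam; case: (Hfam) => Hp Ho.
have Hsa i a : a^st = a -> p i ** a = a -> exists t : C, a = t *: p i.
  move=> sa pa; have [->|a0] := eqVneq a 0; first by exists 0; rewrite scale0r.
  have [sp pp p0] := Hp i.
  have ap : a ** p i = a by rewrite -sa -sp -cs_starM pa.
  have [q [l [l0 sq qq q0 aq]]] := spectral_projection sa fd a0.
  exists l; have [e|ne] := eqVneq (p i) q; first by rewrite e -aq -e ap.
  have pq : p i ** q = q.
    have : l *: (p i ** q) = l *: q by rewrite -bmulZr -aq cs_mulA pa.
    by move/(scalerI l0).
  have qp : q ** p i = q by rewrite -sq -sp -cs_starM pq.
  have Hq : proj q by [].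
  have Hq' : proj (p i - q).
    split; first by rewrite cs_starD bstarN sp sq.
      by rewrite bmulDl bmulNl !bmulDr !bmulNr pp pq qp qq subrr subr0.
    by rewrite subr_eq0.
  have [p' Hp'] : exists p' : 'I_n.+1 -> B, orthfam p'.
    apply: (orthfam_add (orthfam_replace Hfam Hq pq) Hq') => j.
    case: eqVneq => [_|ji]; first by rewrite bmulDr bmulNr qp qq subrr.
    by rewrite bmulDr bmulNr Ho // -pq cs_mulA Ho // bmul0l subrr.
  by case: (Hmax p').
have Hunit x : \sum_i p i ** x = x.
  apply/eqP; rewrite eq_sym -subr_eq0; apply/negPn/negP => y0.
  set y := x - _ in y0.
  have py i : p i ** y = 0.
    rewrite /y bmulDr bmulNr bmul_sumr (bigD1 i) //= big1 => [|j ji].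
      by have [_ pp _] := Hp i; rewrite addr0 cs_mulA pp subrr.
    by rewrite cs_mulA Ho ?bmul0l // eq_sym.
  pose e := y ** y^st.
  have se : e^st = e by rewrite /e cs_starM cs_starK.
  have e0 : e != 0.
    apply: contraNneq y0 => h; have : y^st = 0 by apply: bproper; rewrite cs_starK.
    by move=> h'; rewrite -[y]cs_starK h' bstar0.
  have [q [l [l0 sq qq q0 eq]]] := spectral_projection se fd e0.
  have Hq : proj q by [].
  have [p' Hp'] : exists p' : 'I_n.+1 -> B, orthfam p'.
    apply: (orthfam_add Hfam Hq) => i; apply: (scalerI l0).
    by rewrite -bmulZr -eq cs_mulA /e cs_mulA py !bmul0l scaler0.
  exact: (Hmax p').
exists n, p; split=> // [i x|x].
  have [sp pp p0] := Hp i.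
  have cut y : y^st = y -> exists t : C, p i ** y ** p i = t *: p i.
    move=> sy; apply: Hsa; first by rewrite !cs_starM sp sy cs_mulA.
    by rewrite !cs_mulA pp.
  have [t1 e1] : exists t : C, p i ** (x + x^st) ** p i = t *: p i.
    by apply: cut; rewrite cs_starD cs_starK addrC.
  have [t2 e2] : exists t : C, p i ** ('i%C *: (x - x^st)) ** p i = t *: p i.
    apply: cut; rewrite cs_starZ cs_starD bstarN cs_starK.
    have -> : 'i%C^* = - 'i%C :> C by apply/eqP; rewrite eq_complex /= oppr0 !eqxx.
    by rewrite scaleNr -scalerN opprB.
  have ii : 'i%C * 'i%C = -1 :> C.
    by apply/eqP; rewrite eq_complex /= !mulr0 !mul0r mulr1 addr0 oppr0 sub0r !eqxx.
  have x2 : x + x = (2 : C) *: x by rewrite scaler_nat.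
  (* [x] is half of [x + x^st] minus [i] times [i (x - x^st)], and both of these elements are
     self-adjoint. *)
  exists (2^-1 * (t1 - 'i%C * t2)).
  rewrite -scalerA scalerBl -scalerA -e1 -e2 bmulZr bmulZl scalerA ii scaleN1r opprK.
  rewrite -bmulDl -bmulDr addrACA subrr addr0 x2 bmulZr bmulZl scalerA.
  by rewrite mulVf ?scale1r // pnatr_eq0.
rewrite -[RHS](cs_starK x) -(Hunit x^st) bstar_sum; apply: eq_bigr => i _.
by have [sp _ _] := Hp i; rewrite cs_starM cs_starK sp.
Qed.

End Projections.

(** * Partial isometries and matrix units *)

Section MatrixUnits.
Variables (R : realType) (B : CstarAlgebra R) (n : nat) (p : 'I_n -> B).
Local Notation C := R[i].
Local Notation "x ** y" := (@cs_mul R B x y) (at level 40, left associativity).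
Local Notation "x ^st" := (@cs_star R B x) (at level 2, format "x ^st").
Local Notation cj := (map_mx (@Num.conj C)).
Implicit Types (x y z : B) (i j k : 'I_n).
Hypothesis Hfam : orthfam p.
Hypothesis Hmin : forall i x, exists t : C, p i ** x ** p i = t *: p i.
Hypothesis Hl : forall x, \sum_i p i ** x = x.
Hypothesis Hr : forall x, \sum_i x ** p i = x.

Lemma proj_star i : (p i)^st = p i. Proof. by case: Hfam => H _; case: (H i). Qed.
Lemma proj_idem i : p i ** p i = p i. Proof. by case: Hfam => H _; case: (H i). Qed.
Lemma proj_neq0 i : p i != 0. Proof. by case: Hfam => H _; case: (H i). Qed.
Lemma proj_orth i j : i != j -> p i ** p j = 0. Proof. by case: Hfam => _; apply. Qed.

Lemma pZ_inj i : injective (fun t : C => t *: p i).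
Proof.
move=> s t /eqP; rewrite -subr_eq0 -scalerBl scaler_eq0 (negPf (proj_neq0 i)) orbF subr_eq0.
by move/eqP.
Qed.

Lemma sub_star i j x : p i ** x = x -> x ** p j = x -> p j ** x^st = x^st /\ x^st ** p i = x^st.
Proof.
move=> e1 e2; split; first by rewrite -{2}e2 cs_starM proj_star.
by rewrite -{2}e1 cs_starM proj_star.
Qed.

Lemma star_mul_scalar i j x : p i ** x = x -> x ** p j = x ->
  exists2 t : C, x^st ** x = t *: p j & t^* = t.
Proof.
move=> e1 e2; have [e3 e4] := sub_star e1 e2.
have [t et] := Hmin j (x^st ** x).
have et' : x^st ** x = t *: p j by rewrite -et cs_mulA e3 -cs_mulA e2.
exists t => //; apply: (@pZ_inj j).
by rewrite -{1}(proj_star j) -cs_starZ -et' cs_starM cs_starK.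
Qed.

(** Murray-von Neumann equivalence of minimal projections; its classes become the blocks. *)
Definition linked i j : Prop := exists x, [/\ p i ** x = x, x ** p j = x & x != 0].

Lemma linked_refl i : linked i i.
Proof. by exists (p i); rewrite proj_idem; split=> //; exact: proj_neq0. Qed.

Lemma linked_sym i j : linked i j -> linked j i.
Proof.
move=> [x [e1 e2 x0]]; have [e3 e4] := sub_star e1 e2; exists x^st; split=> //.
by apply: contraNneq x0 => h; rewrite -(cs_starK x) h bstar0.
Qed.

Lemma linked_trans j i k : linked i j -> linked j k -> linked i k.
Proof.
move=> [x [e1 e2 x0]] [y [e3 e4 y0]]; exists (x ** y).
split; [by rewrite cs_mulA e1 | by rewrite -cs_mulA e4|].
have [t et _] := star_mul_scalar e1 e2.
have t0 : t != 0.
  by apply: contraNneq x0 => t0; apply/eqP/bproper; rewrite et t0 scale0r.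
apply: contraNneq y0 => h; have := bmul0r (x^st); rewrite -{1}h cs_mulA et bmulZl e3.
by move/eqP; rewrite scaler_eq0 (negPf t0).
Qed.

(** A canonical member of the class, the same for all linked indices, so that it can serve as the
    colour. *)
Definition rep i : 'I_n := choose (fun j => `[< linked i j >]) i.

Lemma linked_rep i : linked i (rep i).
Proof. by apply/asboolP; apply: (@chooseP _ (fun j => `[< linked i j >])); exact/asboolP/linked_refl. Qed.

Lemma rep_linked i j : linked i j -> rep i = rep j.
Proof.
move=> ij; rewrite /rep.
have eqP' : (fun k => `[< linked i k >]) =1 (fun k => `[< linked j k >]).
  move=> k; apply/asboolP/asboolP => h.
    exact: linked_trans (linked_sym ij) h.
  exact: linked_trans ij h.
by rewrite (eq_choose eqP'); apply: choose_id; apply/asboolP;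
  [exact: linked_sym | exact: linked_refl].
Qed.

(** [x^st ** x] is a real multiple of [p (rep i)], and only its sign matters after scaling. A
    negative sign is excluded without a theory of positive elements: as [p i] and [p (rep i)] are
    orthogonal, [c = p (rep i) + w] would satisfy [c^st ** c = 0]. *)
Lemma partial_isometry i : exists v,
  [/\ p i ** v = v, v ** p (rep i) = v, v^st ** v = p (rep i) & v ** v^st = p i].
Proof.
have [e|ne] := eqVneq (rep i) i; first by exists (p i); rewrite e proj_star !proj_idem.
have [x [e1 e2 x0]] := linked_rep i.
have [e3 e4] := sub_star e1 e2.
have [t et tr] := star_mul_scalar e1 e2.
pose a := complex.Re t.
have ta : t = a%:C%C.
  rewrite /a; move: tr; case: (t) => u w /eqP; rewrite eq_complex /= => /andP[_ /eqP h].
  by congr Complex; move: h; lra.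
have a0 : a != 0.
  apply: contraNneq x0 => h; apply/eqP/bproper; by rewrite et ta h scale0r.
pose s := (Num.sqrt `|a|)^-1.
have s2 : s * s = `|a|^-1.
  by rewrite /s -invfM -expr2 sqr_sqrtr.
pose w := s%:C%C *: x.
have ew : w^st ** w = (s * s * a)%:C%C *: p (rep i).
  rewrite /w cs_starZ bmulZl bmulZr et ta !scalerA; congr (_ *: _).
  have -> : s%:C%C^* = s%:C%C :> C by exact: conjc_real.
  by rewrite !rmorphM.
have w1 : p i ** w = w by rewrite /w bmulZr e1.
have w2 : w ** p (rep i) = w by rewrite /w bmulZl e2.
have [w3 w4] := sub_star w1 w2.
have [an|ap] := ltP a 0.
  have pw0 : p (rep i) ** w = 0 by rewrite -w1 cs_mulA proj_orth // bmul0l.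
  have wp0 : w^st ** p (rep i) = 0 by rewrite -w4 -cs_mulA proj_orth 1?eq_sym // bmul0r.
  have ew' : w^st ** w = - p (rep i).
    rewrite ew s2 ltr0_norm // -scaleN1r; congr (_ *: _).
    by rewrite invrN mulNr mulVf // rmorphN rmorph1.
  have : p (rep i) + w = 0.
    apply: bproper; rewrite cs_starD proj_star bmulDl !bmulDr proj_idem pw0 wp0 ew'.
    by rewrite addr0 add0r subrr.
  move/(congr1 (fun y => p (rep i) ** y)); rewrite bmulDr proj_idem pw0 addr0 bmul0r => /eqP.
  by rewrite (negPf (proj_neq0 _)).
have ew' : w^st ** w = p (rep i).
  rewrite ew s2 ger0_norm // mulVf // ?scale1r //.
exists w; split=> //.
have [u eu _] := star_mul_scalar w3 w4; rewrite cs_starK in eu.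
have u0 : u != 0.
  apply: contraNneq (proj_neq0 (rep i)) => h.
  have : w^st = 0 by apply: bproper; rewrite cs_starK eu h scale0r.
  by rewrite -ew' => ->; rewrite bmul0l.
have uu : u * u = u.
  have e5 : (u *: p i) ** (u *: p i) = u *: p i by rewrite -eu cs_mulA -(cs_mulA w) ew' w2.
  by apply: (@pZ_inj i) => /=; rewrite -[RHS]e5 bmulZl bmulZr proj_idem scalerA.
by rewrite eu; have -> : u = 1 by [apply: (mulfI u0); rewrite uu mulr1]; rewrite scale1r.
Qed.

Lemma linked_cut i j x : p i ** x ** p j != 0 -> linked i j.
Proof.
move=> h; exists (p i ** x ** p j); split=> //; first by rewrite !cs_mulA proj_idem.
by rewrite -cs_mulA proj_idem.
Qed.

Lemma bnorm_ge0 x : 0 <= cs_norm x.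
Proof. exact: (nrm_ge0 (@cs_normD R B) (@cs_normZ R B)). Qed.

(** The matrix units are the products of [v i] with [(v j)^st], and [F x i j] is the coefficient of
    [(v i)^st ** x ** v j] at [p (rep i)]. Colouring by [rep] avoids sorting the indices into
    blocks. The bound on the entries prepares the comparison of the two norms. *)
Lemma wedderburn_units : exists (d : 'I_n -> 'I_n) (F : B -> 'M[C]_n) (G : 'M[C]_n -> B) (e : R),
  [/\ [/\ forall x, inA d (F x), forall x, G (F x) = x & forall X, inA d X -> F (G X) = X],
    [/\ forall x y, F (x + y) = F x + F y, forall (t : C) x, F (t *: x) = t *: F x,
      forall x y, F (x ** y) = F x *m F y & forall x, F x^st = (cj (F x))^T] &
    forall x i j, normc (F x i j) <= e * cs_norm x].
Proof.
have /choice[v Hv] := partial_isometry.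
have v1 i : p i ** v i = v i by have [] := Hv i.
have v2 i : v i ** p (rep i) = v i by have [] := Hv i.
have v3 i : (v i)^st ** v i = p (rep i) by have [] := Hv i.
have v4 i : v i ** (v i)^st = p i by have [] := Hv i.
have v5 i : p (rep i) ** (v i)^st = (v i)^st by have [] := sub_star (v1 i) (v2 i).
have v6 i : (v i)^st ** p i = (v i)^st by have [] := sub_star (v1 i) (v2 i).
have cut i j x : (v i)^st ** x ** v j = p (rep i) ** ((v i)^st ** x ** v j) ** p (rep j).
  by rewrite !cs_mulA v5 -[RHS]cs_mulA v2.
have /choice[f0 Hf0] : forall u : 'I_n * 'I_n * B, exists t : C,
    (v u.1.1)^st ** u.2 ** v u.1.2 = t *: p (rep u.1.1) /\
    (rep u.1.1 != rep u.1.2 -> t = 0).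
  move=> [[i j] x] /=; have [e|ne] := eqVneq (rep i) (rep j).
    have [t et] := Hmin (rep i) ((v i)^st ** x ** v j).
    by exists t; rewrite cut -e et.
  exists 0; split=> //; rewrite scale0r cut; apply/eqP/negPn/negP => /linked_cut h.
  case/eqP: ne; apply: rep_linked.
  exact: linked_trans (linked_rep i) (linked_trans h (linked_sym (linked_rep j))).
pose f i j x := f0 (i, j, x).
have Hf i j x : (v i)^st ** x ** v j = f i j x *: p (rep i) by have [] := Hf0 (i, j, x).
have fne i j x : rep i != rep j -> f i j x = 0 by have [] := Hf0 (i, j, x).
have funi i j x (t : C) : (v i)^st ** x ** v j = t *: p (rep i) -> f i j x = t.
  by rewrite Hf => /pZ_inj.
have Hf' i j x : (v i)^st ** x ** v j = f i j x *: p (rep j).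
  by rewrite Hf; have [->//|ne] := eqVneq (rep i) (rep j); rewrite fne // !scale0r.
pose G (X : 'M[C]_n) : B := \sum_i \sum_j X i j *: (v i ** (v j)^st).
pose F x : 'M[C]_n := \matrix_(i, j) f i j x.
have vv k i : k != i -> (v k)^st ** v i = 0.
  by move=> ki; rewrite -(v6 k) -(v1 i) -cs_mulA (cs_mulA (p k)) proj_orth // bmul0l bmul0r.
pose e := \sum_i \sum_j (cs_norm (p (rep i)))^-1 * (cs_norm (v i)^st * cs_norm (v j)).
exists rep, F, G, e; split; first split.
- by move=> x i j ij; rewrite mxE fne.
- move=> x; rewrite -[RHS]Hl; apply: eq_bigr => i _; rewrite -[RHS]Hr; apply: eq_bigr => j _.
  have -> : p i ** x ** p j = v i ** ((v i)^st ** x ** v j) ** (v j)^st.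
    by rewrite -(v4 i) -(v4 j) !cs_mulA.
  by rewrite mxE Hf bmulZr v2 bmulZl.
- move=> X hX; apply/matrixP => k l; rewrite mxE; apply: funi.
  have -> : (v k)^st ** G X ** v l =
      \sum_i \sum_j X i j *: (((v k)^st ** v i) ** ((v j)^st ** v l)).
    rewrite /G bmul_sumr bmul_suml; apply: eq_bigr => i _.
    rewrite bmul_sumr bmul_suml; apply: eq_bigr => j _.
    by rewrite bmulZr bmulZl !cs_mulA.
  rewrite (bigD1 k) //= [X in _ + X]big1 ?addr0 => [|i ik]; last first.
    by rewrite big1 // => j _; rewrite vv 1?eq_sym // bmul0l scaler0.
  rewrite (bigD1 l) //= big1 ?addr0 => [|j jl]; last by rewrite (vv j l jl) bmul0r scaler0.
  rewrite !v3.
  have [->|kl] := eqVneq (rep k) (rep l); first by rewrite proj_idem.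
  by rewrite hX // !scale0r.
- split.
  + move=> x y; apply/matrixP => i j; rewrite !mxE; apply: funi.
    by rewrite bmulDr bmulDl !Hf scalerDl.
  + move=> t x; apply/matrixP => i j; rewrite !mxE; apply: funi.
    by rewrite bmulZr bmulZl Hf scalerA.
  + move=> x y; apply/matrixP => i k; rewrite !mxE; apply: funi.
    rewrite -{1}[x]Hr bmul_suml bmul_sumr bmul_suml scaler_suml; apply: eq_bigr => j _.
    have -> : (v i)^st ** (x ** p j ** y) ** v k = ((v i)^st ** x ** v j) ** ((v j)^st ** y ** v k).
      by rewrite -(v4 j) !cs_mulA.
    rewrite (Hf' i j) (Hf j k) bmulZl bmulZr proj_idem scalerA.
    rewrite !mxE mulrC.
    by have [->//|ne] := eqVneq (rep i) (rep j); rewrite (fne _ _ x ne) ?mul0r ?mulr0 !scale0r.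
  move=> x; apply/matrixP => i j; rewrite !mxE; apply: funi.
  have -> : (v i)^st ** x^st ** v j = ((v j)^st ** x ** v i)^st.
    by rewrite !cs_starM cs_starK cs_mulA.
  by rewrite Hf' cs_starZ proj_star.
move=> x i j.
have pn : 0 < cs_norm (p (rep i)).
  by rewrite lt_def bnorm_ge0 andbT; apply: contra (proj_neq0 (rep i)) => /eqP/cs_norm_eq0 ->.
pose t k l : R := (cs_norm (p (rep k)))^-1 * (cs_norm (v k)^st * cs_norm (v l)).
have t0 k l : 0 <= t k l by rewrite mulr_ge0 ?invr_ge0 ?bnorm_ge0 // mulr_ge0 ?bnorm_ge0.
have te : t i j <= e.
  rewrite /e (bigD1 i) //= (bigD1 j) //= -/(t i j) -addrA lerDl.
  apply: addr_ge0; apply: sumr_ge0 => k _; first exact: t0.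
  by apply: sumr_ge0 => l _; exact: t0.
apply: (@le_trans _ _ (t i j * cs_norm x)); last by rewrite ler_wpM2r ?bnorm_ge0.
rewrite mxE -(ler_pM2r pn) -cs_normZ -Hf.
have -> : t i j * cs_norm x * cs_norm (p (rep i)) = cs_norm (v i)^st * cs_norm x * cs_norm (v j).
  by rewrite /t; field; rewrite gt_eqF.
apply: (le_trans (cs_normM _ _)); rewrite ler_wpM2r ?bnorm_ge0 //.
exact: cs_normM.
Qed.

End MatrixUnits.

(** * Uniqueness of the C*-norm *)

Section NormUniqueness.
Variable R : realType.
Local Notation C := R[i].
Local Notation cj := (map_mx (@Num.conj C)).

Lemma bernoulli (e : R) n : 0 <= e -> 1 + n%:R * e <= (1 + e) ^+ n.
Proof.
move=> e0; elim: n => [|n IH]; first by rewrite mul0r addr0 expr0.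
rewrite exprS; apply: (@le_trans _ _ ((1 + e) * (1 + n%:R * e))).
  have h : 0 <= n%:R * e * e by rewrite !mulr_ge0 ?ler0n.
  have -> : (1 + e) * (1 + n%:R * e) = 1 + (n%:R + 1) * e + n%:R * e * e by ring.
  by rewrite -natr1 lerDl.
by rewrite ler_wpM2l // addr_ge0.
Qed.

(** The constant [M] disappears under [2^k]-th roots; Bernoulli's inequality replaces the limit. *)
Lemma le_of_powers (s t M : R) : 0 <= s -> 0 <= t ->
  (forall k, t ^+ (2 ^ k)%N <= M * s ^+ (2 ^ k)%N) -> t <= s.
Proof.
move=> s0 t0 H; have [//|lt] := leP t s.
have sp : s != 0.
  apply: contraTneq lt => e; rewrite -leNgt e; have := H 0.
  by rewrite !expr1 e mulr0.
have s1 : 0 < s by rewrite lt_def sp.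
pose u := t / s; have u1 : 1 < u by rewrite ltr_pdivlMr // mul1r.
have Hu k : u ^+ (2 ^ k)%N <= M by rewrite expr_div_n ler_pdivrMr ?exprn_gt0.
pose e := u - 1; have e0 : 0 < e by rewrite subr_gt0.
have ue : u = 1 + e by rewrite /e addrC subrK.
have M0 : 0 <= M by apply: (le_trans _ (Hu 0)); rewrite expr1 (le_trans ler01 (ltW u1)).
have Me : 0 <= M / e by rewrite divr_ge0 // ltW.
have := archi_boundP Me; set k := Num.bound _ => hk.
have : M < u ^+ (2 ^ k)%N.
  apply: (@lt_le_trans _ _ (1 + (2 ^ k)%N%:R * e)); last by rewrite ue bernoulli // ltW.
  rewrite ltr_wpDl // -ltr_pdivrMr //; apply: (lt_le_trans hk).
  by rewrite ler_nat; apply: ltnW; exact: ltn_expl.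
by rewrite ltNge Hu.
Qed.

Variables (B : CstarAlgebra R) (n : nat) (d : 'I_n -> 'I_n).
Variables (F : B -> 'M[C]_n) (G : 'M[C]_n -> B) (e : R).
Hypothesis FA : forall x, inA d (F x).
Hypothesis GF : forall x, G (F x) = x.
Hypothesis FG : forall X, inA d X -> F (G X) = X.
Hypothesis FD : forall x y, F (x + y) = F x + F y.
Hypothesis FZ : forall (t : C) x, F (t *: x) = t *: F x.
Hypothesis FM : forall x y, F (cs_mul x y) = F x *m F y.
Hypothesis FS : forall x, F (cs_star x) = (cj (F x))^T.
Hypothesis Fe : forall x i j, normc (F x i j) <= e * cs_norm x.

Lemma F_sum (I : Type) (s : seq I) (P : pred I) (h : I -> B) :
  F (\sum_(i <- s | P i) h i) = \sum_(i <- s | P i) F (h i).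
Proof.
apply: (big_morph F FD); by rewrite -(scale0r (0 : B)) FZ scale0r.
Qed.

Lemma entry_le_mxnorm (M : 'M[C]_n) i j : normc (M i j) <= mxnorm M.
Proof.
have := mxnorm_bil M (delta_mx i 0 : 'cV[C]_n) (delta_mx j 0 : 'cV[C]_n).
by rewrite !vnorm_delta !mulr1 -/(bf _ _ _) bf_delta.
Qed.

Lemma mxnorm_le_norm x : mxnorm (F x) <= (\sum_(i < n) \sum_(j < n) e) * cs_norm x.
Proof.
apply: (@le_trans _ _ (\sum_i \sum_j normc (F x i j))).
  apply: mxnorm_le => [|y]; last exact: vnorm_mulmx_bound.
  by apply: sumr_ge0 => i _; apply: sumr_ge0 => j _; exact: normc_ge0.
rewrite mulr_suml; apply: ler_sum => i _; rewrite mulr_suml; apply: ler_sum => j _.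
exact: Fe.
Qed.

Definition unit_of i j : B := if d i == d j then G (delta_mx i j) else 0.

Lemma norm_le_mxnorm x : cs_norm x <= (\sum_i \sum_j cs_norm (unit_of i j)) * mxnorm (F x).
Proof.
have ex : x = \sum_i \sum_j F x i j *: unit_of i j.
  rewrite -[LHS]GF -[RHS]GF; congr G; rewrite F_sum [LHS]matrix_sum_delta.
  apply: eq_bigr => i _; rewrite F_sum; apply: eq_bigr => j _; rewrite FZ /unit_of.
  case: eqVneq => [ij|ij]; last by rewrite FA // !scale0r.
  rewrite FG // => a b ab; rewrite mxE; case: (eqVneq a i) => [ai|//].
  by case: (eqVneq b j) => [bj|//]; rewrite ai bj ij eqxx in ab.
have tri (I : finType) (h : I -> B) : cs_norm (\sum_i h i) <= \sum_i cs_norm (h i).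
  elim/big_rec2: _ => [|i y z _ IH]; first by rewrite bnorm0.
  by apply: (le_trans (cs_normD _ _)); rewrite lerD2l.
rewrite {1}ex; apply: (le_trans (tri _ _)); rewrite mulr_suml; apply: ler_sum => i _.
apply: (le_trans (tri _ _)); rewrite mulr_suml; apply: ler_sum => j _.
by rewrite cs_normZ mulrC ler_wpM2l ?bnorm_ge0 // entry_le_mxnorm.
Qed.

Lemma norm_selfadjoint a : cs_star a = a -> cs_norm a = mxnorm (F a).
Proof.
move=> sa; pose sq (x : B) := cs_mul x x.
have Hs k : [/\ cs_star (iter k sq a) = iter k sq a,
    cs_norm (iter k sq a) = cs_norm a ^+ (2 ^ k)%N &
    mxnorm (F (iter k sq a)) = mxnorm (F a) ^+ (2 ^ k)%N].
  elim: k => [|k [h1 h2 h3]]; first by rewrite !expr1.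
  rewrite iterS; set x := iter k sq a in h1 h2 h3 *.
  have fx : (cj (F x))^T = F x by rewrite -FS h1.
  rewrite expnS mulnC !exprM -h2 -h3; split; first by rewrite cs_starM h1.
    by rewrite /sq -{1}h1 cs_Cstar.
  by rewrite /sq FM -{1}fx mxnorm_Cstar.
apply: le_anti; apply/andP; split; apply: le_of_powers; rewrite ?bnorm_ge0 ?mxnorm_ge0 //.
  by move=> k; have [_ <- <-] := Hs k; exact: norm_le_mxnorm.
by move=> k; have [_ <- <-] := Hs k; exact: mxnorm_le_norm.
Qed.

Lemma norm_unique x : cs_norm x = mxnorm (F x).
Proof.
have /eqP : cs_norm x ^+ 2 = mxnorm (F x) ^+ 2.
  rewrite -cs_Cstar norm_selfadjoint; last by rewrite cs_starM cs_starK.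
  by rewrite FM FS mxnorm_Cstar.
by rewrite eqrXn2 ?bnorm_ge0 ?mxnorm_ge0 // => /eqP.
Qed.

End NormUniqueness.

(** * Block diagonal matrices *)

Section Blocks.
Variables (R : realType) (l : nat) (n : 'I_l -> nat).
Local Notation C := R[i].
Local Notation cj := (map_mx (@Num.conj C)).
Local Notation N := (bdN n).
Implicit Types (X Y : BD R n) (M : 'M[C]_N).

Definition blkcol (s : 'I_N) : 'I_l := tagnat.sig1 s.
Definition unblk M : BD R n := fun k => submxblock M k k.

Lemma blkK X : unblk (blk X) = X.
Proof. by apply: functional_extensionality_dep => k; exact: submxblock_diag. Qed.

Lemma blk_inA X : inA blkcol (blk X).
Proof.
move=> s t st; rewrite mxE -/(blkcol s) -/(blkcol t).
by case: eqVneq st => // _ _; rewrite mxE.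
Qed.

Lemma unblkK M : inA blkcol M -> blk (unblk M) = M.
Proof.
move=> hM; rewrite -[RHS]submxblockK; apply/eq_mxblock => i j.
case: eqVneq => [->|ij]; first by rewrite conform_mx_id.
by apply/matrixP => a b; rewrite !mxE hM // /blkcol !tagnat.Rank1K.
Qed.

Lemma unblk_inj M M' : inA blkcol M -> inA blkcol M' -> unblk M = unblk M' -> M = M'.
Proof. by move=> hM hM' e; rewrite -(unblkK hM) e unblkK. Qed.

Lemma blkD X Y : blk (bd_add X Y) = blk X + blk Y.
Proof. exact: mxdiagD. Qed.

Lemma blkZ (a : C) X : blk (bd_scale a X) = a *: blk X.
Proof.
apply: unblk_inj; [exact: blk_inA | exact/inAZ/blk_inA | rewrite blkK].
apply: functional_extensionality_dep => k; rewrite /bd_scale -{1}(blkK X).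
by apply/matrixP => i j; rewrite !mxE.
Qed.

Lemma blkM X Y : blk (bd_mul X Y) = blk X *m blk Y.
Proof.
rewrite [in RHS]/blk {2}/mxdiag mul_mxdiag_mxblock; apply/eq_mxblock => i j.
case: eqVneq => [e|ij]; last by rewrite mulmx0.
by case: _ / e; rewrite !conform_mx_id.
Qed.

Lemma blk_star X : blk (bd_star X) = (cj (blk X))^T.
Proof.
have h : inA blkcol (cj (blk X))^T.
  by move=> s t st; rewrite 2!mxE blk_inA ?conjC0 // eq_sym.
apply: unblk_inj => //; [exact: blk_inA | rewrite blkK].
apply: functional_extensionality_dep => k; rewrite /bd_star -{1}(blkK X).
by apply/matrixP => i j; rewrite !mxE.
Qed.

Lemma unblk_dg (p : 'I_l -> C) M k : unblk (dg blkcol p M) k = p k *: unblk M k.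
Proof. by apply/matrixP => i j; rewrite !mxE /blkcol tagnat.Rank1K. Qed.

Lemma blk_scalars (p : 'I_l -> C) X :
  blk (bd_mul (fun k => (p k)%:M) X) = dg blkcol p (blk X).
Proof.
apply: unblk_inj; [exact: blk_inA | exact/inA_dg/blk_inA | rewrite blkK].
by apply: functional_extensionality_dep => k; rewrite unblk_dg blkK /bd_mul mul_scalar_mx.
Qed.

Lemma posdef_scalars (p : 'I_l -> R) : (forall k, 0 < p k) ->
  posdef (blk (fun k => ((p k)%:C%C)%:M : 'M[C]_(n k))).
Proof.
move=> p0 x x0.
have -> : blk (fun k => ((p k)%:C%C)%:M : 'M[C]_(n k)) = dg blkcol (fun k => (p k)%:C%C) 1%:M.
  rewrite -(mxdiagZ (p_ := n) (1 : C)) -blk_scalars; congr blk.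
  by apply: functional_extensionality_dep => k; rewrite /bd_mul mulmx1.
have -> : ((cj x)^T *m dg blkcol (fun k => (p k)%:C%C) 1%:M *m x) 0 0 =
    (\sum_s p (blkcol s) * normc (x s 0) ^+ 2)%:C%C.
  rewrite -mulmxA mxE rmorph_sum; apply: eq_bigr => s _; rewrite !mxE (bigD1 s) //= big1.
    rewrite !mxE eqxx mulr1n mulr1 addr0 mulrCA mulC_conj.
    exact/esym/(rmorphM (real_complex R)).
  by move=> t ts; rewrite !mxE eq_sym (negPf ts) mulr0n mulr0 mul0r.
rewrite ltcR lt_def sumr_ge0 ?andbT => [|s _]; last by rewrite mulr_ge0 ?sqr_ge0 // ltW.
apply: contra x0 => /eqP h; apply/eqP/matrixP => s j; rewrite ord1 mxE.
move/eqP: h; rewrite psumr_eq0 => [/allP/(_ s)|t _]; last by rewrite mulr_ge0 ?sqr_ge0 // ltW.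
by rewrite mem_index_enum => /(_ isT); rewrite mulf_eq0 gt_eqF //= sqrf_eq0 normc_eq0 => /eqP.
Qed.

Lemma blkcol_ge2 : (forall k, (2 <= n k)%N) -> forall s, exists2 t, t != s & blkcol t = blkcol s.
Proof.
move=> n2 s; pose k := tagnat.sig1 s; pose a : 'I_(n k) := tagnat.sig2 s.
have [b ba] : exists b : 'I_(n k), b != a.
  have n0 : (0 < n k)%N by apply: ltnW; exact: n2.
  have [a0|a0] := eqVneq (a : nat) 0%N.
    by exists (Ordinal (n2 k)); rewrite -val_eqE /= a0.
  by exists (Ordinal n0); rewrite -val_eqE /= eq_sym.
exists (tagnat.Rank _ b); last by rewrite /blkcol tagnat.Rank1K.
apply: contra ba => /eqP e.
have : (tagnat.Rank _ b == tagnat.Rank _ a :> nat) by rewrite e /a tagnat.sig2K.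
by rewrite tagnat.eq_Rank eqxx.
Qed.

End Blocks.

(** * Transfer to the codomain and conclusion *)

Section Transport.
Variables (R : realType) (l : nat) (n : 'I_l -> nat) (B : CstarAlgebra R) (Phi : BD R n -> B).
Local Notation C := R[i].
Local Notation cj := (map_mx (@Num.conj C)).
Local Notation N := (bdN n).
Implicit Types (X Y : BD R n) (M : 'M[C]_N).
Hypothesis HBJ : forall X Y, BJ_orth (@bd_add R l n) (@bd_scale R l n) (@bd_norm R l n) X Y <->
  BJ_orth +%R *:%R (@cs_norm R B) (Phi X) (Phi Y).
Hypothesis Phi_bij : bijective Phi.

Lemma bd_BJ X Y : BJ_orth (@bd_add R l n) (@bd_scale R l n) (@bd_norm R l n) X Y <->
  BJ (blk X) (blk Y).
Proof.
by split=> H lam; have := H lam; rewrite /bd_norm blkD blkZ.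
Qed.

(** There is one linear condition for each pair [(i, j)], so one more vector than pairs forces a
    nontrivial combination [y] to which every [Phi] of a matrix unit is orthogonal. All entries of
    the preimage of [y] then vanish. That [Phi] sends zero to zero is not known beforehand; it
    follows since zero is orthogonal to itself and [y] orthogonal to [y] gives [y = 0]. *)
Lemma codomain_finite (v : 'I_#|{: 'I_N * 'I_N}|.+1 -> B) :
  exists z : 'I_#|{: 'I_N * 'I_N}|.+1 -> C, (exists i, z i != 0) /\ \sum_i z i *: v i = 0.
Proof.
have [z [z0 Hz]] := common_kernel (@cs_normD R B) (@cs_normZ R B)
  (fun s : 'I_N * 'I_N => Phi (unblk (delta_mx s.1 s.2))) v (ltnSn _).
exists z; split=> //; set y := \sum_i _ in Hz *.
have [Phi' PhiK Phi'K] := Phi_bij; pose Y := Phi' y.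
have eY : Phi Y = y by exact: Phi'K.
have bY : blk Y = 0.
  apply/matrixP => i j; rewrite [RHS]mxE.
  have [ij|ij] := eqVneq (blkcol i) (blkcol j); last exact: (blk_inA Y ij).
  have hD : inA (@blkcol l n) (delta_mx i j : 'M[C]_N).
    move=> s t st; rewrite mxE; case: (eqVneq s i) => [si|//].
    by case: (eqVneq t j) => [tj|//]; rewrite si tj ij eqxx in st.
  have h : BJ (delta_mx i j) (blk Y).
    have h : BJ_orth +%R *:%R (@cs_norm R B) (Phi (unblk (delta_mx i j))) (Phi Y).
      by rewrite eY; exact: (Hz (i, j)).
    by have := (bd_BJ _ _).1 ((HBJ _ _).2 h); rewrite (unblkK hD).
  have d0 (k : 'I_N) : (delta_mx k 0 : 'cV[C]_N) != 0.
    by rewrite -vnorm_eq0 vnorm_delta oner_eq0.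
  rewrite -bf_delta; apply/(BJ_rank1 _ (d0 i) (d0 j)).
  have -> : cj ((delta_mx i 0 : 'cV[C]_N) *m (delta_mx j 0)^T) = delta_mx i j.
    rewrite trmx_delta mul_delta_mx; apply/matrixP => s t; rewrite !mxE.
    by case: (_ && _); rewrite /= ?conjC1 ?conjC0.
  exact: h.
have h : BJ_orth +%R *:%R (@cs_norm R B) y y.
  by rewrite -eY; apply: (HBJ _ _).1; apply: (bd_BJ _ _).2; rewrite bY; exact: BJ0l.
have := h (-1); rewrite scaleN1r subrr bnorm0 => y0.
by apply: cs_norm_eq0; apply: le_anti; rewrite y0 bnorm_ge0.
Qed.

End Transport.

Theorem theorem1p1 (R : realType) (l : nat) (n : 'I_l -> nat)
  (B : CstarAlgebra R) (Phi : BD R n -> B) :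
  (forall k : 'I_l, (2 <= n k)%N) ->
  BJ_isomorphism (@bd_add R l n) (@bd_scale R l n) (@bd_norm R l n)
                 +%R *:%R (@cs_norm R B) Phi ->
  star_isomorphic n B /\
  exists (Psi : BD R n -> B) (gamma : BD R n -> R[i]) (P : BD R n -> BD R n),
    [/\ real_linear_surj_isometry Psi,
        forall X, ComplexField.Normc.normc (gamma X) = 1,
        forall X, in_center (P X) /\ posdef (blk (P X)) /\
                  M0 X = M0 (bd_mul (P X) X) &
        forall X, Phi X = Psi (bd_scale (gamma X) (bd_mul (P X) X))].
Proof.
move=> n2 [Phi_bij HBJ]; have [Phi' PhiK Phi'K] := Phi_bij.
have [r [p [Hfam Hmin Hl Hr]]] := minimal_projections (codomain_finite HBJ Phi_bij).
have [d [F [G [e [[FA GF FG] [FD FZ FM FS] Fe]]]]] := wedderburn_units Hfam Hmin Hl Hr.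
have Fn x : cs_norm x = mxnorm (F x) by exact: (norm_unique FA GF FG FD FZ FM FS Fe).
have c2 := blkcol_ge2 n2.
have HP : BJpair (@blkcol l n) d (fun M => F (Phi (unblk M))) (fun Z => blk (Phi' (G Z))).
  split=> [X hX|Z hZ|X hX|Z hZ|X Y hX hY].
  - exact: FA.
  - exact: blk_inA.
  - by rewrite GF PhiK unblkK.
  - by rewrite blkK Phi'K FG.
  rewrite -{1}(unblkK hX) -{1}(unblkK hY); apply: (iff_trans (iff_sym (bd_BJ _ _))).
  apply: (iff_trans (HBJ _ _)).
  by split=> H lam; have := H lam; rewrite !Fn FD FZ.
have GD X Y : inA d X -> inA d Y -> G (X + Y) = G X + G Y.
  by move=> hX hY; rewrite -[RHS]GF FD !FG.
have GZ t X : inA d X -> G (t *: X) = t *: G X.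
  by move=> hX; rewrite -[RHS]GF FZ FG.
have [U [ell [Ps [gamma [q [[U1 U2 sU hell] [PsD PsZ Psn PsA Pss] gamma1 q0 Hcore]]]]]] :=
  BJ_structure HP c2.
split.
  (* Conjugation by [U] alone matches the blocks and respects products and adjoints; the isometry
     [Psi], with its two unitaries and its twists, need not do so. *)
  have hA (X : BD R n) : inA d (U *m blk X *m ((map_mx Num.conj U)^T)).
    by apply: (inA_conjugate hell sU (supp_col_conj sU)); exact: blk_inA.
  exists (fun X => G (U *m blk X *m ((map_mx Num.conj U)^T))); split.
  - exists (fun y => unblk ((map_mx Num.conj U)^T *m F y *m U)) => [X|y].
      by rewrite FG // !mulmxA U1 mul1mx -mulmxA U1 mulmx1 blkK.
    rewrite unblkK; first by rewrite !mulmxA U2 mul1mx -mulmxA U2 mulmx1 GF.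
    by apply: (inA_pull hell (supp_col_conj sU) sU).
  - by move=> X Y; rewrite blkD mulmxDr mulmxDl GD.
  - by move=> t X; rewrite blkZ -scalemxAr -scalemxAl GZ.
  - move=> X Y; rewrite -[RHS]GF FM !FG // blkM !mulmxA.
    by rewrite -(mulmxA _ _ U) U1 mulmx1.
  move=> X; rewrite -[RHS]GF FS FG // blk_star; congr G.
  by rewrite !map_mxM !trmx_mul -map_trmx map_conjK trmxK mulmxA.
pose P (X : BD R n) : BD R n := fun k => ((q (blk X) k)%:C%C)%:M.
have eP X : blk (bd_mul (P X) X) = dg (@blkcol l n) (fun k => (q (blk X) k)%:C%C) (blk X).
  exact: blk_scalars.
exists (fun X => G (Ps (blk X))), (fun X => gamma (blk X)), P; split.
- split=> [X Y|t X|X|y].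
  + by rewrite blkD PsD GD.
  + by rewrite blkZ PsZ GZ.
  + by rewrite Fn FG // Psn //; exact: blk_inA.
  have [M hM eM] := Pss _ (FA y); exists (unblk M); by rewrite unblkK // eM GF.
- by move=> X; exact: gamma1.
- move=> X; split; first by move=> k; exists (q (blk X) k)%:C%C.
  split; first exact/posdef_scalars/q0.
  have [Hmax _] := Hcore _ (blk_inA X).
  apply/seteqP; split=> x; rewrite /M0 /bd_norm /= eP => Hx.
    exact: ((Hmax x).1 Hx).
  exact: ((Hmax x).2 Hx).
move=> X; have [_ eX] := Hcore _ (blk_inA X).
by rewrite -[LHS]GF -{1}(blkK X) eX blkZ eP.
Qed.
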